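(* Let $\pi : A\to M$ be a differentiable vector bundle, let $(A,[\![\cdot,\cdot]\!],\rho)$ be a Lie algebroid over $M$, let $\pi^\ast : A^\ast\to M$ be the dual vector bundle, and let $\phi\in\Gamma(A^\ast)$ be a 1-cocycle of the Lie algebroid. Then there is a unique Jacobi structure $(\Lambda_{(A^\ast,\phi)},E_{(A^\ast,\phi)})$ on the manifold $A^\ast$ whose Jacobi bracket $\{\cdot,\cdot\}_{(A^\ast,\phi)}$ satisfies $$\{\tilde\mu,\tilde\eta\}_{(A^\ast,\phi)}=\widetilde{[\![\mu,\eta]\!]},\qquad \{\tilde\mu,\bar f\circ\pi^\ast\}_{(A^\ast,\phi)}=\bigl(\rho(\mu)(\bar f)+\phi(\mu)\bar f\bigr)\circ\pi^\ast,\qquad \{\bar f\circ\pi^\ast,\bar g\circ\pi^\ast\}_{(A^\ast,\phi)}=0,$$ for all $\mu,\eta\in\Gamma(A)$ and $\bar f,\bar g\in C^\infty(M,\mathbb{R})$. This Jacobi structure is given by $$\Lambda_{(A^\ast,\phi)}=\Lambda_{A^\ast}+\Delta\wedge\phi^v,\qquad E_{(A^\ast,\phi)}=-\phi^v .$$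
   Context: All manifolds, bundles, sections and functions are $C^\infty$. $\Gamma(A)$ is the space of global sections of $A$, and $\mathfrak{X}(M)$ is the Lie algebra of vector fields on $M$. Jacobi structure: a pair $(\Lambda,E)$ on a manifold $N$, with $\Lambda$ a 2-vector (bivector field) and $E$ a vector field, such that $[\Lambda,\Lambda]_{SN}=2E\wedge\Lambda$ and $[E,\Lambda]_{SN}=0$, where $[\cdot,\cdot]_{SN}$ is the Schouten-Nijenhuis bracket. Its Jacobi bracket is $\{F,G\}=\Lambda(dF,dG)+F\,E(G)-G\,E(F)$ for $F,G\in C^\infty(N,\mathbb{R})$. The sign convention for the Schouten-Nijenhuis bracket is the one for which $(\Lambda,E)$ is a Jacobi structure if and only if $\{\cdot,\cdot\}$ satisfies the Jacobi identity. Wedge convention: $(X\wedge Y)(\alpha,\beta)=\alpha(X)\beta(Y)-\alpha(Y)\beta(X)$. A Poisson structure is a Jacobi structure with $E=0$. Lie algebroid structure on $\pi:A\to M$: a pair $([\![\cdot,\cdot]\!],\rho)$ consisting of a (real) Lie algebra bracket $[\![\cdot,\cdot]\!]$ on $\Gamma(A)$ and a vector bundle homomorphism $\rho:A\to TM$ (the anchor map; the induced $C^\infty(M,\mathbb{R})$-module map $\Gamma(A)\to\mathfrak{X}(M)$ is also denoted $\rho$) such that $\rho:\Gamma(A)\to\mathfrak{X}(M)$ is a Lie algebra homomorphism and $[\![\mu,\bar f\eta]\!]=\bar f[\![\mu,\eta]\!]+(\rho(\mu)(\bar f))\eta$ for all $\mu,\eta\in\Gamma(A)$, $\bar f\in C^\infty(M,\mathbb{R})$.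 1-cocycle: a section $\phi\in\Gamma(A^\ast)$ with $\phi([\![\mu,\eta]\!])=\rho(\mu)(\phi(\eta))-\rho(\eta)(\phi(\mu))$ for all $\mu,\eta\in\Gamma(A)$. For $\mu\in\Gamma(A)$, $\tilde\mu\in C^\infty(A^\ast,\mathbb{R})$ is the associated fibrewise linear function, $\tilde\mu(\alpha)=\alpha(\mu(\pi^\ast(\alpha)))$. Local coordinates: let $(x^1,\dots,x^m)$ be coordinates on an open set $U\subseteq M$, $\{e_i\}_{i=1,\dots,n}$ a local basis of sections of $A$ over $U$ with dual basis $\{e^i\}$, and $(x^i,\mu_j)$ the induced coordinates on $(\pi^\ast)^{-1}(U)$, with $\mu_j=\tilde e_j$. Write $[\![e_i,e_j]\!]=\sum_k c_{ij}^k e_k$ and $\rho(e_i)=\sum_l\rho_i^l\,\partial/\partial x^l$. $\Lambda_{A^\ast}$ is the Poisson structure on $A^\ast$ induced by the Lie algebroid structure, given locally by $$\Lambda_{A^\ast}=\sum_{i<j}\sum_k c_{ij}^k\mu_k\frac{\partial}{\partial\mu_i}\wedge\frac{\partial}{\partial\mu_j}+\sum_{i,l}\rho_i^l\frac{\partial}{\partial\mu_i}\wedge\frac{\partial}{\partial x^l}.$$ $\Delta$ is the Liouville vector field of $A^\ast$, locally $\Delta=\sum_i\mu_i\,\partial/\partial\mu_i$. $\phi^v\in\mathfrak{X}(A^\ast)$ is the vertical lift of $\phi$: if $\phi=\sum_i\phi_i e^i$ locally, then $\phi^v=\sum_i\phi_i\,\partial/\partial\mu_i$ (with $\phi_i$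 regarded as a function on $(\pi^\ast)^{-1}(U)$ by composition with $\pi^\ast$, and similarly for $c_{ij}^k,\rho_i^l$). *)

(* Defs.v *)
From HB Require Import structures.
From mathcomp Require Import all_boot all_order all_algebra.
From mathcomp Require Import mathcomp_extra boolp classical_sets functions.
From mathcomp Require Import reals topology normedtype derive.
Set Implicit Arguments.
Unset Strict Implicit.
Unset Printing Implicit Defensive.
Import Order.TTheory GRing.Theory Num.Theory numFieldNormedType.Exports.
Local Open Scope classical_set_scope.
Local Open Scope ring_scope.

Section Calculus.
Variable R : realType.

(* Functions of class C^k and C^infinity on an open subset of R^n, by iterated
   partial derivatives; the values outside of the open set are irrelevant. *)
Fixpoint Ck (k : nat) n (U : set 'rV[R]_n) (f : 'rV[R]_n -> R) : Prop :=
  (forall x, U x -> {for x, continuous f}) /\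
  (if k is k'.+1 then
     forall i : 'I_n, (forall x, U x -> derivable f x (delta_mx 0 i)) /\
                      Ck k' U (fun x => 'D_(delta_mx 0 i) f x)
   else True).

Definition smooth n (U : set 'rV[R]_n) (f : 'rV[R]_n -> R) := forall k, Ck k U f.

Lemma Ck_cont k n (U : set 'rV[R]_n) f x : Ck k U f -> U x -> {for x, continuous f}.
Proof. by case: k => [|k] [+ _]; apply. Qed.

Lemma Ck_pred k n (U : set 'rV[R]_n) f : Ck k.+1 U f -> Ck k U f.
Proof.
elim: k f => [|k IH] f [fc fd]; split => // i.
by have [fi fdi] := fd i; split => //; apply: IH.
Qed.

Lemma Ck_local k n (U : set 'rV[R]_n) f :
  (forall x, U x -> exists2 V : set 'rV[R]_n, V x & Ck k V f) -> Ck k U f.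
Proof.
elim: k f => [|k IH] f H; split => //; try by move=> x /H[V Vx /Ck_cont]; apply.
move=> i; split; first by move=> x /H[V Vx [_ /(_ i)[+ _]]]; apply.
by apply: IH => x /H[V Vx [_ /(_ i)[_ ?]]]; exists V.
Qed.

Lemma Ck_sub k n (U V : set 'rV[R]_n) f : V `<=` U -> Ck k U f -> Ck k V f.
Proof. by move=> VU Uf; apply: Ck_local => x /VU Ux; exists U. Qed.

Lemma Ck_congr k n (U : set 'rV[R]_n) f g : open U ->
  (forall x, U x -> f x = g x) -> Ck k U f -> Ck k U g.
Proof.
move=> oU fg0.
have cfg f' g' k' : (forall x, U x -> f' x = g' x) -> Ck k' U f' ->
    forall x, U x -> {for x, continuous g'}.
  move=> fg fk x Ux; have := Ck_cont fk Ux.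
  rewrite /prop_for /continuous_at -fg//; apply: cvg_trans.
  have := @near_eq_cvg _ _ (nbhs x) _ f' g'; apply.
  by apply: filterS (open_nbhs_nbhs (conj oU Ux)) => y /fg.
elim: k f g fg0 => [|k IH] f g fg fk; split => //; try exact: cfg fg fk.
have nfg x : U x -> \near x, f x = g x.
  by move=> Ux; apply: filterS (open_nbhs_nbhs (conj oU Ux)) => y /fg.
move=> i.
case: fk => _ fd; have [fi fdi] := fd i; split.
  by move=> x Ux; apply: near_eq_derivable (fi _ Ux); exact: nfg.
apply: (IH _ _ _ fdi) => x Ux; apply: near_eq_derive; exact: nfg.
Qed.

Lemma Ck_cst k n (U : set 'rV[R]_n) (a : R) : Ck k U (fun=> a).
Proof.
elim: k a => [|k IH] a; split => //; try by move=> x _; exact: cst_continuous.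
move=> i; split; first by move=> x _; exact: derivable_cst.
rewrite (_ : 'D__ _ = fun=> 0); first exact: IH.
by apply/funext => x; exact: derive_cst.
Qed.

Lemma Ck_add k n (U : set 'rV[R]_n) f g : open U ->
  Ck k U f -> Ck k U g -> Ck k U (fun x => f x + g x).
Proof.
move=> oU; have cfg k' f' g' : Ck k' U f' -> Ck k' U g' ->
    forall x, U x -> {for x, continuous (fun x => f' x + g' x)}.
  by move=> fk gk x Ux; apply: continuousD; [exact: Ck_cont fk Ux|exact: Ck_cont gk Ux].
elim: k f g => [|k IH] f g fk gk; (split; first exact: cfg fk gk) => //.
case: fk gk => _ fd [_ gd] i; have [fi fdi] := fd i; have [gi gdi] := gd i.
split; first by move=> x Ux; apply: derivableD; [exact: fi|exact: gi].
apply: (@Ck_congr _ _ _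
  (fun x => 'D_(delta_mx 0 i) f x + 'D_(delta_mx 0 i) g x)) => //; last exact: IH.
by move=> x Ux; rewrite deriveD//; [exact: fi|exact: gi].
Qed.

Lemma Ck_mul k n (U : set 'rV[R]_n) f g : open U ->
  Ck k U f -> Ck k U g -> Ck k U (fun x => f x * g x).
Proof.
move=> oU; have cfg k' f' g' : Ck k' U f' -> Ck k' U g' ->
    forall x, U x -> {for x, continuous (fun x => f' x * g' x)}.
  by move=> fk gk x Ux; apply: continuousM; [exact: Ck_cont fk Ux|exact: Ck_cont gk Ux].
elim: k f g => [|k IH] f g fk gk; (split; first exact: cfg fk gk) => //.
have [f' g'] := (Ck_pred fk, Ck_pred gk).
case: fk gk => _ fd [_ gd] i; have [fi fdi] := fd i; have [gi gdi] := gd i.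
split; first by move=> x Ux; apply: derivableM; [exact: fi|exact: gi].
apply: (@Ck_congr _ _ _
  (fun x => f x * 'D_(delta_mx 0 i) g x + g x * 'D_(delta_mx 0 i) f x)) => //.
  by move=> x Ux; rewrite deriveM//; [exact: fi|exact: gi].
by apply: Ck_add => //; exact: IH.
Qed.

Lemma derivable_lin (V W : normedModType R) (f : W -> R) (l : V -> W) x v :
  (forall (h : R) y, l (h *: v + y) = h *: l v + l y) ->
  derivable f (l x) (l v) -> derivable (f \o l) x v.
Proof.
move=> ll; rewrite /derivable; set F := (X in cvg (X @ _)); set G := (X in _ -> cvg (X @ _)).
suff -> : F = G by [].
by apply/funext => h; rewrite /F /G /= ll.
Qed.

Lemma derive_lin (V W : normedModType R) (f : W -> R) (l : V -> W) x v :
  (forall (h : R) y, l (h *: v + y) = h *: l v + l y) ->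
  'D_v (f \o l) x = 'D_(l v) f (l x).
Proof.
move=> ll; rewrite /derive; set F := (X in lim (X @ _)); set G := (X in _ = lim (X @ _)).
suff -> : F = G by [].
by apply/funext => h; rewrite /F /G /= ll.
Qed.

Lemma lsubmx_delta m n (i : 'I_(m + n)) :
  lsubmx (delta_mx 0 i : 'rV[R]_(m + n)) =
  match fintype.split i with inl j => delta_mx 0 j | inr _ => 0 end.
Proof.
apply/rowP => j; rewrite !mxE; case: splitP => k ik; rewrite !mxE eqxx /=.
  by rewrite -!val_eqE /= ik.
by rewrite -val_eqE /= ik; case: eqP => // e; have := ltn_ord j; rewrite e ltnNge leq_addr.
Qed.

Lemma Ck_lsub k m n (U : set 'rV[R]_m) f : Ck k U f ->
  Ck k [set v : 'rV[R]_(m + n) | U (lsubmx v)] (fun v => f (lsubmx v)).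
Proof.
have cf k' f' : Ck k' U f' -> forall x, [set v : 'rV[R]_(m + n) | U (lsubmx v)] x ->
    {for x, continuous (fun v : 'rV[R]_(m + n) => f' (lsubmx v))}.
  move=> fk x /= Ux; apply: (@continuous_comp _ _ _ (@lsubmx R 1 m n) f').
    exact: continuous_lsubmx.
  exact: Ck_cont fk Ux.
elim: k f => [|k IH] f fk; (split; first exact: cf fk) => //.
case: fk => _ fd i.
have E v : 'D_(delta_mx 0 i) (fun v : 'rV_(m + n) => f (lsubmx v)) v =
   'D_(lsubmx (delta_mx 0 i : 'rV[R]_(m + n))) f (lsubmx v).
  exact: (@derive_lin _ _ f (@lsubmx R 1 m n) _ _ (fun h y => linearP _ h _ y)).
have -> : (fun x : 'rV_(m + n) => 'D_(delta_mx 0 i) (fun v => f (lsubmx v)) x)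
   = (fun v => 'D_(lsubmx (delta_mx 0 i : 'rV[R]_(m + n))) f (lsubmx v)).
  by apply/funext.
split.
  move=> x Ux; apply: (@derivable_lin _ _ f (@lsubmx R 1 m n)); first by move=> h y; rewrite linearP.
  rewrite /= lsubmx_delta; case: (fintype.split i) => [j|_]; first by apply: (fd j).1.
  exact: derivable0.
rewrite lsubmx_delta; case: (fintype.split i) => [j|_]; first by exact: (IH ('D_(delta_mx 0 j) f) (fd j).2).
rewrite (_ : (fun v => _) = fun=> 0); first exact: Ck_cst.
by apply/funext => v; rewrite derive0.
Qed.

Lemma Ck_coord k n (U : set 'rV[R]_n) (i : 'I_n) : Ck k U (fun v => v 0 i).
Proof.
case: k => [|k]; split => //; try by move=> x _; exact: coord_continuous.
have cl (v : 'rV[R]_n) (h : R) (y : 'rV[R]_n) :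
  (h *: v + y) 0 i = h *: (v 0 i : [the normedModType R of R : Type]) + y 0 i by rewrite !mxE.
move=> j; split.
  move=> x _; apply: (@derivable_lin _ R id (fun v : 'rV[R]_n => v 0 i)) => //.
rewrite (_ : 'D__ _ = fun=> (delta_mx 0 j : 'rV[R]_n) 0 i); first exact: Ck_cst.
apply/funext => v; rewrite (@derive_lin _ R id (fun v : 'rV[R]_n => v 0 i)) //.
exact: derive_id.
Qed.
End Calculus.

Section Boxes.
Variables (R : realType) (n : nat).

Definition rbox (ab : 'rV[rat]_n * 'rV[rat]_n) : set 'rV[R]_n :=
  [set v | forall i, ratr (ab.1 0 i) < v 0 i < ratr (ab.2 0 i)].

Lemma open_box (P : 'I_n -> set R) : (forall i, open (P i)) ->
  open [set v : 'rV[R]_n | forall i, P i (v 0 i)].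
Proof.
move=> oP; rewrite openE => v Pv; rewrite /interior.
exists (fun _ i => P i) => [j i|w /= Pw i]; last exact: Pw.
by apply: open_nbhs_nbhs; split; rewrite ?ord1.
Qed.

Lemma rbox_open ab : open (rbox ab).
Proof.
apply: (@open_box (fun i => `]ratr (ab.1 0 i), ratr (ab.2 0 i)[%classic)).
by move=> i; exact: interval_open.
Qed.

Lemma rbox_base (G : set 'rV[R]_n) z : open G -> G z ->
  exists2 ab, rbox ab z & rbox ab `<=` G.
Proof.
move=> oG Gz; have [P zP PG] : nbhs z G by apply: open_nbhs_nbhs.
have H i : exists ab : rat * rat, ratr ab.1 < z 0 i < ratr ab.2 /\
    (forall x : R, ratr ab.1 < x < ratr ab.2 -> P 0 i x).
  have /nbhs_ballP[e /= e0 eP] := zP 0 i.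
  have [a] := @rat_in_itvoo R (z 0 i - e) (z 0 i) (ltac:(by rewrite ltrBlDr ltrDl)).
  have [b] := @rat_in_itvoo R (z 0 i) (z 0 i + e) (ltac:(by rewrite ltrDl)).
  rewrite !in_itv /= => /andP[b1 b2] /andP[a1 a2]; exists (a, b); split => /=.
    by rewrite a2 b1.
  move=> x /andP[ax xb]; apply: eP; rewrite /ball /= ltr_distlC; apply/andP; split.
    exact: lt_trans ax.
  exact: lt_trans xb b2.
have [f fP] := choice H.
exists (\row_i (f i).1, \row_i (f i).2).
  by move=> i; rewrite !mxE; have [] := fP i.
move=> v vb; apply: PG => /= j i; rewrite (ord1 j); apply: (fP i).2.
by have := vb i; rewrite /= !mxE.
Qed.

End Boxes.

(* A chart with domain [cdom] and coordinates [cfun]; [cinv] is the inverse of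
   [cfun] on [cfun @` cdom], and its values elsewhere are irrelevant. *)
Record chart (R : realType) (T : Type) (m : nat) := Chart {
  cdom : set T;
  cfun : T -> 'rV[R]_m;
  cinv : 'rV[R]_m -> T }.

Section Atlas.
Variables (R : realType) (T : Type) (m : nat) (A : set (chart R T m)).
Implicit Types (c : chart R T m) (O : set T).

(* Manifolds are sets with an atlas, which carries the topology: a set is open
   when its image in each chart is.  The atlas need not be maximal. *)
Definition atlas_open O := forall c, A c -> open (cfun c @` (cdom c `&` O)).

Record is_atlas : Prop := IsAtlas {
  chartK : forall c x, A c -> cdom c x -> cinv c (cfun c x) = x;
  chart_overlap : forall c c', A c -> A c' ->
    open (cfun c @` (cdom c `&` cdom c'));
  chart_transition : forall c c' i, A c -> A c' ->
    smooth (cfun c @` (cdom c `&` cdom c')) (fun y => cfun c' (cinv c y) 0 i);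
  chart_cover : forall x, exists2 c, A c & cdom c x }.

Definition atlas_hausdorff := forall x y : T, x <> y -> exists O O' : set T,
  [/\ atlas_open O, atlas_open O', O x, O' y & O `&` O' = set0].

Definition atlas_second_countable := exists2 B : nat -> set T,
  forall k, atlas_open (B k) &
  forall O x, atlas_open O -> O x -> exists2 k, B k x & B k `<=` O.

Hypothesis hA : is_atlas.

Lemma atlas_openT : atlas_open setT.
Proof. by move=> c Ac; have := chart_overlap hA Ac Ac; rewrite setIT setIid. Qed.

Lemma atlas_open_dom c : A c -> atlas_open (cdom c).
Proof. by move=> Ac c' Ac'; apply: chart_overlap. Qed.

Lemma atlas_open0 : atlas_open set0.
Proof. by move=> c Ac; rewrite setI0 image_set0; exact: open0. Qed.

Lemma image_chartE c O : A c -> cfun c @` (cdom c `&` O) =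
  [set y | [/\ (cfun c @` cdom c) y & O (cinv c y)]].
Proof.
move=> Ac; apply/seteqP; split => [_ [x [cx Ox] <-]|y [[x cx <-]]] /=.
  by split; [exists x|rewrite (chartK hA)].
by rewrite (chartK hA) // => Ox; exists x.
Qed.

Lemma atlas_openI O O' : atlas_open O -> atlas_open O' -> atlas_open (O `&` O').
Proof.
move=> oO oO' c Ac; rewrite (_ : cfun c @` _ =
  (cfun c @` (cdom c `&` O)) `&` (cfun c @` (cdom c `&` O'))).
  by apply: openI; [exact: oO|exact: oO'].
by rewrite !image_chartE //; apply/seteqP; split => [y [? []]|y [[? ?] []]].
Qed.

Lemma atlas_open_chart c (G : set 'rV[R]_m) : A c -> open G ->
  atlas_open (cdom c `&` [set x | G (cfun c x)]).
Proof.
move=> Ac oG c' Ac'; rewrite openE => _ [x [c'x [cx /= Gx]] <-]; rewrite /interior.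
have [P zP PG] : nbhs (cfun c x) G by apply: open_nbhs_nbhs.
pose U := cfun c' @` (cdom c' `&` cdom c).
have oU : open U by apply: chart_overlap.
have Ux : U (cfun c' x) by exists x.
have H (i : 'I_m) : \forall y \near nbhs (cfun c' x), P 0 i (cfun c (cinv c' y) 0 i).
  have := Ck_cont (chart_transition hA i Ac' Ac 0) Ux.
  by rewrite /prop_for /continuous_at (chartK hA) //; apply; exact: zP.
have {}H := @filter_forall _ _ _ (nbhs (cfun c' x)) (nbhs_filter _) H.
have nU : \forall y \near nbhs (cfun c' x), U y by apply: open_nbhs_nbhs.
apply: filterS2 nU H => _ [y [c'y cy] <-] Py; exists y => //; do 2 split => //=.
apply: PG => j i; rewrite (ord1 j); have := Py i; by rewrite (chartK hA).
Qed.

End Atlas.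

Record manifold (R : realType) (m : nat) := Manifold {
  mcar :> Type;
  atlas : set (chart R mcar m);
  atlasP : is_atlas atlas;
  hausdorffP : atlas_hausdorff atlas;
  second_countableP : atlas_second_countable atlas }.

Section Functions.
Variables (R : realType) (m : nat) (M : manifold R m).
Implicit Types (O : set M) (f g : M -> R).

Definition mopen O := atlas_open (@atlas R m M) O.

(* Smoothness of a function on an open set [O]. *)
Definition smooth_on O f := forall c, atlas c ->
  smooth (cfun c @` (cdom c `&` O)) (fun y => f (cinv c y)).

Lemma smooth_on_cst O (a : R) : smooth_on O (fun=> a).
Proof. by move=> c _ k; exact: Ck_cst. Qed.

Lemma smooth_on_add O f g : mopen O -> smooth_on O f -> smooth_on O g ->
  smooth_on O (fun x => f x + g x).
Proof. by move=> oO sf sg c Ac k; apply: Ck_add; [exact: oO|exact: sf|exact: sg]. Qed.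

Lemma smooth_on_mul O f g : mopen O -> smooth_on O f -> smooth_on O g ->
  smooth_on O (fun x => f x * g x).
Proof. by move=> oO sf sg c Ac k; apply: Ck_mul; [exact: oO|exact: sf|exact: sg]. Qed.

Lemma smooth_on_opp O f : mopen O -> smooth_on O f -> smooth_on O (fun x => - f x).
Proof.
move=> oO sf; rewrite (_ : (fun x => _) = fun x => -1 * f x).
  by apply: smooth_on_mul => //; exact: smooth_on_cst.
by apply/funext => x; rewrite mulN1r.
Qed.

Lemma smooth_on_sum O (I : Type) (r : seq I) (h : I -> M -> R) : mopen O ->
  (forall i, smooth_on O (h i)) -> smooth_on O (fun x => \sum_(i <- r) h i x).
Proof.
move=> oO hs; elim: r => [|i r IH].
  rewrite (_ : (fun x => _) = fun=> 0); first exact: smooth_on_cst.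
  by apply/funext => x; rewrite big_nil.
rewrite (_ : (fun x => _) = fun x => h i x + \sum_(j <- r) h j x).
  exact: smooth_on_add.
by apply/funext => x; rewrite big_cons.
Qed.

Lemma smooth_on_sub O O' f : O' `<=` O -> smooth_on O f -> smooth_on O' f.
Proof.
move=> OO sf c Ac k; apply: Ck_sub (sf c Ac k).
by apply: image_subset => x [cx /OO].
Qed.

Lemma smooth_on_local O f :
  (forall x, O x -> exists2 V, V x & smooth_on V f) -> smooth_on O f.
Proof.
move=> H c Ac k; apply: Ck_local => _ [x [cx /H[V Vx fV]] <-].
by exists (cfun c @` (cdom c `&` V)); [exists x|exact: fV].
Qed.

Lemma smooth_on_congr O f g : mopen O -> (forall x, O x -> f x = g x) ->
  smooth_on O f -> smooth_on O g.
Proof.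
move=> oO fg sf c Ac k; apply: Ck_congr (sf c Ac k); first exact: oO.
by move=> _ [x [cx Ox] <-]; rewrite (chartK (atlasP M)) // fg.
Qed.

Lemma mopenT : mopen setT. Proof. exact: atlas_openT (atlasP M). Qed.

Lemma mopenI O O' : mopen O -> mopen O' -> mopen (O `&` O').
Proof. exact: atlas_openI (atlasP M) _ _. Qed.

Lemma mopen_dom c : atlas c -> mopen (cdom c).
Proof. exact: atlas_open_dom (atlasP M) _. Qed.

(* The commutative ring of smooth functions M -> R. *)
Record Cinf := MkCinf { cinf_fun :> M -> R; cinfP : smooth_on setT cinf_fun }.

Lemma cinf_eq (f g : Cinf) : (forall x, f x = g x) -> f = g.
Proof.
case: f g => [f fP] [g gP] /= /funext fg; move: fP gP; rewrite fg => fP gP.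
by congr MkCinf; exact: Prop_irrelevance.
Qed.

HB.instance Definition _ := gen_eqMixin Cinf.
HB.instance Definition _ := gen_choiceMixin Cinf.

Definition cinf_cst (a : R) := MkCinf (smooth_on_cst setT a).
Definition cinf_add (f g : Cinf) := MkCinf (smooth_on_add mopenT (cinfP f) (cinfP g)).
Definition cinf_opp (f : Cinf) := MkCinf (smooth_on_opp mopenT (cinfP f)).
Definition cinf_mul (f g : Cinf) := MkCinf (smooth_on_mul mopenT (cinfP f) (cinfP g)).

Fact cinf_addA : associative cinf_add.
Proof. by move=> f g h; apply: cinf_eq => x /=; rewrite addrA. Qed.
Fact cinf_addC : commutative cinf_add.
Proof. by move=> f g; apply: cinf_eq => x /=; rewrite addrC. Qed.
Fact cinf_add0 : left_id (cinf_cst 0) cinf_add.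
Proof. by move=> f; apply: cinf_eq => x /=; rewrite add0r. Qed.
Fact cinf_addN : left_inverse (cinf_cst 0) cinf_opp cinf_add.
Proof. by move=> f; apply: cinf_eq => x /=; rewrite addNr. Qed.
HB.instance Definition _ :=
  GRing.isZmodule.Build Cinf cinf_addA cinf_addC cinf_add0 cinf_addN.

Fact cinf_mulA : associative cinf_mul.
Proof. by move=> f g h; apply: cinf_eq => x /=; rewrite mulrA. Qed.
Fact cinf_mulC : commutative cinf_mul.
Proof. by move=> f g; apply: cinf_eq => x /=; rewrite mulrC. Qed.
Fact cinf_mul1 : left_id (cinf_cst 1) cinf_mul.
Proof. by move=> f; apply: cinf_eq => x /=; rewrite mul1r. Qed.
Fact cinf_mulD : left_distributive cinf_mul cinf_add.
Proof. by move=> f g h; apply: cinf_eq => x /=; rewrite mulrDl. Qed.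
HB.instance Definition _ :=
  GRing.Zmodule_isComPzRing.Build Cinf cinf_mulA cinf_mulC cinf_mul1 cinf_mulD.

(* The partial derivative (dF/dx^i)(x) with respect to the coordinates of [c]. *)
Definition dpart (c : chart R M m) (i : 'I_m) (F : Cinf) (x : M) : R :=
  'D_(delta_mx 0 i) (fun y => F (cinv c y)) (cfun c x).

End Functions.

Section Tensors.
Variables (R : realType) (m : nat) (M : manifold R m).
Implicit Types (F G H : Cinf M).

(* Vector fields and bivector fields are represented by their action on smooth
   functions, F |-> X(F) and (F, G) |-> P(dF, dG), and are required to be given
   in coordinates by X = \sum_i a^i d/dx^i, resp. P(dx^i, dx^j) = b^(ij) = - b^(ji),
   with smooth coefficients near every point of every chart.  Since tangent
   vectors are determined by their action on global smooth functions and
   differentials of these span the cotangent spaces, this is the same as a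
   smooth section of TM, resp. of the second exterior power of TM. *)
Record vfield := MkVfield {
  vf_op :> Cinf M -> Cinf M;
  vf_loc : forall c x, atlas c -> cdom c x ->
    exists (V : set M) (a : 'I_m -> M -> R),
    [/\ mopen V, V x /\ V `<=` cdom c, forall i, smooth_on V (a i) &
        forall y F, V y -> vf_op F y = \sum_i a i y * dpart c i F y] }.

Record bivector := MkBivector {
  bv_op :> Cinf M -> Cinf M -> Cinf M;
  bv_loc : forall c x, atlas c -> cdom c x ->
    exists (V : set M) (b : 'I_m -> 'I_m -> M -> R),
    [/\ mopen V, V x /\ V `<=` cdom c,
        forall i j, smooth_on V (b i j) /\ forall y, V y -> b i j y = - b j i y &
        forall y F G, V y ->
          bv_op F G y = \sum_i \sum_j b i j y * (dpart c i F y * dpart c j G y)] }.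

Lemma vf_eq (X Y : vfield) : (forall F, X F = Y F) -> X = Y.
Proof.
case: X Y => [f fP] [g gP] /= /funext fg; move: fP gP; rewrite fg => fP gP.
by congr MkVfield; exact: Prop_irrelevance.
Qed.

Lemma bv_eq (P Q : bivector) : (forall F G, P F G = Q F G) -> P = Q.
Proof.
case: P Q => [f fP] [g gP] /= fg.
have {}fg : f = g by apply/funext => F; apply/funext => G.
move: fP gP; rewrite fg => fP gP.
by congr MkBivector; exact: Prop_irrelevance.
Qed.

HB.instance Definition _ := gen_eqMixin vfield.
HB.instance Definition _ := gen_choiceMixin vfield.
HB.instance Definition _ := gen_eqMixin bivector.
HB.instance Definition _ := gen_choiceMixin bivector.

Program Definition vf_zero := @MkVfield (fun=> 0) _.
Next Obligation.
move=> c x Ac cx; exists (cdom c), (fun _ _ => 0); split => //.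
- exact: mopen_dom.
- by split.
- by move=> i; exact: smooth_on_cst.
- by move=> y F _; rewrite big1 // => i _; rewrite mul0r.
Qed.

Program Definition vf_opp (X : vfield) := @MkVfield (fun F => - X F) _.
Next Obligation.
move=> X c x Ac cx; have [V [a [oV Vx sa Xa]]] := vf_loc X Ac cx.
exists V, (fun i y => - a i y); split => //; first by move=> i; exact: smooth_on_opp.
move=> y F Vy; rewrite [LHS]/= Xa // -sumrN.
by apply: eq_bigr => i _; rewrite mulNr.
Qed.

Program Definition vf_add (X Y : vfield) := @MkVfield (fun F => X F + Y F) _.
Next Obligation.
move=> X Y c x Ac cx; have [V [a [oV [Vx Vc] sa Xa]]] := vf_loc X Ac cx.
have [W [b [oW [Wx Wc] sb Yb]]] := vf_loc Y Ac cx.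
have oVW := mopenI oV oW.
exists (V `&` W), (fun i y => a i y + b i y); split => //.
- by split=> // y [/Vc].
- move=> i; apply: smooth_on_add => //.
    exact: smooth_on_sub (sa i).
  exact: smooth_on_sub (sb i).
- move=> y F [Vy Wy]; rewrite [LHS]/= Xa // Yb // -big_split /=.
  by apply: eq_bigr => i _; rewrite mulrDl.
Qed.

Fact vf_addA : associative vf_add.
Proof. by move=> X Y Z; apply: vf_eq => F /=; rewrite addrA. Qed.
Fact vf_addC : commutative vf_add.
Proof. by move=> X Y; apply: vf_eq => F /=; rewrite addrC. Qed.
Fact vf_add0 : left_id vf_zero vf_add.
Proof. by move=> X; apply: vf_eq => F /=; rewrite add0r. Qed.
Fact vf_addN : left_inverse vf_zero vf_opp vf_add.
Proof. by move=> X; apply: vf_eq => F /=; rewrite addNr. Qed.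
HB.instance Definition _ :=
  GRing.isZmodule.Build vfield vf_addA vf_addC vf_add0 vf_addN.

Program Definition bv_zero := @MkBivector (fun _ _ => 0) _.
Next Obligation.
move=> c x Ac cx; exists (cdom c), (fun _ _ _ => 0); split => //.
- exact: mopen_dom.
- by split.
- by move=> i j; split; [exact: smooth_on_cst|rewrite oppr0].
- by move=> y F G _; rewrite big1 // => i _; rewrite big1 // => j _; rewrite mul0r.
Qed.

Program Definition bv_opp (P : bivector) := @MkBivector (fun F G => - P F G) _.
Next Obligation.
move=> P c x Ac cx; have [V [b [oV Vx sb Pb]]] := bv_loc P Ac cx.
exists V, (fun i j y => - b i j y); split => //.
  move=> i j; have [s e] := sb i j; split; first exact: smooth_on_opp.
  by move=> y Vy; rewrite e.
move=> y F G Vy; rewrite [LHS]/= Pb // -sumrN.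
by apply: eq_bigr => i _; rewrite -sumrN; apply: eq_bigr => j _; rewrite mulNr.
Qed.

Program Definition bv_add (P Q : bivector) :=
  @MkBivector (fun F G => P F G + Q F G) _.
Next Obligation.
move=> P Q c x Ac cx; have [V [a [oV [Vx Vc] sa Pa]]] := bv_loc P Ac cx.
have [W [b [oW [Wx Wc] sb Qb]]] := bv_loc Q Ac cx.
have oVW := mopenI oV oW.
exists (V `&` W), (fun i j y => a i j y + b i j y); split => //.
- by split=> // y [/Vc].
- move=> i j; have [s e] := sa i j; have [s' e'] := sb i j; split.
    apply: smooth_on_add => //; first exact: smooth_on_sub s.
    exact: smooth_on_sub s'.
  by move=> y [Vy Wy]; rewrite e // e' // opprD.
- move=> y F G [Vy Wy]; rewrite [LHS]/= Pa // Qb // -big_split /=.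
  apply: eq_bigr => i _; rewrite -big_split /=.
  by apply: eq_bigr => j _; rewrite mulrDl.
Qed.

Fact bv_addA : associative bv_add.
Proof. by move=> X Y Z; apply: bv_eq => F G /=; rewrite addrA. Qed.
Fact bv_addC : commutative bv_add.
Proof. by move=> X Y; apply: bv_eq => F G /=; rewrite addrC. Qed.
Fact bv_add0 : left_id bv_zero bv_add.
Proof. by move=> X; apply: bv_eq => F G /=; rewrite add0r. Qed.
Fact bv_addN : left_inverse bv_zero bv_opp bv_add.
Proof. by move=> X; apply: bv_eq => F G /=; rewrite addNr. Qed.
HB.instance Definition _ :=
  GRing.isZmodule.Build bivector bv_addA bv_addC bv_add0 bv_addN.

(* (X /\ Y)(alpha, beta) = alpha(X) beta(Y) - alpha(Y) beta(X), evaluated on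
   exact forms. *)
Program Definition vf_wedge (X Y : vfield) :=
  @MkBivector (fun F G => X F * Y G - X G * Y F) _.
Next Obligation.
move=> X Y c x Ac cx; have [V [a [oV [Vx Vc] sa Xa]]] := vf_loc X Ac cx.
have [W [b [oW [Wx Wc] sb Yb]]] := vf_loc Y Ac cx.
have oVW := mopenI oV oW.
exists (V `&` W), (fun i j y => a i y * b j y - a j y * b i y); split => //.
- by split=> // y [/Vc].
- have sVa i : smooth_on (V `&` W) (a i) by apply: smooth_on_sub (sa i) => y [].
  have sWb i : smooth_on (V `&` W) (b i) by apply: smooth_on_sub (sb i) => y [].
  move=> i j; split; last by move=> y _; rewrite opprB.
  apply: smooth_on_add => //; first exact: smooth_on_mul.
  by apply: smooth_on_opp => //; exact: smooth_on_mul.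
- move=> y F G [Vy Wy]; rewrite [LHS]/= !Xa // !Yb // !big_distrlr /=.
  rewrite [X in _ - X]exchange_big /= -sumrB; apply: eq_bigr => i _.
  rewrite -sumrB; apply: eq_bigr => j _.
  by rewrite mulrBl mulrACA; congr (_ - _); rewrite mulrACA (mulrC (dpart c j G y)).
Qed.

(* X /\ P on (dF, dG, dH): the sum over (1,2)-shuffles, with the convention of
   [vf_wedge]. *)
Definition wedge12 (X : vfield) (P : bivector) F G H : Cinf M :=
  X F * P G H + X G * P H F + X H * P F G.

(* The Schouten-Nijenhuis bracket of a p-vector P and a q-vector Q, seen as skew
   multiderivations of the algebra of functions, is
     [P, Q](F_1 .. F_(p+q-1)) =
       \sum_(s in S_(q,p-1)) sgn(s) P(Q(F_s(1) .. F_s(q)), F_s(q+1) ..)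
       - (-1)^((p-1)(q-1))
         \sum_(s in S_(p,q-1)) sgn(s) Q(P(F_s(1) .. F_s(p)), F_s(p+1) ..),
   the sums being over shuffles.  [schouten12] and [schouten22] are the cases
   (p, q) = (1, 2) and (2, 2).  For a bivector L and a vector field E,
   [schouten12 E L] is the Lie derivative of L along E, and [schouten22 L L] is
   twice the cyclic sum of L(d(L(dF, dG)), dH).  With this sign, the
   Jacobiator {{F, G}, H} + cyclic of
     {F, G} = L(dF, dG) + F E(G) - G E(F)
   is ([L, L] / 2 - E /\ L)(dF, dG, dH) - (F [E, L](dG, dH) + cyclic), so that
   the two equations of [jacobi_structure] amount to the Jacobi identity. *)
Definition schouten12 (X : vfield) (P : bivector) F G : Cinf M :=
  X (P F G) - P (X F) G + P (X G) F.

Definition schouten22 (P Q : bivector) F G H : Cinf M :=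
  P (Q F G) H + P (Q G H) F + P (Q H F) G
  + (Q (P F G) H + Q (P G H) F + Q (P H F) G).

Record jacobi_structure := MkJacobi {
  jac_bv : bivector;
  jac_vf : vfield;
  jacobi_LL : forall F G H,
    schouten22 jac_bv jac_bv F G H = wedge12 jac_vf jac_bv F G H *+ 2;
  jacobi_EL : forall F G, schouten12 jac_vf jac_bv F G = 0 }.

Definition jacobi_bracket (J : jacobi_structure) F G : Cinf M :=
  jac_bv J F G + F * jac_vf J G - G * jac_vf J F.

End Tensors.

(* A family of n sections over [fdom], irrelevant outside of [fdom]. *)
Record frame (R : realType) (T : Type) (n : nat) (E : T -> vectType R) := Frame {
  fdom : set T;
  fsec : forall x, n.-tuple (E x) }.

(* A vector bundle of rank n: a family of vector spaces with local frames (that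
   is, local trivialisations) related by smooth transition functions. *)
Record vbundle (R : realType) (m : nat) (M : manifold R m) (n : nat) := Vbundle {
  fib :> M -> vectType R;
  frames : set (frame n fib);
  frame_open : forall e, frames e -> mopen (fdom e);
  frame_basis : forall e x, frames e -> fdom e x -> basis_of fullv (fsec e x);
  frame_cover : forall x, exists2 e, frames e & fdom e x;
  frame_transition : forall e e' i j, frames e -> frames e' ->
    smooth_on (fdom e `&` fdom e')
      (fun x => coord (fsec e x) i (tnth (fsec e' x) j)) }.

Section Sections.
Variables (R : realType) (m : nat) (M : manifold R m) (n : nat) (E : vbundle M n).

Definition smooth_section (s : forall x, E x) := forall e i, frames e ->
  smooth_on (fdom e) (fun x => coord (fsec e x) i (s x)).

(* The module of global smooth sections, over the ring of smooth functions. *)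
Record section := MkSection {
  sec_fun :> forall x, E x;
  secP : smooth_section sec_fun }.

Lemma sec_eq (s t : section) : (forall x, s x = t x) -> s = t.
Proof.
case: s t => [s sP] [t tP] /= st.
have {}st : s = t by apply: functional_extensionality_dep.
by move: sP tP; rewrite st => sP tP; congr MkSection; exact: Prop_irrelevance.
Qed.

HB.instance Definition _ := gen_eqMixin section.
HB.instance Definition _ := gen_choiceMixin section.

Program Definition sec_zero := @MkSection (fun=> 0) _.
Next Obligation.
move=> e i fe; rewrite (_ : (fun x => _) = fun=> 0); first exact: smooth_on_cst.
by apply/funext => x; rewrite linear0.
Qed.

Program Definition sec_opp (s : section) := @MkSection (fun x => - s x) _.
Next Obligation.
move=> s e i fe.
rewrite (_ : (fun x => _) = fun x => - coord (fsec e x) i (s x)).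
  by apply: smooth_on_opp; [exact: frame_open|exact: secP].
by apply/funext => x; rewrite linearN.
Qed.

Program Definition sec_add (s t : section) := @MkSection (fun x => s x + t x) _.
Next Obligation.
move=> s t e i fe.
rewrite (_ : (fun x => _) =
  fun x => coord (fsec e x) i (s x) + coord (fsec e x) i (t x)).
  by apply: smooth_on_add; [exact: frame_open|exact: secP|exact: secP].
by apply/funext => x; rewrite linearD.
Qed.

Program Definition sec_scale (f : Cinf M) (s : section) :=
  @MkSection (fun x => f x *: s x) _.
Next Obligation.
move=> f s e i fe.
rewrite (_ : (fun x => _) = fun x => f x * coord (fsec e x) i (s x)).
  apply: smooth_on_mul; [exact: frame_open| |exact: secP].
  exact: smooth_on_sub (cinfP f).
by apply/funext => x; rewrite linearZ.
Qed.

Fact sec_addA : associative sec_add.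
Proof. by move=> s t u; apply: sec_eq => x /=; rewrite addrA. Qed.
Fact sec_addC : commutative sec_add.
Proof. by move=> s t; apply: sec_eq => x /=; rewrite addrC. Qed.
Fact sec_add0 : left_id sec_zero sec_add.
Proof. by move=> s; apply: sec_eq => x /=; rewrite add0r. Qed.
Fact sec_addN : left_inverse sec_zero sec_opp sec_add.
Proof. by move=> s; apply: sec_eq => x /=; rewrite addNr. Qed.
HB.instance Definition _ :=
  GRing.isZmodule.Build section sec_addA sec_addC sec_add0 sec_addN.

Fact sec_scaleA (f g : Cinf M) s : sec_scale f (sec_scale g s) = sec_scale (f * g) s.
Proof. by apply: sec_eq => x /=; rewrite scalerA. Qed.
Fact sec_scale1 : left_id 1 sec_scale.
Proof. by move=> s; apply: sec_eq => x /=; rewrite scale1r. Qed.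
Fact sec_scaleDr : right_distributive sec_scale +%R.
Proof. by move=> f s t; apply: sec_eq => x /=; rewrite scalerDr. Qed.
Fact sec_scaleDl s : {morph sec_scale^~ s : f g / f + g}.
Proof. by move=> f g; apply: sec_eq => x /=; rewrite scalerDl. Qed.
HB.instance Definition _ := GRing.Zmodule_isLmodule.Build (Cinf M) section
  sec_scaleA sec_scale1 sec_scaleDr sec_scaleDl.

End Sections.
Arguments section {R m M n} E.

Section Total.
Variables (R : realType) (m : nat) (M : manifold R m) (n : nat) (E : vbundle M n).

(* The total space: the pairs of a point and a vector over it, with the charts
   (x^1 .. x^m, v^1 .. v^n) given by a chart of M and a local frame. *)
Definition total_car := {x : M & E x}.

Definition total_chart (c : chart R M m) (e : frame n E) : chart R total_car (m + n) :=
  Chart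
    [set a : total_car | cdom c (projT1 a) /\ fdom e (projT1 a)]
    (fun a : total_car => row_mx (cfun c (projT1 a))
      (\row_i coord (fsec e (projT1 a)) i (projT2 a)))
    (fun v => @existT M (fun x => E x) (cinv c (lsubmx v))
      (\sum_i rsubmx v 0 i *: tnth (fsec e (cinv c (lsubmx v))) i)).

Definition total_atlas : set (chart R total_car (m + n)) :=
  [set C | exists c e, [/\ atlas c, frames e & C = total_chart c e]].

Lemma coord_frame (e : frame n E) x (k : 'I_n -> R) i : frames e -> fdom e x ->
  coord (fsec e x) i (\sum_j k j *: tnth (fsec e x) j) = k i.
Proof.
move=> fe ex; have /basis_free fr := frame_basis fe ex.
rewrite -[RHS](coord_sum_free k i fr); congr (coord _ _ _).
by apply: eq_bigr => j _; rewrite (tnth_nth 0).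
Qed.

Lemma frame_coord (e : frame n E) x (v : E x) : frames e -> fdom e x ->
  v = \sum_j coord (fsec e x) j v *: tnth (fsec e x) j.
Proof.
move=> fe ex; rewrite {1}(coord_basis (frame_basis fe ex) (memvf v)).
by apply: eq_bigr => j _; rewrite (tnth_nth 0).
Qed.

Lemma total_chartK c e a : atlas c -> frames e -> cdom (total_chart c e) a ->
  cinv (total_chart c e) (cfun (total_chart c e) a) = a.
Proof.
case: a => x v Ac fe [/= cx ex].
rewrite row_mxKl row_mxKr (chartK (atlasP M)) //.
congr existT; rewrite [RHS](frame_coord v fe ex).
by apply: eq_bigr => i _; rewrite mxE.
Qed.

Lemma total_chartVK c e v : frames e -> fdom e (cinv c (lsubmx v)) ->
  cfun c (cinv c (lsubmx v)) = lsubmx v ->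
  cfun (total_chart c e) (cinv (total_chart c e) v) = v.
Proof.
move=> fe ex cK /=; rewrite cK -[RHS]hsubmxK; congr row_mx.
by apply/rowP => i; rewrite mxE coord_frame.
Qed.

Lemma total_image c e (O : set M) : atlas c -> frames e ->
  cfun (total_chart c e) @`
    [set a : total_car | [/\ cdom c (projT1 a), fdom e (projT1 a) & O (projT1 a)]] =
  [set v | (cfun c @` (cdom c `&` (fdom e `&` O))) (lsubmx v)].
Proof.
move=> Ac fe; apply/seteqP; split => [_ [[x v] [/= cx ex Ox] <-]|v [x [cx [ex Ox]] xv]] /=.
  by rewrite row_mxKl; exists x.
have xE : cinv c (lsubmx v) = x by rewrite -xv (chartK (atlasP M)).
exists (cinv (total_chart c e) v); first by rewrite /= xE.
by apply: total_chartVK => //; rewrite xE.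
Qed.

Lemma total_base_open c e (O : set M) : atlas c -> frames e -> mopen O ->
  open (cfun (total_chart c e) @`
    [set a : total_car | [/\ cdom c (projT1 a), fdom e (projT1 a) & O (projT1 a)]]).
Proof.
move=> Ac fe oO; rewrite total_image //.
apply: (@open_comp _ _ (@lsubmx R 1 m n)).
  by move=> v _; exact: continuous_lsubmx.
exact: mopenI (frame_open fe) oO c Ac.
Qed.

Lemma total_domE c e c' e' :
  cdom (total_chart c e) `&` cdom (total_chart c' e') =
  [set a : total_car |
    [/\ cdom c (projT1 a), fdom e (projT1 a) & (cdom c' `&` fdom e') (projT1 a)]].
Proof. by apply/seteqP; split => [a [[? ?] [? ?]]|a [? ? [? ?]]]. Qed.

Lemma total_atlasP : is_atlas total_atlas.
Proof.
split.
- by move=> _ a [c [e [Ac fe ->]]]; exact: total_chartK.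
- move=> _ _ [c [e [Ac fe ->]]] [c' [e' [Ac' fe' ->]]]; rewrite total_domE.
  by apply: total_base_open => //; apply: mopenI; [exact: mopen_dom|exact: frame_open].
- move=> _ _ j [c [e [Ac fe ->]]] [c' [e' [Ac' fe' ->]]]; rewrite total_domE => k.
  have oW : mopen (cdom c' `&` fdom e').
    by apply: mopenI; [exact: mopen_dom|exact: frame_open].
  have oI := total_base_open Ac fe oW.
  rewrite total_image // in oI *.
  set P := [set v | _] in oI *.
  have [l jl|i ji] := fintype.splitP j.
    have -> : j = lshift n l by apply: val_inj.
    rewrite (_ : (fun y => _) = fun y => cfun c' (cinv c (lsubmx y)) 0 l).
      apply: (Ck_sub (U := [set v | (cfun c @` (cdom c `&` cdom c')) (lsubmx v)])).
        by move=> v [x [cx [ex [c'x e'x]]] xv]; exists x.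
      apply: (@Ck_lsub R k m n _ (fun y => cfun c' (cinv c y) 0 l)).
      exact: (chart_transition (atlasP M) l Ac Ac' k).
    by apply/funext => y; rewrite /= row_mxEl.
  have -> : j = rshift m i by apply: val_inj.
  apply: (@Ck_congr R k _ P (fun y => \sum_h y 0 (rshift m h) *
      coord (fsec e' (cinv c (lsubmx y))) i (tnth (fsec e (cinv c (lsubmx y))) h))) => //.
    move=> y _; rewrite /= row_mxEr mxE linear_sum.
    by apply: eq_bigr => h _; rewrite linearZ mxE.
  elim: (index_enum _) => [|h r IH].
    rewrite (_ : (fun y => _) = fun=> 0); first exact: Ck_cst.
    by apply/funext => y; rewrite big_nil.
  rewrite (_ : (fun y => _) = fun y : 'rV[R]_(m + n) => y 0 (rshift m h) *
      coord (fsec e' (cinv c (lsubmx y))) i (tnth (fsec e (cinv c (lsubmx y))) h) +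
    \sum_(h0 <- r) y 0 (rshift m h0) *
      coord (fsec e' (cinv c (lsubmx y))) i (tnth (fsec e (cinv c (lsubmx y))) h0)).
    apply: Ck_add => //; apply: Ck_mul => //; first exact: Ck_coord.
    apply: (Ck_sub (U := [set v | (cfun c @` (cdom c `&` (fdom e' `&` fdom e))) (lsubmx v)])).
      by move=> v [x [cx [ex [c'x e'x]]] xv]; exists x.
    apply: (@Ck_lsub R k m n _
      (fun y => coord (fsec e' (cinv c y)) i (tnth (fsec e (cinv c y)) h))).
    exact: (frame_transition i h fe' fe Ac k).
  by apply/funext => y; rewrite big_cons.
- move=> [x v]; have [c Ac cx] := chart_cover (atlasP M) x.
  have [e fe ex] := frame_cover E x.
  by exists (total_chart c e) => //; exists c, e.
Qed.

Lemma total_open_pull (O : set M) : mopen O ->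
  atlas_open total_atlas [set a : total_car | O (projT1 a)].
Proof.
move=> oO _ [c [e [Ac fe ->]]].
rewrite (_ : _ `&` _ = [set a : total_car |
  [/\ cdom c (projT1 a), fdom e (projT1 a) & O (projT1 a)]]).
  exact: total_base_open.
by apply/seteqP; split => [a [[? ?] ?]|a [? ? ?]].
Qed.

Lemma total_hausdorff : atlas_hausdorff total_atlas.
Proof.
move=> [x v] [y w] xy.
have [exy|nxy] := pselect (x = y); last first.
  have [O [O' [oO oO' Ox O'y OO']]] := hausdorffP nxy.
  exists [set a : total_car | O (projT1 a)], [set a : total_car | O' (projT1 a)].
  split => //; [exact: total_open_pull|exact: total_open_pull|].
  by apply/seteqP; split => // a [Oa O'a]; have : set0 (projT1 a) by rewrite -OO'.
subst y; have [c Ac cx] := chart_cover (atlasP M) x.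
have [e fe ex] := frame_cover E x.
have AC : total_atlas (total_chart c e) by exists c, e.
pose f := cfun (total_chart c e).
have [i vw] : exists i, coord (fsec e x) i v <> coord (fsec e x) i w.
  apply/existsNP => vw; apply: xy; congr existT.
  rewrite (frame_coord v fe ex) (frame_coord w fe ex).
  by apply: eq_bigr => i _; rewrite vw.
have [P [P' [oP oP' Pv P'w PP']]] : exists P P' : set R, [/\ open P, open P',
    P (coord (fsec e x) i v), P' (coord (fsec e x) i w) & P `&` P' = set0].
  have := @Rhausdorff R; rewrite open_hausdorff.
  move=> /(_ _ _ (introN eqP vw)) [[P P'] [/= /set_mem Pv /set_mem P'w] [oP oP' PP']].
  by exists P, P'; split => //; apply/eqP.
have oG (Q : set R) : open Q -> open [set z : 'rV[R]_(m + n) | Q (z 0 (rshift m i))].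
  move=> oQ; rewrite (_ : [set z | _] = [set z : 'rV[R]_(m + n) |
     forall j, (if j == rshift m i then Q else setT) (z 0 j)]).
    apply: (@open_box R _ (fun j => if j == rshift m i then Q else setT)).
    by move=> j; case: ifP => // _; exact: openT.
  apply/seteqP; split => [z /= Qz j|z /= /(_ (rshift m i))]; last by rewrite eqxx.
  by case: eqP => // ->.
exists (cdom (total_chart c e) `&` [set a | P (f a 0 (rshift m i))]),
       (cdom (total_chart c e) `&` [set a | P' (f a 0 (rshift m i))]); split.
- exact: (atlas_open_chart total_atlasP AC (oG _ oP)).
- exact: (atlas_open_chart total_atlasP AC (oG _ oP')).
- by split=> //; rewrite /f /= row_mxEr mxE.
- by split=> //; rewrite /f /= row_mxEr mxE.
- apply/seteqP; split => // a [[_ Pa] [_ P'a]].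
  by have : set0 (f a 0 (rshift m i)) by rewrite -PP'.
Qed.

Lemma total_second_countable : atlas_second_countable total_atlas.
Proof.
have [B oB bB] := @second_countableP R m M.
pose Q k (ce : chart R M m * frame n E) :=
  [/\ atlas ce.1, frames ce.2 & B k `<=` cdom ce.1 `&` fdom ce.2].
have H k : exists o : option (chart R M m * frame n E),
    (exists ce, Q k ce) -> exists2 ce, o = Some ce & Q k ce.
  have [[ce Qce]|nQ] := pselect (exists ce, Q k ce); last by exists None => /nQ.
  by exists (Some ce) => _; exists ce.
have [g gP] := choice H.
pose D (kab : nat * ('rV[rat]_(m + n) * 'rV[rat]_(m + n))) : set total_car :=
  [set a | exists ce, [/\ g kab.1 = Some ce, Q kab.1 ce, B kab.1 (projT1 a) &
     rbox kab.2 (cfun (total_chart ce.1 ce.2) a)]].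
exists (fun N => if unpickle N is Some kab then D kab else set0).
  move=> N; case: (unpickle N) => [[k ab]|]; last exact: atlas_open0.
  have [[ce [gce Qce]]|nce] := pselect (exists ce, g k = Some ce /\ Q k ce); last first.
    rewrite (_ : D _ = set0); first exact: atlas_open0.
    by apply/seteqP; split => // a [ce [? ? _ _]]; apply: nce; exists ce.
  have [Ac fe Bk] := Qce.
  have AC : total_atlas (total_chart ce.1 ce.2) by exists ce.1, ce.2.
  rewrite (_ : D _ = [set a : total_car | B k (projT1 a)] `&`
    (cdom (total_chart ce.1 ce.2) `&`
      [set a | rbox ab (cfun (total_chart ce.1 ce.2) a)])).
    apply: (atlas_openI total_atlasP (total_open_pull (oB k))).
    exact: (atlas_open_chart total_atlasP AC (@rbox_open _ _ _)).
  apply/seteqP; split => [a [ce' [/= gce' _ Ba ba]]|a [/= Ba [_ ba]]]; last by exists ce.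
  by move: gce' ba; rewrite gce => -[<-] ba; split; [|split; [exact: Bk|]].
move=> O a oO Oa; have [c Ac cx] := chart_cover (atlasP M) (projT1 a).
have [e fe ex] := frame_cover E (projT1 a).
have oce : mopen (cdom c `&` fdom e).
  by apply: mopenI; [exact: mopen_dom|exact: frame_open].
have [k Bx Bce] := bB _ _ oce (conj cx ex).
have [|ce gce Qce] := gP k; first by exists (c, e).
have [Ac' fe' Bk] := Qce.
have AC : total_atlas (total_chart ce.1 ce.2) by exists ce.1, ce.2.
pose C := total_chart ce.1 ce.2.
have Ca : cdom C a by exact: Bk.
have [ab ba abO] := rbox_base (oO _ AC) (ex_intro2 _ _ a (conj Ca Oa) erefl).
exists (pickle (k, ab)); rewrite pickleK; first by exists ce.
move=> b [ce' [/= gce' _ Bb bb]].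
move: gce' bb; rewrite gce => -[<-] /abO [a' [Ca' Oa'] a'b].
have Cb : cdom C b by exact: Bk.
rewrite -(total_chartK Ac' fe' Cb) -/C.
by rewrite -[cfun C b]a'b total_chartK.
Qed.

Definition total_space : manifold R (m + n) :=
  Manifold total_atlasP total_hausdorff total_second_countable.

End Total.

Section Pullback.
Variables (R : realType) (m : nat) (M : manifold R m) (n : nat) (E : vbundle M n).

Fact pullback_smooth (f : Cinf M) :
  @smooth_on R (m + n) (total_space E) setT (fun a => f (projT1 a)).
Proof.
move=> _ [c [e [Ac fe ->]]] k.
apply: (Ck_sub (U := [set v | (cfun c @` (cdom c `&` setT)) (lsubmx v)])).
  by move=> _ [[x v] [[/= cx ex] _] <-]; rewrite /= row_mxKl; exists x.
by apply: (@Ck_lsub R k m n _ (fun y => f (cinv c y))); exact: (cinfP f Ac).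
Qed.

Definition pullback (f : Cinf M) : Cinf (total_space E) := MkCinf (pullback_smooth f).

End Pullback.

Section Dual.
Variables (R : realType) (m : nat) (M : manifold R m) (n : nat) (E : vbundle M n).

(* The dual bundle, with fibres the duals of the fibres and with dual frames. *)
Definition dual_fib (x : M) : vectType R := 'Hom(E x, R^o).

Definition dual_frame (e : frame n E) : frame n dual_fib :=
  Frame (fdom e) (fun x => [tuple linfun (coord (fsec e x) i : E x -> R^o) | i < n]).

Lemma dual_frameE e x i (v : E x) :
  (tnth (fsec (dual_frame e) x) i : 'Hom(E x, R^o)) v = coord (fsec e x) i v.
Proof. by rewrite tnth_mktuple lfunE. Qed.

Lemma dual_frame_delta e x (k : 'I_n -> R) i : frames e -> fdom e x ->
  (\sum_j k j *: (fsec (dual_frame e) x)`_j : 'Hom(E x, R^o)) (tnth (fsec e x) i) = k i.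
Proof.
move=> fe ex; have fr := basis_free (frame_basis fe ex).
rewrite sum_lfunE (bigD1 i) // big1 => [|j ji]; rewrite scale_lfunE -tnth_nth.
  rewrite dual_frameE (tnth_nth 0) coord_free // eqxx.
  by rewrite [LHS]addr0 [LHS]mulr1.
by rewrite dual_frameE (tnth_nth 0) coord_free // eq_sym (negbTE ji) scaler0.
Qed.

Lemma dual_frame_basis e x : frames e -> fdom e x ->
  basis_of fullv (fsec (dual_frame e) x).
Proof.
move=> fe ex; have bx := frame_basis fe ex.
rewrite basisEfree subvf /=; apply/andP; split; last first.
  have En : dim (E x) = n by rewrite -dimvf (size_basis bx).
  have Dn : dim (dual_fib x) = (dim (E x) * 1)%N by [].
  by rewrite (size_tuple (fsec (dual_frame e) x)) dimvf Dn muln1 En.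
apply/(@freeP _ _ n (fsec (dual_frame e) x)) => k k0 i.
by rewrite -(dual_frame_delta k i fe ex) k0 lfunE.
Qed.

Lemma coord_dual e x (u : 'Hom(E x, R^o)) i : frames e -> fdom e x ->
  coord (fsec (dual_frame e) x) i u = u (tnth (fsec e x) i).
Proof.
move=> fe ex; rewrite {2}(coord_basis (dual_frame_basis fe ex) (memvf u)).
by rewrite dual_frame_delta.
Qed.

Program Definition dual_bundle : vbundle M n :=
  @Vbundle R m M n dual_fib [set e' | exists2 e, frames e & e' = dual_frame e] _ _ _ _.
Next Obligation. by move=> _ [e fe ->]; exact: (frame_open fe). Qed.
Next Obligation. by move=> _ x [e fe ->] ex; exact: dual_frame_basis. Qed.
Next Obligation.
move=> x; have [e fe ex] := frame_cover E x.
by exists (dual_frame e) => //; exists e.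
Qed.
Next Obligation.
move=> _ _ i j [e fe ->] [e' fe' ->].
apply: (@smooth_on_congr _ _ _ _ (fun x => coord (fsec e' x) j (tnth (fsec e x) i))).
- exact: mopenI (frame_open fe) (frame_open fe').
- by move=> x [ex e'x]; rewrite coord_dual // dual_frameE.
- by rewrite setIC; exact: frame_transition.
Qed.

Lemma pairing_frame e x (u : dual_bundle x) (v : E x) : frames e -> fdom e x ->
  (u : 'Hom(E x, R^o)) v =
  \sum_i coord (fsec (dual_frame e) x) i u * coord (fsec e x) i v.
Proof.
move=> fe ex; rewrite {1}(frame_coord v fe ex) linear_sum.
by apply: eq_bigr => i _; rewrite linearZ coord_dual // mulrC.
Qed.

Fact pairing_smooth (phi : section dual_bundle) (mu : section E) :
  smooth_on setT (fun x => (phi x : 'Hom(E x, R^o)) (mu x)).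
Proof.
apply: smooth_on_local => x _; have [e fe ex] := frame_cover E x.
exists (fdom e) => //; have oe := frame_open fe.
apply: (smooth_on_congr oe) (fun y ey => esym (pairing_frame (phi y) (mu y) fe ey)) _.
apply: smooth_on_sum => // i; apply: smooth_on_mul => //; last exact: secP.
by apply: (secP phi (e := dual_frame e)); exists e.
Qed.

Definition pairing (phi : section dual_bundle) (mu : section E) : Cinf M :=
  MkCinf (pairing_smooth phi mu).

Fact tilde_smooth (mu : section E) : @smooth_on R (m + n) (total_space dual_bundle) setT
  (fun a => (projT2 a : 'Hom(E (projT1 a), R^o)) (mu (projT1 a))).
Proof.
move=> C AC k; have oC := @mopenT _ _ (total_space dual_bundle) C AC.
case: AC oC => c [_ [Ac [e fe ->] ->]] oC.
apply: (@Ck_congr R k _ _ (fun v => \sum_i v 0 (rshift m i) *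
  coord (fsec e (cinv c (lsubmx v))) i (mu (cinv c (lsubmx v)))) _ oC).
  move=> _ [a [Ca _] <-]; rewrite total_chartK //; last by exists e.
  case: a Ca => x u [/= cx ex]; rewrite row_mxKl (chartK (atlasP M)) //.
  rewrite (pairing_frame _ _ fe ex); apply: eq_bigr => i _.
  by rewrite row_mxEr mxE.
elim: (index_enum _) => [|h r IH].
  rewrite (_ : (fun y => _) = fun=> 0); first exact: Ck_cst.
  by apply/funext => y; rewrite big_nil.
rewrite (_ : (fun y => _) = fun y : 'rV[R]_(m + n) => y 0 (rshift m h) *
    coord (fsec e (cinv c (lsubmx y))) h (mu (cinv c (lsubmx y))) +
  \sum_(i <- r) y 0 (rshift m i) *
    coord (fsec e (cinv c (lsubmx y))) i (mu (cinv c (lsubmx y)))).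
  apply: Ck_add => //; apply: Ck_mul => //; first exact: Ck_coord.
  apply: (Ck_sub (U := [set v | (cfun c @` (cdom c `&` fdom e)) (lsubmx v)])).
    by move=> _ [[x u] [[/= cx ex] _] <-]; rewrite /= row_mxKl; exists x.
  apply: (@Ck_lsub R k m n _
    (fun y => coord (fsec e (cinv c y)) h (mu (cinv c y)))).
  exact: (secP mu h fe Ac).
by apply/funext => y; rewrite big_cons.
Qed.

(* The fibrewise linear function alpha |-> alpha(mu(pi^* alpha)). *)
Definition tilde (mu : section E) : Cinf (total_space dual_bundle) := MkCinf (tilde_smooth mu).

End Dual.

Section Algebroid.
Variables (R : realType) (m : nat) (M : manifold R m) (n : nat).

(* A tangent vector at x acts on functions as \sum_l a^l d/dx^l at x. *)
Record tangent (x : M) := MkTangent {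
  tan_op :> Cinf M -> R;
  tan_loc : forall c, atlas c -> cdom c x ->
    exists a : 'I_m -> R, forall F, tan_op F = \sum_l a l * dpart c l F x }.

(* A vector bundle homomorphism A -> TM, smooth in local trivialisations. *)
Record anchor_map (A : vbundle M n) := MkAnchor {
  anc_fib :> forall x, A x -> tangent x;
  anc_linear : forall x a (u v : A x) F,
    anc_fib (a *: u + v) F = a * anc_fib u F + anc_fib v F;
  anc_smooth : forall c e, atlas c -> frames e ->
    exists r : 'I_n -> 'I_m -> M -> R,
      (forall i l, smooth_on (cdom c `&` fdom e) (r i l)) /\
      forall x i F, cdom c x -> fdom e x ->
        anc_fib (tnth (fsec e x) i) F = \sum_l r i l x * dpart c l F x }.

Lemma Ck_dpart k c l (F : Cinf M) : atlas c ->
  Ck k (cfun c @` (cdom c `&` setT)) (fun y => dpart c l F (cinv c y)).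
Proof.
move=> Ac; have [_ /(_ l)[_]] := cinfP F Ac k.+1.
apply: Ck_congr; first exact: (@mopenT _ _ M c Ac).
by move=> _ [x [cx _] <-]; rewrite /dpart (chartK (atlasP M)).
Qed.

Variables (A : vbundle M n) (rho : anchor_map A).

Lemma anc0 x F : rho x 0 F = 0.
Proof.
have := anc_linear rho 1 (0 : A x) 0 F.
by rewrite scaler0 addr0 mul1r => /eqP; rewrite -subr_eq0 opprD addNKr oppr_eq0 => /eqP.
Qed.

Lemma anc_sum x (k : 'I_n -> R) (v : 'I_n -> A x) F :
  rho x (\sum_i k i *: v i) F = \sum_i k i * rho x (v i) F.
Proof.
elim: (index_enum _) => [|h r IH]; first by rewrite !big_nil anc0.
by rewrite !big_cons anc_linear IH.
Qed.

Lemma anc_loc_sec c e : atlas c -> frames e -> exists r : 'I_n -> 'I_m -> M -> R,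
  (forall i l, smooth_on (cdom c `&` fdom e) (r i l)) /\
  forall (mu : section A) x F, (cdom c `&` fdom e) x ->
    rho x (mu x) F = \sum_l
      (\sum_i coord (fsec e x) i (mu x) * r i l x) * dpart c l F x.
Proof.
move=> Ac fe; have [r [sr rE]] := anc_smooth rho Ac fe; exists r; split => //.
move=> mu x F [cx ex]; rewrite {1}(frame_coord (mu x) fe ex) anc_sum.
under eq_bigr do rewrite rE // big_distrr /=.
rewrite exchange_big /=; apply: eq_bigr => l _; rewrite big_distrl /=.
by apply: eq_bigr => i _; rewrite mulrA.
Qed.

Lemma anc_coef_smooth c e (r : 'I_n -> 'I_m -> M -> R) (mu : section A) l :
  atlas c -> frames e -> (forall i l, smooth_on (cdom c `&` fdom e) (r i l)) ->
  smooth_on (cdom c `&` fdom e)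
    (fun x => \sum_i coord (fsec e x) i (mu x) * r i l x).
Proof.
move=> Ac fe sr; have oV : mopen (cdom c `&` fdom e).
  by apply: mopenI; [exact: mopen_dom|exact: frame_open].
apply: smooth_on_sum => // i; apply: smooth_on_mul => //.
by apply: smooth_on_sub (secP mu i fe) => x [].
Qed.

Fact anc_cinf (mu : section A) (F : Cinf M) : smooth_on setT (fun x => rho x (mu x) F).
Proof.
move=> c Ac k; apply: Ck_local => _ [x [cx _] <-].
have [e fe ex] := frame_cover A x.
have oV : mopen (cdom c `&` fdom e).
  by apply: mopenI; [exact: mopen_dom|exact: frame_open].
exists (cfun c @` (cdom c `&` (cdom c `&` fdom e))); first by exists x.
have [r [sr rE]] := anc_loc_sec Ac fe.
apply: (@Ck_congr R k m _ (fun y => \sum_l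
  (\sum_i coord (fsec e (cinv c y)) i (mu (cinv c y)) * r i l (cinv c y)) *
  dpart c l F (cinv c y)) _ (oV c Ac)).
  by move=> _ [y [cy Vy] <-]; rewrite (chartK (atlasP M)) // rE.
elim: (index_enum _) => [|l s IH].
  rewrite (_ : (fun y => _) = fun=> 0); first exact: Ck_cst.
  by apply/funext => y; rewrite big_nil.
rewrite (_ : (fun y => _) = fun y =>
  (\sum_i coord (fsec e (cinv c y)) i (mu (cinv c y)) * r i l (cinv c y)) *
    dpart c l F (cinv c y) +
  \sum_(l <- s)
  (\sum_i coord (fsec e (cinv c y)) i (mu (cinv c y)) * r i l (cinv c y)) *
    dpart c l F (cinv c y)).
  apply: Ck_add IH => //; first exact: (oV c Ac).
  apply: Ck_mul; first exact: (oV c Ac).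
    exact: (anc_coef_smooth mu l Ac fe sr Ac k).
  apply: Ck_sub (Ck_dpart k l F Ac).
  by apply: image_subset => y [].
by apply/funext => y; rewrite big_cons.
Qed.

(* The induced map from sections of A to vector fields. *)
Program Definition anchor_vf (mu : section A) : vfield M :=
  @MkVfield R m M (fun F => MkCinf (anc_cinf mu F)) _.
Next Obligation.
move=> mu c x Ac cx; have [e fe ex] := frame_cover A x.
have [r [sr rE]] := anc_loc_sec Ac fe.
exists (cdom c `&` fdom e),
  (fun l y => \sum_i coord (fsec e y) i (mu y) * r i l y); split.
- by apply: mopenI; [exact: mopen_dom|exact: frame_open].
- by split => // y [].
- by move=> l; exact: anc_coef_smooth.
- by move=> y F Vy /=; exact: rE.
Qed.

End Algebroid.

Section LieAlgebroid.
Variables (R : realType) (m : nat) (M : manifold R m) (n : nat) (A : vbundle M n).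

Record lie_algebroid := MkLieAlgebroid {
  anchor : anchor_map A;
  lbr : section A -> section A -> section A;
  (* R-linearity: a real number acts as the corresponding constant function. *)
  lbr_linear : forall (a : R) mu nu eta,
    lbr (cinf_cst M a *: mu + nu) eta = cinf_cst M a *: lbr mu eta + lbr nu eta;
  lbr_anti : forall mu eta, lbr mu eta = - lbr eta mu;
  lbr_jacobi : forall mu nu eta,
    lbr mu (lbr nu eta) + lbr nu (lbr eta mu) + lbr eta (lbr mu nu) = 0;
  anchor_lbr : forall mu eta F, anchor_vf anchor (lbr mu eta) F =
    anchor_vf anchor mu (anchor_vf anchor eta F) -
    anchor_vf anchor eta (anchor_vf anchor mu F);
  lbr_leibniz : forall mu eta f,
    lbr mu (f *: eta) = f *: lbr mu eta + anchor_vf anchor mu f *: eta }.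

Variable L : lie_algebroid.

Definition cocycle (phi : section (dual_bundle A)) := forall mu eta,
  pairing phi (lbr L mu eta) =
  anchor_vf (anchor L) mu (pairing phi eta) - anchor_vf (anchor L) eta (pairing phi mu).

Definition germ_eq (x : M) (s t : forall y, A y) :=
  exists2 V : set M, mopen V /\ V x & forall y, V y -> s y = t y.

(* v is the value at x of the bracket of the local sections s and t, computed
   with global sections which coincide with s and t near x; it does not depend
   on the choice of these because the bracket is local. *)
Definition local_bracket (s t : forall y, A y) (x : M) (v : A x) :=
  exists mu eta : section A, [/\ germ_eq x mu s, germ_eq x eta t & v = lbr L mu eta x].

(* [e_i, e_j] = \sum_k c_(ij)^k e_k and rho(e_i) = \sum_l rho_i^l d/dx^l. *)
Definition structure_functions (c : chart R M m) (e : frame n A)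
    (cs : 'I_n -> 'I_n -> 'I_n -> M -> R) (rs : 'I_n -> 'I_m -> M -> R) :=
  forall x, cdom c x -> fdom e x ->
    (forall i j, local_bracket (fun y => tnth (fsec e y) i) (fun y => tnth (fsec e y) j)
       (\sum_k cs i j k x *: tnth (fsec e x) k)) /\
    (forall i F, anchor L x (tnth (fsec e x) i) F = \sum_l rs i l x * dpart c l F x).

(* (d/dy^i /\ d/dy^j)(dF, dG) at a, for the coordinates y of the chart C. *)
Definition coord_wedge p (N : manifold R p) (C : chart R N p) (i j : 'I_p)
    (F G : Cinf N) (a : N) : R :=
  dpart C i F a * dpart C j G a - dpart C i G a * dpart C j F a.

(* alpha(v); for v = e_k this is the fibre coordinate mu_k of alpha. *)
Definition dual_ev (a : total_space (dual_bundle A)) (v : A (projT1 a)) : R :=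
  (projT2 a : 'Hom(A (projT1 a), R^o)) v.
Arguments dual_ev a v : clear implicits.

(* The chart (x^l, mu_i) of the dual bundle: x^l has index [lshift n l] and mu_i
   has index [rshift m i]. *)
Definition dual_chart (c : chart R M m) (e : frame n A) :
  chart R (total_space (dual_bundle A)) (m + n) := total_chart (E := dual_bundle A) c (dual_frame e).

(* The Poisson structure on the dual bundle induced by the Lie algebroid; the
   local expression determines it, since the charts (x^l, mu_i) cover. *)
Definition linear_poisson (P : bivector (total_space (dual_bundle A))) :=
  (forall F G H, schouten22 P P F G H = 0) /\
  forall c e, atlas c -> frames e -> exists cs rs, structure_functions c e cs rs /\
    forall a F G, cdom (dual_chart c e) a ->
      P F G a =
        \sum_(i < n) \sum_(j < n | (i < j)%N) \sum_(k < n)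
          cs i j k (projT1 a) * dual_ev a (tnth (fsec e (projT1 a)) k) *
          coord_wedge (dual_chart c e) (rshift m i) (rshift m j) F G a
        + \sum_(i < n) \sum_(l < m)
          rs i l (projT1 a) *
          coord_wedge (dual_chart c e) (rshift m i) (lshift n l) F G a.

Definition liouville (X : vfield (total_space (dual_bundle A))) :=
  forall c e, atlas c -> frames e -> forall a F, cdom (dual_chart c e) a ->
    X F a = \sum_(i < n) dual_ev a (tnth (fsec e (projT1 a)) i) *
      dpart (dual_chart c e) (rshift m i) F a.

Definition vertical_lift (phi : section (dual_bundle A)) (X : vfield (total_space (dual_bundle A))) :=
  forall c e, atlas c -> frames e -> forall a F, cdom (dual_chart c e) a ->
    X F a = \sum_(i < n)
      (phi (projT1 a) : 'Hom(A (projT1 a), R^o)) (tnth (fsec e (projT1 a)) i) *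
      dpart (dual_chart c e) (rshift m i) F a.

Definition linear_bracket (phi : section (dual_bundle A))
    (br : Cinf (total_space (dual_bundle A)) -> Cinf (total_space (dual_bundle A)) -> Cinf (total_space (dual_bundle A))) :=
  [/\ forall mu eta, br (tilde mu) (tilde eta) = tilde (lbr L mu eta),
      forall mu f, br (tilde mu) (pullback (dual_bundle A) f) =
        pullback (dual_bundle A) (anchor_vf (anchor L) mu f + pairing phi mu * f) &
      forall f g, br (pullback (dual_bundle A) f) (pullback (dual_bundle A) g) = 0].

End LieAlgebroid.

(* Main.v *)
Require Import Defs.
From mathcomp Require Import all_boot all_order all_algebra.
From mathcomp Require Import finmap boolp classical_sets functions.
From mathcomp Require Import reals topology normedtype derive.
From mathcomp Require Import sequences realfun exp ring lra.
Set Implicit Arguments.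
Unset Strict Implicit.
Unset Printing Implicit Defensive.
Import Order.TTheory GRing.Theory Num.Theory numFieldNormedType.Exports.
Local Open Scope classical_set_scope.
Local Open Scope ring_scope.

(** On the total space of the dual bundle, the differentials of the fibrewise
    linear functions and of the functions pulled back from the base span every
    cotangent space.  Hence two vector fields, or two bivector fields, which
    agree on these generators are equal.  This gives the uniqueness ([E] is read
    off the bracket with the constant function 1), and it also shows that the
    local expressions of the Poisson structure, of the Liouville field and of
    the vertical lift do not depend on the chart, so that they glue.  With
    [X_F = P(dF, -)], the trivector [[P, P]] evaluated on [dF], [dG], [dH] is
    twice [X_(P(F, G)) H + [X_G, X_F] H], which depends on [H] only through [dH]
    because second derivatives cancel in a commutator of vector fields; so the
    Schouten identities only have to be checked on the generators, where they
    are the Jacobi identity, the Leibniz rule, the compatibility with the anchor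
    and the cocycle condition. *)

(** * Differential calculus in R^n *)

Section DirectionalCalculus.
Variable R : realType.

(** Sections, functions and fields are global, whereas frames, coordinates and structure functions
    are local. Bump functions bridge the two: they extend a local frame or coordinate to a global
    object that agrees with it near a given point, and they make the Lie bracket local. This is what
    the calculus is for: smoothness of [exp(-1/x)] for the bumps, the chain rule for changes of
    chart, symmetry of second derivatives for commutators. The shape of the pair is forced. As
    [{F, 1} = - E(F)], the mixed bracket relation at the function [1] gives
    [E(tilde mu) = - phi(mu)]. The terms [F E(G) - G E(F)] then disturb the bracket of two linear
    functions by [tilde eta phi(mu) - tilde mu phi(eta)], and the wedge of the Liouville field with
    the vertical lift removes exactly this, because the first fixes linear functions and the second
    sends [tilde mu] to [phi(mu)]. The Poisson condition is not verified separately: it is the same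
    computation with zero cocycle and zero vector field. *)

Lemma is_derive_line (V : normedModType R) (F : V -> R) x v (t : R) :
  derivable F (t *: v + x) v ->
  is_derive t (1 : R) (fun h : R => F (h *: v + x)) ('D_v F (t *: v + x)).
Proof.
move=> dF.
have E : (fun h : R => h^-1 *: (((fun h => F (h *: v + x)) \o shift t) (h *: (1 : R)) -
    F (t *: v + x))) =
  (fun h : R => h^-1 *: ((F \o shift (t *: v + x)) (h *: v) - F (t *: v + x))).
  by apply/funext => h /=; rewrite [h *: 1]mulr1 scalerDl addrA.
by split; rewrite /derivable /derive E.
Qed.

(** Derivability is asked on the symmetric range [|s| <= |t|], so that callers need not know the
    sign of [t]; only the proof distinguishes it, to order the endpoints. *)
Lemma MVT_line (V : normedModType R) (F : V -> R) x v (t : R) :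
  (forall s, `|s| <= `|t| -> derivable F (s *: v + x) v) ->
  exists2 s, `|s| <= `|t| & F (t *: v + x) - F x = t * 'D_v F (s *: v + x).
Proof.
move=> dF; pose G := fun h : R => F (h *: v + x).
have F0 : F x = G 0 by rewrite /G scale0r add0r.
have dG (s : R) : `|s| <= `|t| -> is_derive s 1 G ('D_v F (s *: v + x)).
  by move=> /dF; exact: is_derive_line.
have cG (s : R) : `|s| <= `|t| -> {for s, continuous G}.
  move=> /dG dGs; apply: differentiable_continuous; apply/derivable1_diffP.
  exact: ex_derive.
have [t0|t0] := leP 0 t.
  have [s /itvP st E] := @MVT_segment R G (fun s => 'D_v F (s *: v + x)) 0 t t0
    (ltac:(move=> s /itvP st; apply: dG; rewrite !ger0_norm ?st //))
    (ltac:(apply: continuous_in_subspaceT => s /set_mem/itvP st; apply: cG; rewrite !ger0_norm ?st //)).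
  exists s; first by rewrite !ger0_norm ?st.
  by rewrite F0 -/(G t) E subr0 mulrC.
have [s /itvP st E] := @MVT_segment R G (fun s => 'D_v F (s *: v + x)) t 0 (ltW t0)
    (ltac:(move=> s /itvP st; apply: dG; rewrite !ler0_norm ?lerN2 ?st // ltW //))
    (ltac:(apply: continuous_in_subspaceT => s /set_mem/itvP st; apply: cG; rewrite !ler0_norm ?lerN2 ?st // ltW //)).
exists s; first by rewrite !ler0_norm ?lerN2 ?st // ltW.
by rewrite F0 -/(G t) -opprB E sub0r mulrN opprK mulrC.
Qed.

(** The radius is constrained separately because for [n = 0] the condition on coordinates is
    empty. *)
Lemma ball_rVP n (x y : 'rV[R]_n) e :
  ball x e y <-> 0 < e /\ forall i, `|x 0 i - y 0 i| < e.
Proof.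
split=> [[e0 xy]|[e0 xy]]; split=> // i; first exact: xy.
by move=> j; rewrite (ord1 i); exact: xy.
Qed.

(* Caratheodory's form of differentiability: from [x] to [y] one moves along one
   coordinate axis at a time and applies the mean value theorem on each leg. *)
Lemma C1_partial_slopes n (U : set 'rV[R]_n) (F : 'rV[R]_n -> R) x :
  open U -> Ck 1 U F -> U x ->
  exists A : 'I_n -> 'rV[R]_n -> R,
    (forall i, A i y @[y --> x] --> 'D_(delta_mx 0 i) F x) /\
    \forall y \near x, F y - F x = \sum_i A i y * (y 0 i - x 0 i).
Proof.
move=> oU [_ F1] Ux.
have /nbhs_ballP[r /= r0 rU] : nbhs x U by apply: open_nbhs_nbhs.
pose p k (y : 'rV[R]_n) : 'rV[R]_n := \row_j (if (j < k)%N then y 0 j else x 0 j).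
(* [z] is the mean value point on the leg in direction [i]. It lies in every ball around [x] that
   contains [y], hence tends to [x] with [y]; for [y] outside the ball of radius [r] the value [x]
   is a mere default. *)
have H (iy : 'I_n * 'rV[R]_n) : exists z, ball x r iy.2 ->
    (forall s, ball x s iy.2 -> ball x s z) /\
    F (p iy.1.+1 iy.2) - F (p iy.1 iy.2) =
      'D_(delta_mx 0 iy.1) F z * (iy.2 0 iy.1 - x 0 iy.1).
  case: iy => i y /=; have [yr|] := pselect (ball x r y); last by exists x.
  have pi : p i.+1 y = (y 0 i - x 0 i) *: delta_mx 0 i + p i y.
    apply/rowP => j; rewrite !mxE eqxx /= ltnS leq_eqVlt val_eqE.
    have [->|_] /= := eqVneq j i; first by rewrite ltnn mulr1 subrK.
    by rewrite mulr0 add0r.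
  have zs (s : R) e : `|s| <= `|y 0 i - x 0 i| -> ball x e y ->
      ball x e (s *: delta_mx 0 i + p i y).
    move=> sy /ball_rVP[e0 xy]; apply/ball_rVP; split => // j; rewrite !mxE eqxx /=.
    have [->|_] /= := eqVneq j i.
      rewrite ltnn mulr1 opprD addrCA subrr addr0 normrN.
      by apply: le_lt_trans sy _; rewrite distrC.
    by rewrite mulr0 add0r; case: ifP => _; rewrite ?subrr ?normr0.
  have [s sy E] := @MVT_line _ F (p i y) (delta_mx 0 i) (y 0 i - x 0 i)
    (fun s sy => (F1 i).1 _ (rU _ (zs s r sy yr))).
  exists (s *: delta_mx 0 i + p i y) => _; split; first by move=> e; exact: zs.
  by rewrite pi E mulrC.
have [z zP] := choice H.
exists (fun i y => 'D_(delta_mx 0 i) F (z (i, y))); split.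
  move=> i; have c := (F1 i).2.1 _ Ux.
  suff cz : z (i, y) @[y --> x] --> x by exact: cvg_comp cz c.
  apply/(@cvg_ballP _ _ _ _ (nbhs_filter x)) => e e0.
  apply: (@filterS2 _ _ (nbhs_filter x) _ _ _ _
    (nbhsx_ballx x r r0) (nbhsx_ballx x e e0)) => y yr ye.
  exact: (zP (i, y) _).1.
near=> y.
have yr : ball x r y by near: y; exact: nbhsx_ballx.
have -> : F y - F x = F (p n y) - F (p 0 y).
  congr (F _ - F _); apply/rowP => j; rewrite mxE //.
  by rewrite ltn_ord.
rewrite -(telescope_sumr (fun k => F (p k y))) // big_mkord.
by apply: eq_bigr => i _; rewrite ((zP (i, y)) yr).2.
Unshelve. all: by end_near. Qed.

(** Insert [g (h *: w + z)] into the slope identity for [F] at [g z] and divide by [h]: the slopes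
    converge since [g] is continuous along the line, and the increments of the coordinates of [g]
    converge to their derivatives. *)
Lemma derive_chain p n (g : 'rV[R]_p -> 'rV[R]_n) (F : 'rV[R]_n -> R) U z w :
  open U -> Ck 1 U F -> U (g z) ->
  (forall i, derivable (fun y => g y 0 i) z w) ->
  is_derive z w (fun y => F (g y))
    (\sum_i 'D_w (fun y => g y 0 i) z * 'D_(delta_mx 0 i) F (g z)).
Proof.
move=> oU F1 Ugz dg.
have [A [cA AE]] := C1_partial_slopes oU F1 Ugz.
have cg : g (h *: w + z) @[h --> (0 : R)] --> g z.
  have H i : (g (h *: w + z) 0 i) @[h --> (0 : R)] --> g z 0 i.
    have /derivable1P/derivable1_diffP/differentiable_continuous := dg i.
    by rewrite /prop_for /continuous_at /= scale0r add0r.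
  apply/cvg_ballP => e e0.
  have {}H : \forall h \near (0 : R), forall i, `|g z 0 i - g (h *: w + z) 0 i| < e.
    apply: (@filter_forall _ _ _ (nbhs (0 : R)) (nbhs_filter _)) => i.
    by have /cvgrPdist_lt/(_ e e0) := H i.
  apply: (@filterS _ _ (nbhs_filter (0 : R)) _ _ _ H) => h gh.
  by apply/ball_rVP.
have E : (fun h : R => h^-1 *: (((fun y => F (g y)) \o shift z) (h *: w) - F (g z)))
    @ 0^' --> \sum_i 'D_w (fun y => g y 0 i) z * 'D_(delta_mx 0 i) F (g z).
  apply: (@cvg_trans _ ((fun h : R => \sum_i
     (h^-1 *: (((fun y => g y 0 i) \o shift z) (h *: w) - g z 0 i)) *
     A i (g (h *: w + z))) @ 0^')).
    apply: near_eq_cvg; near=> h.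
    have -> : F (g (h *: w + z)) - F (g z) =
        \sum_i A i (g (h *: w + z)) * (g (h *: w + z) 0 i - g z 0 i).
      near: h; apply: cvg_within; exact: (cg _ AE).
    rewrite scaler_sumr; apply: eq_bigr => i _.
    by rewrite /= [A _ _ * _]mulrC; apply: esym; exact: mulrA.
  apply: cvg_big => [|i _]; first exact: add_continuous.
  apply: cvgM; first exact: dg.
  apply: cvg_comp (cA i); apply: cvg_trans cg.
  apply: cvg_app; exact: cvg_within.
split; first by apply/cvg_ex; eexists; exact: E.
exact: cvg_lim E.
Unshelve. all: by end_near. Qed.

End DirectionalCalculus.

(** * Symmetry of second partial derivatives *)

Section Schwarz.
Variable R : realType.

(** This is the symmetry of a second difference in its two increments. *)
Lemma subrACA (V : zmodType) (a b c d : V) : a - c - (b - d) = a - b - (c - d).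
Proof. by rewrite !opprB addrACA (addrC (- c)) -addrACA. Qed.

Lemma ler_dist_half (v a b e : R) :
  `|a - v| < e / 2 -> `|b - v| < e / 2 -> `|a - b| <= e.
Proof.
move=> av bv; have -> : a - b = (a - v) - (b - v) by ring.
by apply: le_trans (ler_normB _ _) _; lra.
Qed.

(** The mean value theorem is applied twice: along [i] to the increment [G] of [F] along [j], then
    along [j] to the [i]-th derivative. The displacement is at most [2t] in each coordinate, so the
    open ball of radius [3t] contains the intermediate point. *)
Lemma second_difference n (U : set 'rV[R]_n) (F : 'rV[R]_n -> R) x r (i j : 'I_n) :
  ball x r `<=` U -> Ck 2 U F -> forall t, 0 < t -> t + t < r ->
  exists2 z, ball x (t + t + t) z &
    F (t *: delta_mx 0 i + (t *: delta_mx 0 j + x)) - F (t *: delta_mx 0 i + x)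
    - (F (t *: delta_mx 0 j + x) - F x) =
    t * (t * 'D_(delta_mx 0 j) ('D_(delta_mx 0 i) F) z).
Proof.
move=> rU [_ F2] t t0 tr.
(* Bounding by the sum, not by the maximum, also covers [i = j], where both displacements fall on
   one coordinate. *)
have near_x (a b : R) e : `|a| + `|b| < e ->
    ball x e (a *: delta_mx 0 i + (b *: delta_mx 0 j + x)).
  move=> ab; apply/ball_rVP; split; first by apply: le_lt_trans ab; rewrite addr_ge0.
  move=> k; rewrite !mxE eqxx /= addrA opprD addrCA subrr addr0 normrN.
  apply: le_lt_trans ab; apply: le_trans (ler_normD _ _) _; rewrite !normrM.
  by apply: lerD; rewrite ler_piMr // normr_nat lern1 leq_b1.
have tt : `|t| = t by rewrite gtr0_norm.
pose G y := F (t *: delta_mx 0 j + y) - F y.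
have dF y : U y -> derivable F y (delta_mx 0 i) by exact: (F2 i).1.
have ij (s : R) (y : 'rV[R]_n) : t *: delta_mx 0 j + (s *: delta_mx 0 i + y) =
  s *: delta_mx 0 i + (t *: delta_mx 0 j + y) by rewrite addrCA.
have dFs (s : R) y : U (t *: delta_mx 0 j + (s *: delta_mx 0 i + y)) ->
    is_derive (s *: delta_mx 0 i + y) (delta_mx 0 i)
    (fun y => F (t *: delta_mx 0 j + y))
    ('D_(delta_mx 0 i) F (t *: delta_mx 0 j + (s *: delta_mx 0 i + y))).
  move=> Uz; have lin (h : R) z : h *: delta_mx 0 i +
      (t *: delta_mx 0 j + z) = t *: delta_mx 0 j + (h *: delta_mx 0 i + z).
    by rewrite addrCA.
  have E : (fun h : R => h^-1 *: (((fun y => F (t *: delta_mx 0 j + y)) \o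
      shift (s *: delta_mx 0 i + y)) (h *: delta_mx 0 i) -
      F (t *: delta_mx 0 j + (s *: delta_mx 0 i + y)))) =
    (fun h : R => h^-1 *: ((F \o shift (t *: delta_mx 0 j + (s *: delta_mx 0 i + y)))
      (h *: delta_mx 0 i) - F (t *: delta_mx 0 j + (s *: delta_mx 0 i + y)))).
    by apply/funext => h /=; rewrite lin.
  by split; rewrite /derivable /derive E //; exact: dF Uz.
have dG (s : R) : `|s| <= `|t| -> is_derive (s *: delta_mx 0 i + x) (delta_mx 0 i) G
    ('D_(delta_mx 0 i) F (t *: delta_mx 0 j + (s *: delta_mx 0 i + x)) -
     'D_(delta_mx 0 i) F (s *: delta_mx 0 i + x)).
  move=> st; apply: is_deriveB.
    apply: dFs; apply: rU; rewrite ij; apply: near_x.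
    by apply: le_lt_trans tr; rewrite -[X in _ <= X + X]tt lerD.
  apply/derivableP/dF/rU.
  rewrite -[x in _ + x]add0r -(scale0r (delta_mx 0 j)); apply: near_x.
  rewrite normr0 addr0; apply: le_lt_trans st _.
  by rewrite tt (lt_trans _ tr) // ltrDl.
have [s st E] := @MVT_line _ _ G x (delta_mx 0 i) t
  (fun s st => @ex_derive _ _ _ _ _ _ _ (dG s st)).
have dFj y : U y -> derivable ('D_(delta_mx 0 i) F) y (delta_mx 0 j).
  exact: ((F2 i).2.2 j).1.
have near_ji (s' : R) : `|s'| <= `|t| ->
    ball x (t + t + t) (s' *: delta_mx 0 j + (s *: delta_mx 0 i + x)) /\
    ball x r (s' *: delta_mx 0 j + (s *: delta_mx 0 i + x)).
  move=> s't; rewrite addrCA; split; apply: near_x.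
    by rewrite tt in st s't; apply: le_lt_trans (lerD st s't) _; rewrite ltrDl.
  by rewrite tt in st s't; apply: le_lt_trans (lerD st s't) _.
have [s' s't E'] := @MVT_line _ _ ('D_(delta_mx 0 i) F) (s *: delta_mx 0 i + x)
   (delta_mx 0 j) t (fun s' s't => dFj _ (rU _ (near_ji s' s't).2)).
exists (s' *: delta_mx 0 j + (s *: delta_mx 0 i + x)); first exact: (near_ji _ s't).1.
rewrite -E' -(derive_val (is_derive := dG s st)) -E /G ij; ring.
Qed.

(** Divided by [t^2], the second difference is a value of either mixed derivative at some point
    within [3t] of [x]. Both derivatives are continuous at [x], so their values there differ by at
    most any [e > 0]. *)
Lemma schwarz n (U : set 'rV[R]_n) (F : 'rV[R]_n -> R) x (i j : 'I_n) :
  open U -> Ck 2 U F -> U x ->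
  'D_(delta_mx 0 i) ('D_(delta_mx 0 j) F) x = 'D_(delta_mx 0 j) ('D_(delta_mx 0 i) F) x.
Proof.
move=> oU F2 Ux; have /nbhs_ballP[r /= r0 rU] : nbhs x U by apply: open_nbhs_nbhs.
apply/eqP; rewrite -subr_eq0 -normr_le0; apply/ler_addgt0Pl => e e0; rewrite addr0.
have c (k l : 'I_n) : \forall z \near x,
    `|'D_(delta_mx 0 k) ('D_(delta_mx 0 l) F) x -
      'D_(delta_mx 0 k) ('D_(delta_mx 0 l) F) z| < e / 2.
  have [_ /(_ l)[_ [_ /(_ k)[_ [cF _]]]]] := F2.
  by have /cvgrPdist_lt/(_ (e / 2)) := cF _ Ux; apply; rewrite divr_gt0.
have /nbhs_ballP[d /= d0 dij] : nbhs x _ := c i j.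
have /nbhs_ballP[d' /= d'0 dji] : nbhs x _ := c j i.
(* Division by 4 leaves [3t] strictly below all three radii. *)
pose t := Num.min r (Num.min d d') / 4.
have m0 : 0 < Num.min r (Num.min d d') by rewrite !lt_min r0 d0 d'0.
have t0 : 0 < t by rewrite divr_gt0.
have [tr td td'] : [/\ t + t < r, t + t + t < d & t + t + t < d'].
  have : Num.min r (Num.min d d') <= r by rewrite ge_min lexx.
  have : Num.min r (Num.min d d') <= d by rewrite !ge_min lexx orbT.
  have : Num.min r (Num.min d d') <= d' by rewrite !ge_min lexx !orbT.
  have -> : Num.min r (Num.min d d') = 4 * t by rewrite /t; field.
  by split; lra.
have [z zt E] := @second_difference n U F x r i j rU F2 t t0 tr.
have [z' z't E'] := @second_difference n U F x r j i rU F2 t t0 tr.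
have FF : F (t *: delta_mx 0 j + (t *: delta_mx 0 i + x)) =
    F (t *: delta_mx 0 i + (t *: delta_mx 0 j + x)) by congr (F _); rewrite addrCA.
have {E E'} zz' : 'D_(delta_mx 0 i) ('D_(delta_mx 0 j) F) z' =
    'D_(delta_mx 0 j) ('D_(delta_mx 0 i) F) z.
  have H := etrans (esym E') (etrans _ E).
  by apply: (mulfI (lt0r_neq0 t0)); apply: (mulfI (lt0r_neq0 t0)); apply: H;
    rewrite FF; exact: subrACA.
apply: (@ler_dist_half ('D_(delta_mx 0 j) ('D_(delta_mx 0 i) F) z)); last first.
  exact: dji (le_ball (ltW td') zt).
by rewrite -zz'; exact: dij (le_ball (ltW td) z't).
Qed.

End Schwarz.

(** * The flat functions built from [exp(-1/x)] *)

Section Flat.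
Variable R : realType.

Lemma is_derive_comp1 (V : normedModType R) (f : V -> R) (g : R -> R) x v dg :
  derivable f x v -> is_derive (f x) 1 g dg ->
  is_derive x v (fun y => g (f y)) (dg * 'D_v f x).
Proof.
move=> df dgx; have fx : f (0 *: v + x) = f x by rewrite scale0r add0r.
have d1 : is_derive (0 : R) 1 (fun h : R => f (h *: v + x)) ('D_v f x).
  by have := @is_derive_line R V f x v 0; rewrite scale0r add0r; apply.
have d2 : is_derive (0 : R) 1 (g \o (fun h : R => f (h *: v + x))) (dg * 'D_v f x).
  by apply: is_derive1_comp; rewrite fx.
have dgf : derivable (fun y => g (f y)) x v by apply/derivable1P; exact: (@ex_derive _ _ _ _ _ _ _ d2).
apply: DeriveDef => //; rewrite -(derive_val (is_derive := d2)).
have dl : is_derive (0 : R) 1 (fun h : R => g (f (h *: v + x))) ('D_v (fun y => g (f y)) x).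
  by have := @is_derive_line R V (fun y => g (f y)) x v 0; rewrite scale0r add0r; apply.
by rewrite -(derive_val (is_derive := dl)).
Qed.

(** The powers of [1/x] are included so that the family is closed under differentiation: the
    derivative of [flat k] is a combination of [flat k.+2] and [flat k.+1]. *)
Definition flat k (x : R) : R := if 0 < x then x^-1 ^+ k * expR (- x^-1) else 0.

(** With [y = 1/x], the estimate [exp y >= y^(k+2) / (k+2)!] bounds the difference quotient of
    [flat k] at [0] by a multiple of [|x|], which yields the derivative [0] at the origin. *)
Lemma flat_le k x : 0 < x -> `|x^-1 * flat k x| <= k.+2`!%:R * `|x|.
Proof.
move=> x0; rewrite /flat x0 (gtr0_norm x0).
have y0 : 0 < x^-1 by rewrite invr_gt0.
rewrite ger0_norm; last by rewrite mulr_ge0 ?mulr_ge0 ?exprn_ge0 ?expR_ge0 // ltW.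
rewrite mulrA -exprS -ler_pdivrMr // mulrAC -exprSr.
rewrite expRN ler_pdivrMr ?expR_gt0 //.
have := @expR_ge1Dxn R x^-1 k.+1 (ltW y0).
have f0 : 0 < (k.+2)`!%:R :> R by rewrite ltr0n fact_gt0.
move=> h; rewrite mulrC -ler_pdivrMr //; apply: le_trans h; rewrite lerDr //.
Qed.

Lemma is_derive_flat k (x : R) : is_derive x (1 : R) (flat k) (flat k.+2 x - k%:R * flat k.+1 x).
Proof.
have [x0|x0|->] := ltgtP x 0.
- apply: (@near_eq_is_derive _ _ _ (fun=> 0)).
    near=> y; rewrite /flat ifF //; apply/negbTE; rewrite -leNgt ltW //.
    by near: y; exact: lt_nbhsl.
  apply: is_derive_eq; by rewrite /flat ltNge (ltW x0) /= mulr0 subr0.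
- apply: (@near_eq_is_derive _ _ _ (fun y : R => y^-1 ^+ k * expR (- y^-1))).
    near=> y; rewrite /flat ifT //; near: y; exact: lt_nbhsr.
  have xn0 : x != 0 by rewrite gt_eqF.
  have dV : is_derive x (1 : R) (fun y : R => y^-1) (- x ^- 2).
    apply: DeriveDef; first by apply: derivableV.
    by rewrite deriveV // derive_id; exact: mulr1.
  have dE : is_derive x (1 : R) (fun y : R => expR (- y^-1)) (expR (- x^-1) * - (- x ^- 2)).
    exact: (@is_derive1_comp _ expR (fun y : R => - y^-1) x _ _
      (is_derive_expR _) (@is_deriveN _ _ _ _ _ _ _ dV)).
  have dX : is_derive x (1 : R) (fun y : R => y^-1 ^+ k) (k%:R * x^-1 ^+ k.-1 * - x ^- 2).
    have -> : (fun y : R => y^-1 ^+ k) = (fun y : R => y^-1) ^+ k.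
      by apply/funext => y; rewrite !fctE.
    have dX := is_deriveX k dV; exact: dX.
  apply: is_derive_eq (@is_deriveM _ _ _ _ _ _ _ _ dX dE) _.
  rewrite /flat x0 /GRing.scale /=.
  case: k {dX} => [|k] /=; rewrite ?exprS ?expr0; first by field.
  by field.
- have E : (fun h : R => h^-1 *: ((flat k \o shift 0) (h *: (1 : R)) - flat k 0)) @ 0^' --> (0 : R).
    apply: (@cvg_to_0_linear _ _ (k.+2`!%:R) 1) => // h _ /=.
    have -> : h *: (1 : R) + 0 = h by rewrite addr0; exact: mulr1.
    rewrite {2}/flat ltxx subr0.
    have [h0|h0] := ltP 0 h; first exact: flat_le.
    by rewrite /flat ltNge h0 /= scaler0 normr0 mulr_ge0.
  rewrite /flat ltxx mulr0 subr0.
  split; first by apply/cvg_ex; eexists; exact: E.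
  exact: cvg_lim E.
Unshelve. all: by end_near. Qed.

Lemma continuous_flat k : continuous (flat k).
Proof.
move=> x; apply: differentiable_continuous; apply/derivable1_diffP.
exact: (@ex_derive _ _ _ _ _ _ _ (is_derive_flat k x)).
Qed.

(** The index [k] has to vary in the induction on [j], since differentiation raises it. *)
Lemma Ck_flat j k n (U : set 'rV[R]_n) f : open U -> Ck j U f -> Ck j U (fun x => flat k (f x)).
Proof.
move=> oU; elim: j k f => [|j IH] k f fj.
  split=> // x Ux; apply: continuous_comp; first exact: Ck_cont fj Ux.
  exact: continuous_flat.
have f' := Ck_pred fj; case: (fj) => _ fd; split.
  move=> x Ux; apply: continuous_comp; first exact: Ck_cont fj Ux.
  exact: continuous_flat.
move=> i; have [fi fdi] := fd i.
have D x : U x -> is_derive x (delta_mx 0 i) (fun x => flat k (f x))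
    ((flat k.+2 (f x) - k%:R * flat k.+1 (f x)) * 'D_(delta_mx 0 i) f x).
  by move=> Ux; apply: is_derive_comp1; [exact: fi|exact: is_derive_flat].
split; first by move=> x /D ?; exact: ex_derive.
apply: (@Ck_congr _ _ _ _ (fun x => (flat k.+2 (f x) + (- k%:R) * flat k.+1 (f x)) *
   'D_(delta_mx 0 i) f x)) => //.
  by move=> x /D [_ ->]; rewrite mulNr.
apply: Ck_mul => //; apply: Ck_add => //; first exact: IH.
by apply: Ck_mul => //; [exact: Ck_cst|exact: IH].
Qed.

End Flat.

(** * Bump functions on manifolds *)

Section Bump.
Variables (R : realType) (m : nat) (M : manifold R m).

Lemma mopen_local (O : set M) :
  (forall x, O x -> exists V : set M, [/\ mopen V, V x & V `<=` O]) -> mopen O.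
Proof.
move=> H c Ac; rewrite openE => _ [x [cx Ox] <-]; rewrite /interior.
have [V [oV Vx VO]] := H _ Ox.
apply: (@filterS _ _ (nbhs_filter _) (cfun c @` (cdom c `&` V))).
  by apply: image_subset => y [cy /VO].
by apply: open_nbhs_nbhs; split; [exact: oV|exists x].
Qed.

Lemma mopen_pos (O : set M) (f : M -> R) : mopen O -> smooth_on O f ->
  mopen (O `&` [set x | 0 < f x]).
Proof.
move=> oO sf c Ac; rewrite openE => _ [x [cx [Ox fx]] <-]; rewrite /interior.
have Ux : (cfun c @` (cdom c `&` O)) (cfun c x) by exists x.
have cf : f (cinv c y) @[y --> cfun c x] --> f x.
  have := Ck_cont (sf c Ac 0) Ux.
  by rewrite /prop_for /continuous_at (chartK (atlasP M)).
have nf : \forall y \near cfun c x, 0 < f (cinv c y).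
  exact: (cf _ (lt_nbhsr fx)).
have nU : nbhs (cfun c x) (cfun c @` (cdom c `&` O)).
  by apply: open_nbhs_nbhs; split; [exact: oO|].
apply: (@filterS2 _ _ (nbhs_filter _) _ _ _ _ nU nf) => _ [y [cy Oy] <-].
by rewrite (chartK (atlasP M)) // => fy; exists y.
Qed.

Lemma mopen_bigI (I : eqType) (s : seq I) (O : I -> set M) :
  (forall i, i \in s -> mopen (O i)) -> mopen [set x | forall i, i \in s -> O i x].
Proof.
elim: s => [|i s IH] oO.
  rewrite (_ : [set x | _] = setT); first exact: mopenT.
  by apply/seteqP; split.
rewrite (_ : [set x | _] = O i `&` [set x | forall i, i \in s -> O i x]).
  apply: mopenI; first by apply: oO; rewrite mem_head.
  by apply: IH => j js; apply: oO; rewrite in_cons js orbT.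
apply/seteqP; split => [x Ox|x [Oi Os] j].
  by split=> [|j js]; apply: Ox; rewrite in_cons ?eqxx ?js ?orbT.
by rewrite in_cons => /predU1P[->|] //; exact: Os.
Qed.

(** Compact sets are closed by the Hausdorff property: [z] is separated from each point of the image
    of [K], finitely many of the neighbourhoods cover [K], and the opposite neighbourhoods of [z]
    are intersected. It is needed because a function extended by zero from a chart could otherwise
    fail to be smooth at the boundary of the chart domain. *)
Lemma mopen_setC_compact c (K : set 'rV[R]_m) : @atlas R m M c ->
  compact K -> K `<=` cfun c @` cdom c -> @mopen R m M (~` (cinv c @` K)).
Proof.
move=> Ac; rewrite compact_cover => cK Kc; apply: mopen_local => z zK.
have H (y : 'rV[R]_m) : exists OO : set M * set M, K y ->
    [/\ mopen OO.1, mopen OO.2, OO.1 z, OO.2 (cinv c y) & OO.1 `&` OO.2 = set0].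
  have [Ky|] := pselect (K y); last by exists (set0, set0).
  have [|O [O' ?]] := @hausdorffP R m M z (cinv c y).
    by move=> zy; apply: zK; exists y.
  by exists (O, O').
have [OO OOP] := choice H.
have [y Ky|y Ky|D DK KD] := cK _ K (fun y => cfun c @` (cdom c `&` (OO y).2)).
- by have [_ + _ _ _] := OOP y Ky; apply.
- exists y => //; have [x cx xy] := Kc y Ky; have [_ _ _ + _] := OOP y Ky.
  by rewrite -xy (chartK (atlasP M)) // => Ox; exists x.
exists [set x | forall y, y \in enum_fset D -> (OO y).1 x]; split.
- apply: mopen_bigI => y yD; have Ky : K y by apply/set_mem/DK.
  by have [] := OOP y Ky.
- by move=> y yD; have Ky : K y by [apply/set_mem/DK]; have [] := OOP y Ky.
- move=> x Ox [k Kk kx]; have [y /= yD [x' [cx' Ox'] x'k]] := KD k Kk.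
  have Ky : K y by apply/set_mem/DK.
  have [_ _ _ _ O0] := OOP y Ky; have : set0 x by rewrite -O0; split;
    [exact: Ox|rewrite -kx -x'k (chartK (atlasP M))].
  by [].
Qed.

Lemma smooth_on_flat k (O : set M) (f : M -> R) : mopen O -> smooth_on O f ->
  smooth_on O (fun x => flat k (f x)).
Proof. by move=> oO sf c Ac j; apply: Ck_flat; [exact: oO|exact: sf]. Qed.

Lemma smooth_on_prod (O : set M) (I : Type) (r : seq I) (h : I -> M -> R) : mopen O ->
  (forall i, smooth_on O (h i)) -> smooth_on O (fun x => \prod_(i <- r) h i x).
Proof.
move=> oO hs; elim: r => [|i r IH].
  rewrite (_ : (fun x => _) = fun=> 1); first exact: smooth_on_cst.
  by apply/funext => x; rewrite big_nil.
rewrite (_ : (fun x => _) = fun x => h i x * \prod_(j <- r) h j x).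
  exact: smooth_on_mul.
by apply/funext => x; rewrite big_cons.
Qed.

Lemma smooth_on_coord c i : @atlas R m M c -> smooth_on (cdom c) (fun x : M => cfun c x 0 i).
Proof. by move=> Ac c' Ac'; by have := chart_transition (atlasP M) i Ac' Ac; apply. Qed.

(** The open set [W] expresses that the support of [chi] lies in [O]: since [O] and [W] cover the
    manifold, [chi] times anything smooth on [O] extends smoothly by zero. *)
Lemma smooth_bump (O : set M) x : mopen O -> O x ->
  exists (chi : Cinf M) (V W : set M), [/\ mopen V /\ mopen W, V x /\ V `<=` O,
    forall y, V y -> chi y = 1, forall y, W y -> chi y = 0 & forall y, O y \/ W y].
Proof.
move=> oO Ox; have [c Ac cx] := chart_cover (atlasP M) x.
pose U := cdom c `&` O; have oU : mopen U by apply: mopenI => //; exact: mopen_dom.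
have /nbhs_ballP[r /= r0 rU] : nbhs (cfun c x) (cfun c @` U).
  by apply: open_nbhs_nbhs; split; [exact: oO|exists x].
(* Halving [r] keeps the closed cube [K] of half-side [d] inside the open ball of radius [r]. *)
pose d := r / 2; have d0 : 0 < d by rewrite divr_gt0.
(* Each factor is positive exactly when its coordinate is within [d] of that of [x], so [S] vanishes
   off the open cube. *)
pose S z : R := \prod_i flat 0 (d ^+ 2 - (cfun c z 0 i - cfun c x 0 i) ^+ 2).
have sS : smooth_on U S.
  apply: smooth_on_prod => // i; apply: smooth_on_flat => //.
  apply: smooth_on_add => //; first exact: smooth_on_cst.
  have sc : smooth_on U (fun z => cfun c z 0 i - cfun c x 0 i).
    apply: smooth_on_add => //; last exact: smooth_on_cst.
    by apply: smooth_on_sub (smooth_on_coord i Ac) => z [].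
  by apply: smooth_on_opp => //; exact: smooth_on_mul.
have flat0 (t : R) : 0 < t -> 0 < flat 0 t.
  by move=> t0; rewrite /flat t0 expr0 mul1r expR_gt0.
have flatN (t : R) : t <= 0 -> flat 0 t = 0 by rewrite /flat ltNge => ->.
have Sx : 0 < S x.
  by apply: prodr_gt0 => i _; apply: flat0; rewrite subrr expr0n subr0 exprn_gt0.
(* As [flat 0] vanishes on the negative reals, [h = 1] where [S] exceeds half
   its value at [x], and [h = 0] where [S = 0]. *)
pose h z := 1 - flat 0 (S x / 2 - S z) / flat 0 (S x / 2).
have S2 : 0 < S x / 2 by rewrite divr_gt0.
have sh : smooth_on U h.
  apply: smooth_on_add => //; first exact: smooth_on_cst.
  apply: smooth_on_opp => //; apply: smooth_on_mul => //; last exact: smooth_on_cst.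
  apply: smooth_on_flat => //; apply: smooth_on_add => //; first exact: smooth_on_cst.
  exact: smooth_on_opp.
pose K : set 'rV[R]_m := [set y | forall i, `[cfun c x 0 i - d, cfun c x 0 i + d]%classic (y 0 i)].
have cK : compact K by exact: (@rV_compact R m _ (fun i => @segment_compact _ _ _)).
have KU : K `<=` cfun c @` U.
  apply: subset_trans rU => y Ky; apply/ball_rVP; split => // i.
  have := Ky i; rewrite /= in_itv /= -ler_distlC distrC => /le_lt_trans; apply.
  by rewrite /d ltr_pdivrMr // mulr_natr mulr2n ltrDl.
pose W := ~` (cinv c @` K).
have oW : mopen W.
  by apply: mopen_setC_compact => // y /KU [z [cz _] <-]; exists z.
have WO y : O y \/ W y.
  have [[k /KU[z [cz Oz] <-] <-]|] := pselect ((cinv c @` K) y); last by right.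
  by left; rewrite (chartK (atlasP M)).
pose chi z := if `[< U z >] then h z else 0.
have chiW z : W z -> chi z = 0.
  move=> Wz; rewrite /chi; case: asboolP => // -[cz _].
  have [i nKi] : exists i, ~ `[cfun c x 0 i - d, cfun c x 0 i + d]%classic (cfun c z 0 i).
    by apply/existsNP => Kz; apply: Wz; exists (cfun c z); rewrite ?(chartK (atlasP M)).
  have Sz : S z = 0.
    rewrite /S (bigD1 i) //= flatN ?mul0r // subr_le0.
    rewrite -ler_sqrt ?exprn_even_ge0 // !sqrtr_sqr gtr0_norm //.
    by rewrite leNgt; apply/negP => lt; apply: nKi; rewrite /= in_itv /= -ler_distlC distrC ltW.
  by rewrite /h Sz subr0 divff ?subrr // gt_eqF // flat0.
have schi : smooth_on setT chi.
  apply: smooth_on_local => z _; have [Wz|nWz] := pselect (W z).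
    by exists W => //; apply: (smooth_on_congr oW (f := fun=> 0)) (smooth_on_cst _ _) => y /chiW.
  exists U; last by apply: (smooth_on_congr oU _ sh) => y Uy; rewrite /chi asboolT.
  have /contrapT[k /KU[y [cy Oy] <-] <-] := nWz.
  by rewrite (chartK (atlasP M)).
exists (MkCinf schi), (U `&` [set z | 0 < S z - S x / 2]), W; split => //.
- split=> //; apply: mopen_pos => //; apply: smooth_on_add => //; exact: smooth_on_cst.
- split; last by move=> z [[]].
  by split=> //=; rewrite subr_gt0 ltr_pdivrMr // mulr_natr mulr2n ltrDl.
- move=> z [Uz /= Sz]; rewrite /chi asboolT // /h [flat 0 (_ - S z)]flatN ?mul0r ?subr0 //.
  by rewrite -oppr_ge0 opprB ltW.
Qed.

End Bump.

(** * Tangent functionals *)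

(** By the chain rule the partial derivatives of the composite are sums of products of derivatives
    of [g] with partial derivatives of [F] composed with [g]; the induction on [k] therefore runs
    over all [F]. *)
Lemma Ck_comp (R : realType) k p n (U : set 'rV[R]_p) (U' : set 'rV[R]_n)
    (g : 'rV[R]_p -> 'rV[R]_n) F :
  open U -> open U' -> (forall z, U z -> U' (g z)) ->
  (forall i, Ck k U (fun z => g z 0 i)) -> Ck k U' F -> Ck k U (fun z => F (g z)).
Proof.
move=> oU oU' gU; elim: k F => [|k IH] F gk Fk.
  split=> // z Uz; apply: continuous_comp; last exact: Ck_cont Fk (gU _ Uz).
  apply/(@cvg_ballP _ _ _ _ (nbhs_filter z)) => e e0.
  have H : \forall y \near z, forall i, `|g z 0 i - g y 0 i| < e.
    apply: (@filter_forall _ _ _ (nbhs z) (nbhs_filter _)) => i.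
    by have /cvgrPdist_lt/(_ e e0) := Ck_cont (gk i) Uz.
  by apply: (@filterS _ _ (nbhs_filter z) _ _ _ H) => y gy; apply/ball_rVP.
have [gk' Fk'] := (fun i => Ck_pred (gk i), Ck_pred Fk).
split; first by move=> z; exact: (Ck_cont (IH F gk' Fk')).
move=> j; have F1 : Ck 1 U' F.
  by have [cF dF] := Fk; split=> // i; split; [exact: (dF i).1|split=> //;
    by move=> x; exact: (Ck_cont (dF i).2)].
have dg z : U z -> forall i, derivable (fun y => g y 0 i) z (delta_mx 0 j).
  by move=> Uz i; have [_ /(_ j)[+ _]] := gk i; apply.
have D z (Uz : U z) := derive_chain oU' F1 (gU _ Uz) (dg z Uz).
split; first by move=> z /D; move=> dz; exact: (@ex_derive _ _ _ _ _ _ _ dz).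
apply: (@Ck_congr _ _ _ _ (fun z => \sum_i 'D_(delta_mx 0 j) (fun y => g y 0 i) z *
   'D_(delta_mx 0 i) F (g z))) => //; first by move=> z /D [_ ->].
elim: (index_enum _) => [|i r IHr].
  rewrite (_ : (fun y => _) = fun=> 0); first exact: Ck_cst.
  by apply/funext => y; rewrite big_nil.
rewrite (_ : (fun z => _) = fun z => 'D_(delta_mx 0 j) (fun y => g y 0 i) z *
    'D_(delta_mx 0 i) F (g z) + \sum_(i <- r) 'D_(delta_mx 0 j) (fun y => g y 0 i) z *
    'D_(delta_mx 0 i) F (g z)); last by apply/funext => y; rewrite big_cons.
apply: Ck_add => //; apply: Ck_mul => //; first by have [_ /(_ j)[_]] := gk i.
by apply: (IH ('D_(delta_mx 0 i) F)) => //; have [_ /(_ i)[_]] := Fk.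
Qed.

Section ManifoldCalculus.
Variables (R : realType) (m : nat) (M : manifold R m).
Implicit Types (c : chart R M m) (V : set M) (f g : M -> R) (F G : Cinf M).

Definition eqnear (x : M) f g := exists2 V : set M, mopen V /\ V x & forall y, V y -> f y = g y.

(** Unlike [dpart] this accepts functions that are smooth only locally, such as the coefficients of
    a field or the coordinates of another chart. *)
Definition pd c i f (x : M) : R := 'D_(delta_mx 0 i) (fun y => f (cinv c y)) (cfun c x).

Lemma smooth_on_chart c V f : atlas c -> mopen V -> V `<=` cdom c ->
  smooth (cfun c @` V) (fun y => f (cinv c y)) -> smooth_on V f.
Proof.
move=> Ac oV Vc sf c' Ac' k.
have VE : cdom c `&` V = V by apply/seteqP; split=> [x []//|x Vx]; split=> //; exact: Vc.
apply: (@Ck_congr _ _ _ _ (fun y => f (cinv c (cfun c (cinv c' y))))); first exact: oV.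
  by move=> _ [x [cx Vx] <-]; rewrite (chartK (atlasP M) Ac') // (chartK (atlasP M) Ac) //; exact: Vc.
apply: (@Ck_comp R k m m _ (cfun c @` V) (fun y => cfun c (cinv c' y))
  (fun y => f (cinv c y))).
- exact: oV.
- by rewrite -VE; exact: oV.
- by move=> _ [x [cx Vx] <-]; rewrite (chartK (atlasP M) Ac') //; exists x.
- move=> i; have := chart_transition (atlasP M) i Ac' Ac k; apply: Ck_sub.
  by apply: image_subset => x [cx /Vc].
- exact: sf.
Qed.

Section AtPoint.
Variables (c : chart R M m) (x : M) (V : set M).
Hypotheses (Ac : atlas c) (cx : cdom c x) (oV : mopen V) (Vx : V x).

Let nV : nbhs (cfun c x) (cfun c @` (cdom c `&` V)).
Proof. by apply: open_nbhs_nbhs; split; [exact: oV|exists x]. Qed.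

Lemma pd_derivable i f : smooth_on V f ->
  derivable (fun y => f (cinv c y)) (cfun c x) (delta_mx 0 i).
Proof. by move=> /(_ c Ac 1) [_ /(_ i)[+ _]]; apply; exists x. Qed.

Lemma pd_congr i f g : (forall y, V y -> f y = g y) -> pd c i f x = pd c i g x.
Proof.
move=> fg; apply: near_eq_derive; apply: filterS nV => _ [y [cy Vy] <-].
by rewrite (chartK (atlasP M)) // fg.
Qed.

Lemma pdD i f g : smooth_on V f -> smooth_on V g ->
  pd c i (fun y => f y + g y) x = pd c i f x + pd c i g x.
Proof. by move=> sf sg; rewrite /pd deriveD //; exact: pd_derivable. Qed.

Lemma pdM i f g : smooth_on V f -> smooth_on V g ->
  pd c i (fun y => f y * g y) x = f x * pd c i g x + g x * pd c i f x.
Proof.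
move=> sf sg; rewrite /pd deriveM //; try exact: pd_derivable.
by rewrite (chartK (atlasP M)).
Qed.

Lemma pd_cst i (a : R) : pd c i (fun=> a) x = 0.
Proof. exact: derive_cst. Qed.

Lemma pd_sum i (I : Type) (r : seq I) (h : I -> M -> R) : (forall j, smooth_on V (h j)) ->
  pd c i (fun y => \sum_(j <- r) h j y) x = \sum_(j <- r) pd c i (h j) x.
Proof.
move=> sh; elim: r => [|j r IH].
  rewrite (_ : (fun y => _) = fun=> 0) ?pd_cst ?big_nil //.
  by apply/funext => y; rewrite big_nil.
rewrite big_cons -IH -pdD //; last exact: smooth_on_sum.
by congr (pd _ _ _ _); apply/funext => y; rewrite big_cons.
Qed.

Lemma dpart_chart_change c' F j : atlas c' -> cdom c' x ->
  dpart c' j F x = \sum_i pd c' j (fun y => cfun c y 0 i) x * dpart c i F x.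
Proof.
move=> Ac' c'x.
have oU : open (cfun c @` (cdom c `&` setT)) by exact: (@mopenT _ _ M _ Ac).
have F1 := cinfP F Ac 1.
have x'K : cinv c' (cfun c' x) = x by rewrite (chartK (atlasP M)).
have Ux : (cfun c @` (cdom c `&` setT)) (cfun c (cinv c' (cfun c' x))).
  by rewrite x'K; exists x.
have dg i : derivable (fun y => cfun c (cinv c' y) 0 i) (cfun c' x) (delta_mx 0 j).
  have [_ /(_ j)[+ _]] := chart_transition (atlasP M) i Ac' Ac 1; apply.
  by exists x.
have [_ E] := derive_chain (g := fun y => cfun c (cinv c' y)) oU F1 Ux dg.
rewrite x'K in E; rewrite /dpart -E; apply: near_eq_derive.
have nW : nbhs (cfun c' x) (cfun c' @` (cdom c' `&` cdom c)).
  by apply: open_nbhs_nbhs; split; [exact: (chart_overlap (atlasP M) Ac' Ac)|exists x].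
apply: filterS nW => _ [y [c'y cy] <-].
by rewrite (chartK (atlasP M) Ac') // (chartK (atlasP M) Ac).
Qed.

Lemma pd_dpartC i j F : pd c i (dpart c j F) x = pd c j (dpart c i F) x.
Proof.
have oU : open (cfun c @` (cdom c `&` setT)) by exact: (@mopenT _ _ M _ Ac).
have E k l : pd c k (dpart c l F) x =
    'D_(delta_mx 0 k) ('D_(delta_mx 0 l) (fun y => F (cinv c y))) (cfun c x).
  apply: near_eq_derive.
  apply: filterS (open_nbhs_nbhs (conj oU (ex_intro2 _ _ x (conj cx I) erefl))).
  by move=> _ [y [cy _] <-]; rewrite /dpart (chartK (atlasP M)).
rewrite !E; apply: (schwarz i j oU (cinfP F Ac 2)).
by exists x.
Qed.

End AtPoint.

Lemma smooth_on_dpart c i F : atlas c -> smooth_on (cdom c) (dpart c i F).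
Proof.
move=> Ac; apply: (smooth_on_chart Ac) => // [|k]; first exact: mopen_dom.
by have := @Ck_dpart R m M k c i F Ac; rewrite setIT.
Qed.

Lemma dpart_coord c i j F x : atlas c -> cdom c x ->
  eqnear x F (fun y => cfun c y 0 i) -> dpart c j F x = (i == j)%:R.
Proof.
move=> Ac cx [V [oV Vx] FE].
have nV : nbhs (cfun c x) (cfun c @` (cdom c `&` V)).
  by apply: open_nbhs_nbhs; split; [exact: oV|exists x].
rewrite /dpart (@near_eq_derive _ _ _ _ (fun v : 'rV[R]_m => v 0 i)).
  rewrite (@derive_lin _ _ R id (fun v : 'rV[R]_m => v 0 i)); last first.
    by move=> h y; rewrite !mxE.
  by rewrite derive_id mxE eqxx.
apply: filterS nV => _ [y [cy Vy] <-].
by rewrite (chartK (atlasP M)) // FE.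
Qed.

(** Being a tangent vector is made a predicate on functionals, so that it applies to any expression
    in [F], for instance to one slot of a bivector or of a Schouten bracket. *)
Record tangential (x : M) (D : Cinf M -> R) : Prop := Tangential {
  tangential_coef : forall c, atlas c -> cdom c x ->
    exists a : 'I_m -> R, forall F, D F = \sum_i a i * dpart c i F x }.

(** The Jacobian matrix of the coordinate change transforms the coefficients, so a single chart
    suffices. *)
Lemma tangential_chart c x (D : Cinf M -> R) (a : 'I_m -> R) : atlas c -> cdom c x ->
  (forall F, D F = \sum_i a i * dpart c i F x) -> tangential x D.
Proof.
move=> Ac cx DE; split=> c' Ac' c'x.
exists (fun j => \sum_i a i * pd c i (fun y => cfun c' y 0 j) x) => F; rewrite DE.
under eq_bigr do rewrite (dpart_chart_change Ac' c'x F _ Ac cx) big_distrr /=.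
rewrite exchange_big /=; apply: eq_bigr => j _; rewrite big_distrl /=.
by apply: eq_bigr => i _; rewrite mulrA.
Qed.

Lemma tangential_dpart c x i : atlas c -> cdom c x -> tangential x (fun F => dpart c i F x).
Proof.
move=> Ac cx; apply: (tangential_chart (a := fun j => (j == i)%:R) Ac cx) => F.
rewrite (bigD1 i) //= eqxx mul1r big1 ?addr0 // => j /negbTE->.
by rewrite mul0r.
Qed.

Lemma tangential_ext x D D' : tangential x D -> (forall F, D F = D' F) -> tangential x D'.
Proof. by move=> tD DD'; split=> c Ac cx; have [a aE] := tangential_coef tD Ac cx; exists a => F; rewrite -DD'. Qed.

Lemma tangential0 x : tangential x (fun=> 0).
Proof. by split=> c _ _; exists (fun=> 0) => F; rewrite big1 // => i _; rewrite mul0r. Qed.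

Lemma tangentialD x D D' : tangential x D -> tangential x D' ->
  tangential x (fun F => D F + D' F).
Proof.
move=> tD tD'; split=> c Ac cx.
have [a aE] := tangential_coef tD Ac cx; have [b bE] := tangential_coef tD' Ac cx.
exists (fun i => a i + b i) => F; rewrite aE bE -big_split /=.
by apply: eq_bigr => i _; rewrite mulrDl.
Qed.

Lemma tangentialZ x (k : R) D : tangential x D -> tangential x (fun F => k * D F).
Proof.
move=> tD; split=> c Ac cx; have [a aE] := tangential_coef tD Ac cx.
by exists (fun i => k * a i) => F; rewrite aE big_distrr; apply: eq_bigr => i _; rewrite /= mulrA.
Qed.

Lemma tangentialN x D : tangential x D -> tangential x (fun F => - D F).
Proof. by move=> tD; apply: tangential_ext (tangentialZ (-1) tD) _ => F; rewrite mulN1r. Qed.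

Lemma tangential_sum x (I : Type) (r : seq I) (P : pred I) (D : I -> Cinf M -> R) :
  (forall i, tangential x (D i)) -> tangential x (fun F => \sum_(i <- r | P i) D i F).
Proof.
move=> tD; elim: r => [|i r IH].
  by apply: tangential_ext (tangential0 x) _ => F; rewrite big_nil.
have [Pi|nPi] := boolP (P i).
  by apply: tangential_ext (tangentialD (tD i) IH) _ => F; rewrite big_cons Pi.
by apply: tangential_ext IH _ => F; rewrite big_cons (negbTE nPi).
Qed.

Section TangentialRules.
Variables (x : M) (D : Cinf M -> R).
Hypothesis tD : tangential x D.

Lemma tanD F G : D (F + G) = D F + D G.
Proof.
have [c Ac cx] := chart_cover (atlasP M) x; have [a aE] := tangential_coef tD Ac cx.
rewrite !aE -big_split /=; apply: eq_bigr => i _; rewrite -mulrDr.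
by congr (_ * _); apply: (pdD (V := setT)) => //; [exact: cinfP|exact: cinfP].
Qed.

Lemma tanM F G : D (F * G) = F x * D G + G x * D F.
Proof.
have [c Ac cx] := chart_cover (atlasP M) x; have [a aE] := tangential_coef tD Ac cx.
rewrite !aE !big_distrr -big_split /=; apply: eq_bigr => i _.
rewrite mulrCA [G x * _]mulrCA -mulrDr.
by congr (_ * _); apply: (pdM (V := setT)) => //; [exact: cinfP|exact: cinfP].
Qed.

Lemma tan_near F G : eqnear x F G -> D F = D G.
Proof.
move=> [V [oV Vx] FG].
have [c Ac cx] := chart_cover (atlasP M) x; have [a aE] := tangential_coef tD Ac cx.
rewrite !aE; apply: eq_bigr => i _; congr (_ * _); exact: (pd_congr Ac cx oV Vx).
Qed.

Lemma tan_cst (k : R) : D (cinf_cst M k) = 0.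
Proof.
have [c Ac cx] := chart_cover (atlasP M) x; have [a aE] := tangential_coef tD Ac cx.
by rewrite aE big1 // => i _; rewrite [dpart _ _ _ _]pd_cst mulr0.
Qed.

Lemma tan_sum (I : Type) (r : seq I) (F : I -> Cinf M) :
  D (\sum_(i <- r) F i) = \sum_(i <- r) D (F i).
Proof. by elim/big_rec2: _ => [|i a F' _ <-]; [exact: tan_cst|exact: tanD]. Qed.

Lemma tanN F : D (- F) = - D F.
Proof.
by apply/eqP; rewrite -subr_eq0 opprK -tanD addNr; apply/eqP; exact: tan_cst.
Qed.

End TangentialRules.

Lemma tangential_vf (X : vfield M) x : tangential x (fun F => X F x).
Proof.
have [c Ac cx] := chart_cover (atlasP M) x.
have [V [a [_ [Vx _] _ XE]]] := vf_loc X Ac cx.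
by apply: (tangential_chart (a := fun i => a i x) Ac cx) => F; exact: XE.
Qed.

Lemma tangential_bvr (P : bivector M) F x : tangential x (fun G => P F G x).
Proof.
have [c Ac cx] := chart_cover (atlasP M) x.
have [V [b [_ [Vx _] _ PE]]] := bv_loc P Ac cx.
apply: (tangential_chart (a := fun j => \sum_i b i j x * dpart c i F x) Ac cx) => G.
rewrite PE // exchange_big /=; apply: eq_bigr => j _; rewrite big_distrl /=.
by apply: eq_bigr => i _; rewrite mulrA.
Qed.

Lemma bvC (P : bivector M) F G : P F G = - P G F.
Proof.
apply: cinf_eq => x; have [c Ac cx] := chart_cover (atlasP M) x.
have [V [b [_ [Vx _] sb PE]]] := bv_loc P Ac cx.
rewrite [RHS]/= !PE // exchange_big /= -sumrN; apply: eq_bigr => i _.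
rewrite -sumrN; apply: eq_bigr => j _.
by rewrite (sb j i).2 // mulNr; congr (- (_ * _)); exact: mulrC.
Qed.

Lemma tangential_bvl (P : bivector M) G x : tangential x (fun F => P F G x).
Proof.
apply: tangential_ext (tangentialN (tangential_bvr P G x)) _ => F.
by rewrite (bvC P F G).
Qed.

Program Definition hamiltonian (P : bivector M) F : vfield M := @MkVfield R m M (P F) _.
Next Obligation.
move=> P F c x Ac cx; have [V [b [oV [Vx Vc] sb PE]]] := bv_loc P Ac cx.
exists V, (fun j y => \sum_i b i j y * dpart c i F y); split=> //.
  move=> j; apply: smooth_on_sum => // i; apply: smooth_on_mul => //; first exact: (sb i j).1.
  exact: smooth_on_sub Vc (smooth_on_dpart i F Ac).
move=> y G Vy; rewrite PE // exchange_big /=; apply: eq_bigr => j _; rewrite big_distrl /=.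
by apply: eq_bigr => i _; rewrite mulrA.
Qed.

Lemma tangential_commutator (X Y : vfield M) x :
  tangential x (fun F => X (Y F) x - Y (X F) x).
Proof.
have [c Ac cx] := chart_cover (atlasP M) x.
have [V [a [oV [Vx Vc] sa XE]]] := vf_loc X Ac cx.
have [W [b [oW [Wx Wc] sb YE]]] := vf_loc Y Ac cx.
have H (Y' : vfield M) (W' : set M) (b' : 'I_m -> M -> R) : mopen W' -> W' x -> W' `<=` cdom c ->
   (forall i, smooth_on W' (b' i)) ->
   (forall y F, W' y -> Y' F y = \sum_i b' i y * dpart c i F y) ->
   forall i F, dpart c i (Y' F) x =
     \sum_j (b' j x * pd c i (dpart c j F) x + dpart c j F x * pd c i (b' j) x).
  move=> oW' W'x W'c sb' Y'E i F; rewrite /dpart -/(pd c i (Y' F) x).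
  rewrite (pd_congr Ac cx oW' W'x i (fun y => Y'E y F)) (pd_sum Ac cx oW' W'x).
    apply: eq_bigr => j _; apply: (pdM Ac cx W'x) => //.
    exact: smooth_on_sub W'c (smooth_on_dpart j F Ac).
  move=> j; apply: smooth_on_mul => //.
  exact: smooth_on_sub W'c (smooth_on_dpart j F Ac).
apply: (tangential_chart (a := fun j => \sum_i (a i x * pd c i (b j) x - b i x * pd c i (a j) x)) Ac cx) => F.
rewrite XE // YE //.
under eq_bigr do rewrite (H Y W b) // big_split /= mulrDr !big_distrr /=.
under [X in _ - X]eq_bigr do rewrite (H X V a) // big_split /= mulrDr !big_distrr /=.
(* The summand isolated here collects the second derivatives of [F]; it is zero by their symmetry.
   What remains is the usual coefficient formula for the commutator. *)
rewrite !big_split /= opprD addrACA [X in X + _](_ : _ = 0) ?add0r.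
  rewrite exchange_big [X in _ - X]exchange_big /= -sumrB; apply: eq_bigr => j _.
  rewrite -sumrB big_distrl /=; apply: eq_bigr => i _; ring.
apply/eqP; rewrite subr_eq0 exchange_big; apply/eqP; apply: eq_bigr => i _.
apply: eq_bigr => j _; rewrite (pd_dpartC Ac cx); ring.
Qed.

End ManifoldCalculus.

(** * Linear and basic functions on the dual bundle *)

Section Extension.
Variables (R : realType) (m : nat) (M : manifold R m) (n : nat) (E : vbundle M n).

Lemma extend_by_zero (O W : set M) (chi f : M -> R) : mopen O -> mopen W ->
  smooth_on setT chi -> (forall y, W y -> chi y = 0) -> (forall y, O y \/ W y) ->
  smooth_on O f -> smooth_on setT (fun y => if `[< O y >] then chi y * f y else 0).
Proof.
move=> oO oW schi chiW OW sf; apply: smooth_on_local => y _.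
have [Oy|Wy] := OW y; last first.
  exists W => //; apply: (smooth_on_congr oW (f := fun=> 0)) (smooth_on_cst _ _) => z Wz.
  by case: asboolP => // _; rewrite chiW // mul0r.
exists O => //; apply: (smooth_on_congr oO (f := fun y => chi y * f y)).
  by move=> z Oz; rewrite asboolT.
by apply: smooth_on_mul => //; apply: smooth_on_sub schi.
Qed.

(** [V] is chosen before [f]: all functions on [O] have extensions that are valid on one common
    neighbourhood. *)
Lemma function_ext (O : set M) x : mopen O -> O x ->
  exists V : set M, [/\ mopen V, V x, V `<=` O & forall f, smooth_on O f ->
    exists F : Cinf M, forall y, V y -> F y = f y].
Proof.
move=> oO Ox; have [chi [V [W [[oV oW] [Vx VO] chiV chiW OW]]]] := smooth_bump oO Ox.
exists V; split=> // f sf.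
exists (MkCinf (extend_by_zero oO oW (cinfP chi) chiW OW sf)) => y Vy /=.
by rewrite asboolT ?chiV ?mul1r //; exact: VO.
Qed.

Lemma section_ext (e : frame n E) x : frames e -> fdom e x ->
  exists (V : set M) (s : 'I_n -> section E), [/\ mopen V, V x, V `<=` fdom e &
    forall i y, V y -> s i y = tnth (fsec e y) i].
Proof.
move=> fe ex; have oO := frame_open fe.
have [chi [V [W [[oV oW] [Vx VO] chiV chiW OW]]]] := smooth_bump oO ex.
pose s i y : E y := if `[< fdom e y >] then chi y *: tnth (fsec e y) i else 0.
have ss i : smooth_section (s i).
  move=> e' j fe'; have oO' := frame_open fe'; apply: smooth_on_local => y e'y.
  have [ey|Wy] := OW y; last first.
    exists (fdom e' `&` W); first by split.
    apply: (smooth_on_congr (mopenI oO' oW) (f := fun=> 0)) (smooth_on_cst _ _) => z [_ Wz].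
    by rewrite /s; case: asboolP => _; rewrite ?chiW // ?scale0r linear0.
  exists (fdom e' `&` fdom e); first by split.
  apply: (smooth_on_congr (mopenI oO' oO)
    (f := fun y => chi y * coord (fsec e' y) j (tnth (fsec e y) i))).
    by move=> z [_ ez]; rewrite /s asboolT // linearZ.
  apply: smooth_on_mul; first exact: mopenI.
    exact: smooth_on_sub (cinfP chi).
  exact: frame_transition.
exists V, (fun i => MkSection (ss i)); split=> // i y Vy.
by rewrite /= /s asboolT ?chiV ?scale1r //; exact: VO.
Qed.

Lemma sec_sumE (I : Type) (r : seq I) (s : I -> section E) x :
  (\sum_(i <- r) s i) x = \sum_(i <- r) s i x.
Proof. by elim/big_rec2: _ => [|i a t _ <-]. Qed.

(** Any expression that is local and function-linear in a section can thereby be tested on the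
    finitely many sections [s], which are fixed independently of [mu]. *)
Lemma frame_ext (e : frame n E) x : frames e -> fdom e x ->
  exists (V : set M) (s : 'I_n -> section E), [/\ mopen V, V x, V `<=` fdom e,
    forall i y, V y -> s i y = tnth (fsec e y) i &
    forall mu : section E, exists f : 'I_n -> Cinf M,
      (forall i, f i x = coord (fsec e x) i (mu x)) /\
      forall y, V y -> mu y = (\sum_i f i *: s i) y].
Proof.
move=> fe ex; have oO := frame_open fe.
have [V [s [oV Vx VO sE]]] := section_ext fe ex.
have [W [oW Wx WO FE]] := function_ext oO ex.
exists (V `&` W), s; split=> //; first exact: mopenI.
- by move=> y [/VO].
- by move=> i y [Vy _]; exact: sE.
move=> mu; have [f fE] := choice (fun i => FE _ (secP mu i fe)).
exists f; split=> [i|y [Vy Wy]]; first exact: fE.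
rewrite sec_sumE [LHS](frame_coord _ fe (VO _ Vy)); apply: eq_bigr => i _.
by rewrite /= sE // fE.
Qed.

End Extension.

Section TotalSpace.
Variables (R : realType) (m : nat) (M : manifold R m) (n : nat) (A : vbundle M n).
Local Notation N := (total_space (dual_bundle A)).
Local Notation pull := (pullback (dual_bundle A)).
Implicit Types (c : chart R M m) (e : frame n A) (a : N) (mu eta : section A) (f g : Cinf M).

Lemma tildeD mu eta : tilde (mu + eta) = tilde mu + tilde eta.
Proof. by apply: cinf_eq => a; rewrite /= linearD. Qed.

Lemma tildeN mu : tilde (- mu) = - tilde mu.
Proof. by apply: cinf_eq => a; rewrite /= linearN. Qed.

Lemma tildeZ f mu : tilde (f *: mu) = pull f * tilde mu.
Proof. by apply: cinf_eq => a; rewrite /= linearZ. Qed.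

Lemma pullD f g : pull (f + g) = pull f + pull g.
Proof. exact: cinf_eq. Qed.

Lemma pullM f g : pull (f * g) = pull f * pull g.
Proof. exact: cinf_eq. Qed.

Lemma pullN f : pull (- f) = - pull f.
Proof. exact: cinf_eq. Qed.

Lemma tilde_near a mu eta : germ_eq (projT1 a) mu eta -> eqnear a (tilde mu) (tilde eta).
Proof.
move=> [V [oV Vx] me]; exists [set b : N | V (projT1 b)].
  by split=> //; exact: (@total_open_pull R m M n (dual_bundle A)).
by move=> b /= Vb; rewrite me.
Qed.

Lemma atlas_dual_chart c e : atlas c -> frames e -> @atlas _ _ N (dual_chart c e).
Proof. by move=> Ac fe; exists c, (dual_frame e); split=> //; exists e. Qed.

Lemma dual_chart_cover a : exists c e,
  [/\ atlas c, frames e & cdom (dual_chart c e) a].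
Proof.
have [c Ac cx] := chart_cover (atlasP M) (projT1 a).
by have [e fe ex] := frame_cover A (projT1 a); exists c, e.
Qed.

Lemma tilde_coord c e mu i a : frames e -> cdom (dual_chart c e) a ->
  germ_eq (projT1 a) mu (fun y => tnth (fsec e y) i) ->
  eqnear a (tilde mu) (fun b => cfun (dual_chart c e) b 0 (rshift m i)).
Proof.
move=> fe [_ ea] [V [oV Vx] me]; exists [set b : N | (V `&` fdom e) (projT1 b)].
  split=> //; apply: (@total_open_pull R m M n (dual_bundle A)).
  by apply: mopenI => //; exact: frame_open.
by move=> b /= [Vb eb]; rewrite me // row_mxEr mxE coord_dual.
Qed.

Lemma pull_coord c e f l a :
  eqnear (projT1 a) f (fun y => cfun c y 0 l) ->
  eqnear a (pull f) (fun b => cfun (dual_chart c e) b 0 (lshift n l)).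
Proof.
move=> [V [oV Vx] fE]; exists [set b : N | V (projT1 b)].
  by split=> //; exact: (@total_open_pull R m M n (dual_bundle A)).
by move=> b /= Vb; rewrite fE // row_mxEl.
Qed.

(** Each coordinate of a dual chart agrees near [a] with a globally defined generator, and the value
    of [D] on a coordinate is the corresponding coefficient. *)
Lemma tangential_span a (D : Cinf N -> R) : tangential a D ->
  (forall mu, D (tilde mu) = 0) -> (forall f, D (pull f) = 0) -> forall F, D F = 0.
Proof.
move=> tD Dt Dp F; have [c [e [Ac fe ca]]] := dual_chart_cover a.
have AC := atlas_dual_chart Ac fe.
have [al alE] := tangential_coef tD AC ca.
have Dcoord i (G : Cinf N) : eqnear a G (fun b => cfun (dual_chart c e) b 0 i) -> D G = al i.
  move=> Gi; rewrite alE (bigD1 i) //= big1 => [|j ji].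
    by rewrite (dpart_coord _ AC ca Gi) eqxx mulr1 addr0.
  by rewrite (dpart_coord _ AC ca Gi) eq_sym (negbTE ji) mulr0.
rewrite alE big1 // => j _; suff -> : al j = 0 by rewrite mul0r.
have [l jl|i ji] := fintype.splitP j.
  have -> : j = lshift n l by apply: val_inj.
  have [V [oV Vx VO VE]] := function_ext (mopen_dom Ac) ca.1.
  have [f fE] := VE _ (smooth_on_coord l Ac).
  by rewrite -(Dp f); apply/esym/Dcoord/pull_coord; exists V.
have -> : j = rshift m i by apply: val_inj.
have [V [s [oV Vx VO sE]]] := section_ext fe ca.2.
by rewrite -(Dt (s i)); apply/esym/Dcoord/tilde_coord => //; exists V => // y; exact: sE.
Qed.

Lemma tangential_eq a (D D' : Cinf N -> R) : tangential a D -> tangential a D' ->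
  (forall mu, D (tilde mu) = D' (tilde mu)) -> (forall f, D (pull f) = D' (pull f)) ->
  forall F, D F = D' F.
Proof.
move=> tD tD' Dt Dp F; apply/eqP; rewrite -subr_eq0; apply/eqP.
apply: (tangential_span (tangentialD tD (tangentialN tD'))) => [mu|f].
  by rewrite Dt subrr.
by rewrite Dp subrr.
Qed.

Section DualChart.
Variables (c : chart R M m) (e : frame n A) (a : N).
Hypotheses (Ac : atlas c) (fe : frames e) (ca : cdom (dual_chart c e) a).

Lemma dpart_pull j f : dpart (dual_chart c e) j (pull f) a =
  match fintype.split j with inl l => dpart c l f (projT1 a) | inr _ => 0 end.
Proof.
rewrite /dpart /=.
have := @derive_lin R _ _ (fun y => f (cinv c y)) (@lsubmx R 1 m n)
  (row_mx (cfun c (projT1 a)) (\row_i coord (fsec (dual_frame e) (projT1 a)) i (projT2 a)))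
  (delta_mx 0 j) (fun h y => linearP _ h _ y).
rewrite row_mxKl lsubmx_delta => ->.
by case: fintype.split => // _; rewrite derive0.
Qed.

Lemma dpart_pull_base l f :
  dpart (dual_chart c e) (lshift n l) (pull f) a = dpart c l f (projT1 a).
Proof. by rewrite dpart_pull (unsplitK (inl l)). Qed.

Lemma dpart_pull_fibre i f : dpart (dual_chart c e) (rshift m i) (pull f) a = 0.
Proof. by rewrite dpart_pull (unsplitK (inr i)). Qed.

Lemma dpart_tilde_frame mu i j : germ_eq (projT1 a) mu (fun y => tnth (fsec e y) i) ->
  dpart (dual_chart c e) j (tilde mu) a = (rshift m i == j)%:R.
Proof.
move=> mi; apply: dpart_coord => //; first exact: atlas_dual_chart.
exact: tilde_coord.
Qed.

(** Near the base point [mu] is a combination of extended frame sections. Its coefficients, pulled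
    back, are constant along the fibres, and the linear functions of the frame sections are the
    fibre coordinates. *)
Lemma dpart_tilde_fibre mu i :
  dpart (dual_chart c e) (rshift m i) (tilde mu) a = coord (fsec e (projT1 a)) i (mu (projT1 a)).
Proof.
have AC := atlas_dual_chart Ac fe; have tD := tangential_dpart (rshift m i) AC ca.
have [V [s [oV Vx VO sE fE]]] := frame_ext fe ca.2.
have [f [fx muE]] := fE mu.
rewrite (tan_near tD (G := tilde (\sum_j f j *: s j))); last by apply: tilde_near; exists V.
have -> : tilde (\sum_j f j *: s j) = \sum_j pull (f j) * tilde (s j).
  elim/big_rec2: _ => [|j F mu' _ <-]; last by rewrite tildeD tildeZ.
  by apply: cinf_eq => b; rewrite /= linear0.
have ds k : dpart (dual_chart c e) (rshift m i) (tilde (s k)) a = (k == i)%:R.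
  rewrite (dpart_tilde_frame (i := k)); last by exists V => // y; exact: sE.
  by rewrite (inj_eq (@rshift_inj _ _)).
rewrite (tan_sum tD) (bigD1 i) //= big1 ?addr0 => [|j /negbTE ji].
  by rewrite (tanM tD) dpart_pull_fibre mulr0 addr0 ds eqxx mulr1 -fx.
by rewrite (tanM tD) dpart_pull_fibre mulr0 addr0 ds ji mulr0.
Qed.

End DualChart.
End TotalSpace.

(** * Lie algebroid brackets in local frames *)

Section Bracket.
Variables (R : realType) (m : nat) (M : manifold R m) (n : nat) (A : vbundle M n).
Variable L : lie_algebroid A.
Implicit Types (c : chart R M m) (e : frame n A) (mu nu eta : section A) (f g : Cinf M).
Local Notation br := (lbr L).
Local Notation rho := (anchor_vf (anchor L)).

Lemma lbrDl mu nu eta : br (mu + nu) eta = br mu eta + br nu eta.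
Proof. by have := lbr_linear L 1 mu nu eta; rewrite !scale1r. Qed.

Lemma lbrDr mu nu eta : br mu (nu + eta) = br mu nu + br mu eta.
Proof. by rewrite lbr_anti lbrDl opprD -!lbr_anti. Qed.

Lemma lbr0r mu : br mu 0 = 0.
Proof. by apply: (addIr (br mu 0)); rewrite -lbrDr !add0r. Qed.

Lemma lbrNr mu nu : br mu (- nu) = - br mu nu.
Proof. by apply/eqP; rewrite -subr_eq0 opprK -lbrDr addNr lbr0r. Qed.

Lemma lbrZl f mu eta : br (f *: mu) eta = f *: br mu eta - rho eta f *: mu.
Proof. by rewrite lbr_anti lbr_leibniz opprD -scalerN -lbr_anti. Qed.

(** Take [chi] equal to 1 near [x] and zero off [V]. Then [chi *: eta] is zero everywhere, and the
    Leibniz rule for its bracket with [mu], read at [x], leaves only the bracket of [mu] and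
    [eta]. *)
Lemma lbr_eq0_near x mu eta : germ_eq x eta (fun=> 0) -> br mu eta x = 0.
Proof.
move=> [V [oV Vx] eta0].
have [chi [V' [W [_ [V'x _] chiV' chiW VW]]]] := smooth_bump oV Vx.
have z : chi *: eta = 0.
  apply: sec_eq => y /=; have [/eta0->|/chiW->] := VW y; first by rewrite scaler0.
  by rewrite scale0r.
have := congr1 (fun s : section A => s x) (lbr_leibniz L mu eta chi).
by rewrite z lbr0r /= chiV' // scale1r eta0 // scaler0 addr0.
Qed.

Lemma lbr_near x mu mu' eta eta' : germ_eq x mu mu' -> germ_eq x eta eta' ->
  br mu eta x = br mu' eta' x.
Proof.
have H mu1 nu nu' : germ_eq x nu nu' -> br mu1 nu x = br mu1 nu' x.
  move=> [V oV nn]; apply/eqP; rewrite -subr_eq0; apply/eqP.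
  have : br mu1 (nu - nu') x = 0.
    by apply: lbr_eq0_near; exists V => // y Vy /=; rewrite nn // subrr.
  by rewrite lbrDr lbrNr.
move=> mm ee; rewrite (H _ _ _ ee) (lbr_anti L mu) (lbr_anti L mu') /=.
by rewrite (H _ _ _ mm).
Qed.

(** The global extension of the frame used at [x] depends on [x]. Locality of the bracket replaces
    it, on a neighbourhood, by one fixed extension, whence smoothness. Defining the coefficients
    through actual brackets makes the antisymmetry hold at all points, even outside the frame
    domain. *)
Lemma structure_functions_exist c e : atlas c -> frames e -> exists cs rs,
  [/\ structure_functions L c e cs rs,
      forall i j k, smooth_on (cdom c `&` fdom e) (cs i j k),
      forall i l, smooth_on (cdom c `&` fdom e) (rs i l) &
      forall i j k x, cs i j k x = - cs j i k x].
Proof.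
move=> Ac fe; have [r [sr rE]] := anc_smooth (anchor L) Ac fe.
have H x : exists s : 'I_n -> section A, fdom e x ->
    forall i, germ_eq x (s i) (fun y => tnth (fsec e y) i).
  have [ex|] := pselect (fdom e x); last by exists (fun=> 0).
  have [V [s [oV Vx VO sE]]] := section_ext fe ex.
  by exists s => _ i; exists V => // y; exact: sE.
have [s sE] := choice H.
pose cs i j k x := coord (fsec e x) k (br (s x i) (s x j) x).
exists cs, r; split=> // [x cx ex|i j k|i j k x].
- split=> [i j|i F]; last exact: rE.
  exists (s x i), (s x j); split; [exact: sE|exact: sE|].
  by rewrite [RHS](frame_coord _ fe ex).
- apply: smooth_on_local => x [cx ex].
  have [V [s' [oV Vx VO s'E]]] := section_ext fe ex.
  exists V => //.
  apply: (smooth_on_congr oV (f := fun y => coord (fsec e y) k (br (s' i) (s' j) y))).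
    move=> y Vy; congr (coord _ _ _).
    have g h : germ_eq y (s' h) (s y h).
      have [W [oW Wy] WE] := sE y (VO _ Vy) h.
      exists (V `&` W); first by split=> //; exact: mopenI.
      by move=> z [Vz Wz]; rewrite s'E // WE.
    exact: lbr_near.
  exact: smooth_on_sub VO (secP _ k fe).
- by rewrite /cs lbr_anti /= linearN.
Qed.

End Bracket.

(** * Fields obtained from local expressions *)

Section LocalConstruction.
Variables (R : realType) (p : nat) (N : manifold R p).

Lemma vfield_of_local (op : Cinf N -> N -> R) :
  (forall c x, atlas c -> cdom c x -> exists (V : set N) (a : 'I_p -> N -> R),
    [/\ mopen V, V x /\ V `<=` cdom c, forall i, smooth_on V (a i) &
        forall y F, V y -> op F y = \sum_i a i y * dpart c i F y]) ->
  exists X : vfield N, forall F x, X F x = op F x.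
Proof.
move=> H; have s F : smooth_on setT (op F).
  apply: smooth_on_local => x _; have [c Ac cx] := chart_cover (atlasP N) x.
  have [V [a [oV [Vx Vc] sa E]]] := H c x Ac cx.
  exists V => //; apply: (smooth_on_congr oV) (fun y Vy => esym (E y F Vy)) _.
  apply: smooth_on_sum => // i; apply: smooth_on_mul => //.
  exact: smooth_on_sub Vc (smooth_on_dpart i F Ac).
have lX c x : atlas c -> cdom c x -> exists (V : set N) (a : 'I_p -> N -> R),
    [/\ mopen V, V x /\ V `<=` cdom c, forall i, smooth_on V (a i) &
        forall y F, V y -> MkCinf (s F) y = \sum_i a i y * dpart c i F y] := @H c x.
by exists (MkVfield lX).
Qed.

Lemma bivector_of_local (op : Cinf N -> Cinf N -> N -> R) :
  (forall c x, atlas c -> cdom c x -> exists (V : set N) (b : 'I_p -> 'I_p -> N -> R),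
    [/\ mopen V, V x /\ V `<=` cdom c,
        forall i j, smooth_on V (b i j) /\ forall y, V y -> b i j y = - b j i y &
        forall y F G, V y ->
          op F G y = \sum_i \sum_j b i j y * (dpart c i F y * dpart c j G y)]) ->
  exists P : bivector N, forall F G x, P F G x = op F G x.
Proof.
move=> H; have s F G : smooth_on setT (op F G).
  apply: smooth_on_local => x _; have [c Ac cx] := chart_cover (atlasP N) x.
  have [V [b [oV [Vx Vc] sb E]]] := H c x Ac cx.
  exists V => //; apply: (smooth_on_congr oV) (fun y Vy => esym (E y F G Vy)) _.
  apply: smooth_on_sum => // i; apply: smooth_on_sum => // j.
  apply: smooth_on_mul => //; first exact: (sb i j).1.
  by apply: smooth_on_mul => //; exact: smooth_on_sub Vc (smooth_on_dpart _ _ Ac).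
have lP c x : atlas c -> cdom c x -> exists (V : set N) (b : 'I_p -> 'I_p -> N -> R),
    [/\ mopen V, V x /\ V `<=` cdom c,
        forall i j, smooth_on V (b i j) /\ forall y, V y -> b i j y = - b j i y &
        forall y F G, V y -> MkCinf (s F G) y =
          \sum_i \sum_j b i j y * (dpart c i F y * dpart c j G y)] := @H c x.
by exists (MkBivector lP).
Qed.

End LocalConstruction.

(** * Vertical vector fields on the dual bundle *)

Section VerticalFields.
Variables (R : realType) (m : nat) (M : manifold R m) (n : nat) (A : vbundle M n).
Local Notation N := (total_space (dual_bundle A)).
Local Notation pull := (pullback (dual_bundle A)).
Implicit Types (c : chart R M m) (e : frame n A) (a : N).

Lemma mopen_dual_dom c e : atlas c -> frames e -> @mopen _ _ N (cdom (dual_chart c e)).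
Proof. by move=> Ac fe; apply: mopen_dom; exact: atlas_dual_chart. Qed.

Lemma smooth_on_pull (O : set M) (f : M -> R) : smooth_on O f ->
  @smooth_on _ _ N [set a : N | O (projT1 a)] (fun a => f (projT1 a)).
Proof.
move=> sf _ [c [e [Ac fe ->]]] k.
apply: (Ck_sub (U := [set v | (cfun c @` (cdom c `&` O)) (lsubmx v)])).
  by move=> _ [[x v] [[/= cx ex] Ox] <-]; rewrite /= row_mxKl; exists x.
by apply: (@Ck_lsub R k m n _ (fun y => f (cinv c y))); exact: sf.
Qed.

Lemma smooth_on_dual_ev c e k : atlas c -> frames e ->
  @smooth_on _ _ N (cdom (dual_chart c e)) (fun a => @dual_ev _ _ _ _ A a (tnth (fsec e (projT1 a)) k)).
Proof.
move=> Ac fe; apply: (smooth_on_congr (mopen_dual_dom Ac fe)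
    (f := fun a => cfun (dual_chart c e) a 0 (rshift m k))).
  by move=> a [_ /= ea]; rewrite row_mxEr mxE coord_dual.
by apply: smooth_on_coord; exact: atlas_dual_chart.
Qed.

Variable psi : forall a : N, 'Hom(A (projT1 a), R^o).
Hypothesis psi_smooth : forall c e i, atlas c -> frames e ->
  @smooth_on _ _ N (cdom (dual_chart c e)) (fun a => psi a (tnth (fsec e (projT1 a)) i)).

(** A map [psi] from the total space to covectors over the same base point is the same thing as a
    vertical field. The tautological map gives the Liouville field, and [phi] composed with the
    projection gives its vertical lift. *)
Definition vertical_form c e (F : Cinf N) a : R :=
  \sum_(i < n) psi a (tnth (fsec e (projT1 a)) i) * dpart (dual_chart c e) (rshift m i) F a.

(** The value mentions neither [c] nor [e]; with the vanishing on pulled back functions, this makes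
    the local forms agree on overlaps. *)
Lemma vertical_form_tilde c e mu a : atlas c -> frames e -> cdom (dual_chart c e) a ->
  vertical_form c e (tilde mu) a = psi a (mu (projT1 a)).
Proof.
move=> Ac fe ca; rewrite [mu _](frame_coord _ fe ca.2) linear_sum; apply: eq_bigr => i _.
by rewrite linearZ dpart_tilde_fibre // mulrC.
Qed.

Lemma vertical_form_pull c e f a : atlas c -> frames e -> cdom (dual_chart c e) a ->
  vertical_form c e (pull f) a = 0.
Proof. by move=> Ac fe ca; rewrite /vertical_form big1 // => i _; rewrite dpart_pull_fibre // mulr0. Qed.

Lemma tangential_vertical_form c e a : atlas c -> frames e -> cdom (dual_chart c e) a ->
  tangential a (fun F => vertical_form c e F a).
Proof.
move=> Ac fe ca; apply: tangential_sum => i; apply: tangentialZ.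
by apply: tangential_dpart => //; exact: atlas_dual_chart.
Qed.

Lemma vertical_field_exists : exists X : vfield N, forall c e, atlas c -> frames e ->
  forall a F, cdom (dual_chart c e) a -> X F a = vertical_form c e F a.
Proof.
have H a : exists ce : chart R M m * frame n A,
    [/\ atlas ce.1, frames ce.2 & cdom (dual_chart ce.1 ce.2) a].
  by have [c [e ?]] := dual_chart_cover a; exists (c, e).
have [ce ceP] := choice H.
have E c e F a : atlas c -> frames e -> cdom (dual_chart c e) a ->
    vertical_form (ce a).1 (ce a).2 F a = vertical_form c e F a.
  move=> Ac fe ca; have [Ac' fe' ca'] := ceP a.
  apply: (tangential_eq (tangential_vertical_form Ac' fe' ca') (tangential_vertical_form Ac fe ca)).
    by move=> mu; rewrite !vertical_form_tilde.
  by move=> f; rewrite !vertical_form_pull.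
have [|X XE] := @vfield_of_local R _ N (fun F a => vertical_form (ce a).1 (ce a).2 F a).
  move=> _ a [c [_ [Ac [e fe ->] ->]]] ca.
  exists (cdom (dual_chart c e)), (fun j b => match fintype.split j with
    inl _ => 0 | inr i => psi b (tnth (fsec e (projT1 b)) i) end); split.
  - exact: mopen_dual_dom.
  - by split.
  - move=> j; case: (fintype.split j) => [_|i]; first exact: smooth_on_cst.
    exact: psi_smooth.
  - move=> b F cb; rewrite (E c e) // /vertical_form [RHS]big_split_ord /= [X in _ = X + _]big1 ?add0r => [|l _].
      by apply: eq_bigr => i _; rewrite (unsplitK (inr i)).
    by rewrite (unsplitK (inl l)) mul0r.
by exists X => c e Ac fe a F ca; rewrite XE; exact: E.
Qed.

End VerticalFields.

(** * The linear Poisson structure *)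

(** It passes from the sum of wedges over [i < j], as in the local Poisson formula, to the full
    coefficient matrix of a [bivector]. *)
Lemma sum_lt_antisym (K : numDomainType) n (s : 'I_n -> 'I_n -> K) (u v : 'I_n -> K) :
  (forall i j, s i j = - s j i) ->
  \sum_(i < n) \sum_(j < n | (i < j)%N) s i j * (u i * v j - v i * u j) =
  \sum_i \sum_j s i j * (u i * v j).
Proof.
move=> sA; have s0 i : s i i = 0.
  by have /eqP := sA i i; rewrite -subr_eq0 opprK -mulr2n mulrn_eq0 /= => /eqP.
have -> : \sum_i \sum_j s i j * (u i * v j) =
    \sum_(i < n) \sum_(j < n | (i < j)%N) s i j * (u i * v j) +
    \sum_(i < n) \sum_(j < n | (j < i)%N) s i j * (u i * v j).
  rewrite -big_split; apply: eq_bigr => i _ /=.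
  rewrite (bigID (fun j : 'I_n => (i < j)%N)) /=; congr (_ + _).
  rewrite (bigD1 i) ?ltnn //= s0 mul0r add0r; apply: eq_bigl => j.
  by rewrite -leqNgt ltn_neqAle andbC.
rewrite [X in _ + X](exchange_big_dep predT) //= -big_split; apply: eq_bigr => i _ /=.
rewrite -big_split; apply: eq_bigr => j _ /=.
by rewrite mulrBr (sA j i) mulNr [u j * v i]mulrC.
Qed.

Lemma sum_delta (K : pzRingType) n (s : 'I_n -> 'I_n -> K) (p q : 'I_n) :
  \sum_i \sum_j s i j * ((p == i)%:R * (q == j)%:R) = s p q.
Proof.
rewrite (bigD1 p) //= (bigD1 q) //= !eqxx !mulr1 big1 => [|j /negbTE jq].
  rewrite addr0 big1 ?addr0 // => i /negbTE ip; rewrite big1 // => j _.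
  by rewrite eq_sym ip mul0r mulr0.
by rewrite [q == j]eq_sym jq !mulr0.
Qed.

Section PoissonForm.
Variables (R : realType) (m : nat) (M : manifold R m) (n : nat) (A : vbundle M n).
Variable L : lie_algebroid A.
Local Notation N := (total_space (dual_bundle A)).
Local Notation pull := (pullback (dual_bundle A)).
Local Notation br := (lbr L).
Local Notation rho := (anchor_vf (anchor L)).
Local Notation ev a v := (@dual_ev R m M n A a v).

(** Skew symmetry brings each argument in turn into the first slot, where a tangent functional is
    determined by its values on generators. *)
Lemma skew_biderivation_eq (a : N) (B B' : Cinf N -> Cinf N -> R) :
  (forall G, tangential a (fun F => B F G)) -> (forall G, tangential a (fun F => B' F G)) ->
  (forall F G, B F G = - B G F) -> (forall F G, B' F G = - B' G F) ->
  (forall mu eta, B (tilde mu) (tilde eta) = B' (tilde mu) (tilde eta)) ->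
  (forall mu f, B (tilde mu) (pull f) = B' (tilde mu) (pull f)) ->
  (forall f g, B (pull f) (pull g) = B' (pull f) (pull g)) ->
  forall F G, B F G = B' F G.
Proof.
move=> tB tB' BC BC' tt tp pp F G.
apply: (tangential_eq (tB G) (tB' G)) => [mu|f]; rewrite BC BC'; congr (- _).
  by apply: (tangential_eq (tB _) (tB' _)) => [eta|g]; rewrite ?tt // BC BC' tp.
by apply: (tangential_eq (tB _) (tB' _)) => [eta|g].
Qed.

Definition poisson_form (c : chart R M m) (e : frame n A)
    (cs : 'I_n -> 'I_n -> 'I_n -> M -> R) (rs : 'I_n -> 'I_m -> M -> R) (F G : Cinf N) (a : N) : R :=
  \sum_(i < n) \sum_(j < n | (i < j)%N) \sum_(k < n)
    cs i j k (projT1 a) * ev a (tnth (fsec e (projT1 a)) k) *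
    coord_wedge (dual_chart c e) (rshift m i) (rshift m j) F G a
  + \sum_(i < n) \sum_(l < m)
    rs i l (projT1 a) *
    coord_wedge (dual_chart c e) (rshift m i) (lshift n l) F G a.

Section AtPoint.
Variables (c : chart R M m) (e : frame n A) (a : N).
Variables (cs : 'I_n -> 'I_n -> 'I_n -> M -> R) (rs : 'I_n -> 'I_m -> M -> R).
Hypotheses (Ac : atlas c) (fe : frames e) (ca : cdom (dual_chart c e) a).
Hypothesis sf : structure_functions L c e cs rs.
Hypothesis csA : forall i j k x, cs i j k x = - cs j i k x.
Local Notation P F G := (poisson_form c e cs rs F G a).
Local Notation d := (dpart (dual_chart c e)).
Local Notation x := (projT1 a).

Lemma poisson_formE F G : P F G =
  \sum_i \sum_j (\sum_k cs i j k x * ev a (tnth (fsec e x) k)) *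
    (d (rshift m i) F a * d (rshift m j) G a)
  + \sum_i \sum_l rs i l x * (d (rshift m i) F a * d (lshift n l) G a
      - d (rshift m i) G a * d (lshift n l) F a).
Proof.
rewrite -sum_lt_antisym => [|i j].
  congr (_ + _); apply: eq_bigr => i _; apply: eq_bigr => j _.
  by rewrite big_distrl.
by rewrite -sumrN; apply: eq_bigr => k _; rewrite csA mulNr.
Qed.

Lemma poisson_formC F G : P F G = - P G F.
Proof.
rewrite /poisson_form opprD -!sumrN; congr (_ + _); apply: eq_bigr => i _; rewrite -sumrN.
  apply: eq_bigr => j _; rewrite -sumrN; apply: eq_bigr => k _.
  by rewrite -mulrN /coord_wedge opprB.
by apply: eq_bigr => l _; rewrite -mulrN /coord_wedge opprB.
Qed.

Lemma tangential_poisson_form G : tangential a (fun F => P F G).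
Proof.
have AC := atlas_dual_chart Ac fe.
have H i j : tangential a (fun F => coord_wedge (dual_chart c e) i j F G a).
  apply: tangentialD.
    apply: tangential_ext (tangentialZ (d j G a) (tangential_dpart i AC ca)) _ => F.
    exact: mulrC.
  exact: tangentialN (tangentialZ (d i G a) (tangential_dpart j AC ca)).
apply: tangentialD; apply: tangential_sum => i; apply: tangential_sum => j.
  by apply: tangential_sum => k; exact: tangentialZ.
exact: tangentialZ.
Qed.

Lemma poisson_form_pull_pull f g : P (pull f) (pull g) = 0.
Proof.
rewrite poisson_formE !big1 ?addr0 // => i _; rewrite big1 // => j _;
by rewrite !dpart_pull_fibre // !mul0r ?subr0 mulr0.
Qed.

Lemma poisson_form_tilde_pull mu f : P (tilde mu) (pull f) = rho mu f x.
Proof.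
rewrite poisson_formE big1 ?add0r => [|i _]; last first.
  by rewrite big1 // => j _; rewrite dpart_pull_fibre // !mulr0.
rewrite /= (frame_coord (mu x) fe ca.2) anc_sum; apply: eq_bigr => i _.
rewrite (sf ca.1 ca.2).2 big_distrr; apply: eq_bigr => l _ /=.
by rewrite dpart_tilde_fibre // dpart_pull_base // dpart_pull_fibre // mul0r subr0 mulrCA.
Qed.

Lemma poisson_form_tilde mu eta : P (tilde mu) (tilde eta) = tilde (br mu eta) a.
Proof.
(* The difference [T] is bilinear over the functions on [M], so it suffices to
   test it on a local frame. *)
pose T mu eta := P (tilde mu) (tilde eta) - tilde (br mu eta) a.
suff T0 : T mu eta = 0 by apply/eqP; rewrite -subr_eq0; apply/eqP.
have tP G := tangential_poisson_form G.
have TA nu1 nu2 : T nu1 nu2 = - T nu2 nu1.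
  by rewrite /T poisson_formC (lbr_anti L nu1) tildeN [RHS]opprD.
have TD nu1 nu2 nu : T (nu1 + nu2) nu = T nu1 nu + T nu2 nu.
  by rewrite /T tildeD (tanD (tP _)) lbrDl tildeD [tilde _ a]/= opprD addrACA.
(* The derivative of [f] along the anchor of [nu] comes once from the mixed bracket and once from
   the Leibniz rule, and the two cancel in the difference. *)
have TZ f nu1 nu : T (f *: nu1) nu = f x * T nu1 nu.
  rewrite /T tildeZ (tanM (tP _)) lbrZl tildeD tildeN !tildeZ (poisson_formC (pull f)).
  rewrite poisson_form_tilde_pull /=; ring.
have Tnear (nu1 nu2 nu : section A) : germ_eq x nu1 nu2 -> T nu1 nu = T nu2 nu.
  move=> mm; rewrite /T (tan_near (tP _) (tilde_near mm)); congr (_ - _).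
  by rewrite /= (lbr_near L mm (eta' := nu)) //; exists setT => //; split=> //; exact: mopenT.
have [V [s [oV Vx VO sE sec]]] := frame_ext fe ca.2.
have TS nu1 nu : (forall i, T (s i) nu = 0) -> T nu1 nu = 0.
  move=> Ts; have [f [_ fE]] := sec nu1.
  rewrite (Tnear _ (\sum_i f i *: s i)); last by exists V.
  elim/big_ind: _ => [|s1 s2 E1 E2|i _]; last by rewrite TZ Ts mulr0.
    by apply: (addIr (T 0 nu)); rewrite -TD !add0r.
  by rewrite TD E1 E2 addr0.
apply: (TS) => i; rewrite TA TS ?oppr0 // => j; apply/eqP; rewrite subr_eq0; apply/eqP.
have sg k : germ_eq x (s k) (fun y => tnth (fsec e y) k) by exists V => // y; exact: sE.
have ds k I : d I (tilde (s k)) a = (rshift m k == I)%:R by exact: dpart_tilde_frame.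
(* The structure functions are tied to some extensions [mu1] and [mu2] of the frame; locality of the
   bracket exchanges them for [s j] and [s i]. *)
have [mu1 [mu2 [mu1E mu2E muE]]] := (sf ca.1 ca.2).1 j i.
have -> : tilde (br (s j) (s i)) a = \sum_k cs j i k x * ev a (tnth (fsec e x) k).
  rewrite /= (lbr_near L (mu' := mu1) (eta' := mu2)) -?muE.
  - by rewrite linear_sum; apply: eq_bigr => k _; rewrite linearZ.
  - have [W [oW Wx] WE] := mu1E; exists (V `&` W); first by split=> //; exact: mopenI.
    by move=> y [Vy Wy]; rewrite sE // WE.
  - have [W [oW Wx] WE] := mu2E; exists (V `&` W); first by split=> //; exact: mopenI.
    by move=> y [Vy Wy]; rewrite sE // WE.
rewrite poisson_formE [X in _ + X]big1 ?addr0 => [|k _]; last first.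
  by rewrite big1 // => l _; rewrite !ds !eq_rlshift !mulr0 subrr mulr0.
rewrite -[RHS](sum_delta (fun h k => \sum_l cs h k l x * ev a (tnth (fsec e x) l)) j i).
apply: eq_bigr => h _; apply: eq_bigr => k _.
by rewrite !ds !(inj_eq (@rshift_inj _ _)).
Qed.

End AtPoint.

Lemma linear_bivector_exists : exists P : bivector N,
  [/\ forall c e, atlas c -> frames e -> exists cs rs, structure_functions L c e cs rs /\
        forall a F G, cdom (dual_chart c e) a -> P F G a = poisson_form c e cs rs F G a,
      forall mu eta, P (tilde mu) (tilde eta) = tilde (br mu eta),
      forall mu f, P (tilde mu) (pull f) = pull (rho mu f) &
      forall f g, P (pull f) (pull g) = 0].
Proof.
pose CE : Type := (chart R M m * frame n A)%type.
pose SF : Type := (('I_n -> 'I_n -> 'I_n -> M -> R) * ('I_n -> 'I_m -> M -> R))%type.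
(* Structure functions are fixed once for each pair of a chart and a frame; the zeros given to other
   pairs are defaults. *)
have H (ce : CE) : exists S : SF, atlas ce.1 -> frames ce.2 ->
    [/\ structure_functions L ce.1 ce.2 S.1 S.2,
      forall i j k, smooth_on (cdom ce.1 `&` fdom ce.2) (S.1 i j k),
      forall i l, smooth_on (cdom ce.1 `&` fdom ce.2) (S.2 i l) &
      forall i j k x, S.1 i j k x = - S.1 j i k x].
  have [Ac|nA] := pselect (atlas ce.1); last by exists ((fun _ _ _ _ => 0), (fun _ _ _ => 0)).
  have [fe|nf] := pselect (frames ce.2); last by exists ((fun _ _ _ _ => 0), (fun _ _ _ => 0)).
  by have [cs [rs ?]] := structure_functions_exist L Ac fe; exists (cs, rs).
have {H} [S SP] := choice H.
have H (a : N) : exists ce : CE, [/\ atlas ce.1, frames ce.2 & cdom (dual_chart ce.1 ce.2) a].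
  by have [c [e ?]] := dual_chart_cover a; exists (c, e).
have {H} [ce ceP] := choice H.
pose Q (ce : CE) F G a := poisson_form ce.1 ce.2 (S ce).1 (S ce).2 F G a.
have E (ce1 ce2 : CE) F G a : atlas ce1.1 -> frames ce1.2 -> cdom (dual_chart ce1.1 ce1.2) a ->
    atlas ce2.1 -> frames ce2.2 -> cdom (dual_chart ce2.1 ce2.2) a ->
    Q ce1 F G a = Q ce2 F G a.
  move=> A1 f1 c1 A2 f2 c2; have [s1 _ _ a1] := SP _ A1 f1; have [s2 _ _ a2] := SP _ A2 f2.
  apply: (@skew_biderivation_eq a (fun F G => Q ce1 F G a) (fun F G => Q ce2 F G a)).
  - by move=> G'; exact: tangential_poisson_form.
  - by move=> G'; exact: tangential_poisson_form.
  - by move=> F' G'; exact: poisson_formC.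
  - by move=> F' G'; exact: poisson_formC.
  - by move=> mu eta; rewrite /Q !poisson_form_tilde.
  - by move=> mu f; rewrite /Q !poisson_form_tilde_pull.
  - by move=> f g; rewrite /Q !poisson_form_pull_pull.
have [|P PE] := @bivector_of_local R _ N (fun F G a => Q (ce a) F G a).
  move=> _ a [c [_ [Ac [e fe ->] ->]]] ca.
  have [sf scs srs csA] := SP (c, e) Ac fe; rewrite /= in sf scs srs csA.
  set cs := (S (c, e)).1 in sf scs csA *; set rs := (S (c, e)).2 in sf srs *.
  pose S2 i j (b : N) := \sum_k cs i j k (projT1 b) * ev b (tnth (fsec e (projT1 b)) k).
  have sS i j : smooth_on (cdom (dual_chart c e)) (S2 i j).
    apply: smooth_on_sum => [|k]; first exact: mopen_dual_dom.
    apply: smooth_on_mul; [exact: mopen_dual_dom|exact: (smooth_on_pull (scs i j k))|exact: smooth_on_dual_ev].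
  have SA i j b : S2 i j b = - S2 j i b.
    by rewrite /S2 -sumrN; apply: eq_bigr => k _; rewrite csA mulNr.
  (* The coefficient matrix in blocks: zero on base directions, plus or minus the anchor on mixed
     ones, the fibrewise linear functions [S2] on fibre directions. *)
  pose B (I J : 'I_(m + n)) (b : N) := match fintype.split I, fintype.split J with
    | inr i, inr j => S2 i j b
    | inr i, inl l => rs i l (projT1 b)
    | inl l, inr i => - rs i l (projT1 b)
    | inl _, inl _ => 0 end.
  have Bll l l' b : B (lshift n l) (lshift n l') b = 0.
    by rewrite /B (unsplitK (inl l)) (unsplitK (inl l')).
  have Blr l i b : B (lshift n l) (rshift m i) b = - rs i l (projT1 b).
    by rewrite /B (unsplitK (inl l)) (unsplitK (inr i)).
  have Brl i l b : B (rshift m i) (lshift n l) b = rs i l (projT1 b).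
    by rewrite /B (unsplitK (inl l)) (unsplitK (inr i)).
  have Brr i j b : B (rshift m i) (rshift m j) b = S2 i j b.
    by rewrite /B (unsplitK (inr j)) (unsplitK (inr i)).
  exists (cdom (dual_chart c e)), B; split.
  - exact: mopen_dual_dom.
  - by split.
  - move=> I J; rewrite /B; case: (fintype.split I) => i; case: (fintype.split J) => j.
    + by split=> [|y _]; [exact: smooth_on_cst|rewrite oppr0].
    + split=> [|y _] //; apply: smooth_on_opp; first exact: mopen_dual_dom.
      exact: (smooth_on_pull (srs j i)).
    + by split=> [|y _]; [exact: (smooth_on_pull (srs i j))|rewrite opprK].
    + by split=> [|y _]; [exact: sS|exact: SA].
  - move=> b F G cb; have [A' f' c'] := ceP b.
    rewrite (E _ (c, e)) // /Q poisson_formE // [RHS]big_split_ord /=.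
    rewrite [X in _ = X + _](eq_bigr (fun l => \sum_i rs i l (projT1 b) *
      - (dpart (dual_chart c e) (rshift m i) G b * dpart (dual_chart c e) (lshift n l) F b)))
      => [|l _]; last first.
      rewrite big_split_ord /= big1 ?add0r => [|l' _]; last by rewrite Bll mul0r.
      by apply: eq_bigr => i _; rewrite Blr mulNr mulrN; congr (- (_ * _)); exact: mulrC.
    rewrite [X in _ = _ + X](eq_bigr (fun i => \sum_l rs i l (projT1 b) *
      (dpart (dual_chart c e) (rshift m i) F b * dpart (dual_chart c e) (lshift n l) G b) +
      \sum_j S2 i j b *
      (dpart (dual_chart c e) (rshift m i) F b * dpart (dual_chart c e) (rshift m j) G b)))
      => [|i _]; last first.
      rewrite big_split_ord /=; congr (_ + _); apply: eq_bigr => k _; first by rewrite Brl.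
      by rewrite Brr.
    rewrite big_split /= addrA [RHS]addrC; congr (_ + _).
    rewrite [X in _ = X + _]exchange_big -big_split; apply: eq_bigr => i _ /=.
    by rewrite -big_split; apply: eq_bigr => l _ /=; rewrite -mulrDr addrC.
have EP c e a F G : atlas c -> frames e -> cdom (dual_chart c e) a ->
    P F G a = poisson_form c e (S (c, e)).1 (S (c, e)).2 F G a.
  move=> Ac fe ca; rewrite PE; have [A' f' c'] := ceP a.
  exact: (E _ (c, e)).
have Pgen (F G H : Cinf N) : (forall c e a, atlas c -> frames e -> cdom (dual_chart c e) a ->
    poisson_form c e (S (c, e)).1 (S (c, e)).2 F G a = H a) -> P F G = H.
  move=> PH; apply: cinf_eq => a; have [A' f' c'] := ceP a.
  by rewrite (EP _ _ a F G A' f' c') PH.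
exists P; split.
- move=> c e Ac fe; have [sf _ _ _] := SP (c, e) Ac fe.
  exists (S (c, e)).1, (S (c, e)).2; split; first exact: sf.
  by move=> a F G ca; exact: EP.
- move=> mu eta; apply: Pgen => c e a Ac fe ca; have [sf _ _ csA] := SP (c, e) Ac fe.
  exact: poisson_form_tilde.
- move=> mu f; apply: Pgen => c e a Ac fe ca; have [sf _ _ csA] := SP (c, e) Ac fe.
  exact: poisson_form_tilde_pull.
- move=> f g; apply: Pgen => c e a Ac fe ca; have [sf _ _ csA] := SP (c, e) Ac fe.
  exact: poisson_form_pull_pull.
Qed.

End PoissonForm.

(** * Schouten identities on generators *)

Section Derivations.
Variables (R : realType) (p : nat) (N : manifold R p) (P : bivector N) (X : vfield N).
Implicit Types F G H : Cinf N.

Lemma vfD F G : X (F + G) = X F + X G.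
Proof. by apply: cinf_eq => x; exact: (tanD (tangential_vf X x)). Qed.
Lemma vfN F : X (- F) = - X F.
Proof. by apply: cinf_eq => x; exact: (tanN (tangential_vf X x)). Qed.
Lemma vfM F G : X (F * G) = F * X G + G * X F.
Proof. by apply: cinf_eq => x; exact: (tanM (tangential_vf X x)). Qed.
Lemma vf0 : X 0 = 0.
Proof. by apply: cinf_eq => x; exact: (tan_cst (tangential_vf X x)). Qed.

Lemma bvDl F G H : P (F + G) H = P F H + P G H.
Proof. by apply: cinf_eq => x; exact: (tanD (tangential_bvl P H x)). Qed.
Lemma bvNl F H : P (- F) H = - P F H.
Proof. by apply: cinf_eq => x; exact: (tanN (tangential_bvl P H x)). Qed.
Lemma bvMl F G H : P (F * G) H = F * P G H + G * P F H.
Proof. by apply: cinf_eq => x; exact: (tanM (tangential_bvl P H x)). Qed.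
Lemma bv0l H : P 0 H = 0.
Proof. by apply: cinf_eq => x; exact: (tan_cst (tangential_bvl P H x)). Qed.
Lemma bvNr F H : P F (- H) = - P F H.
Proof. by rewrite bvC bvNl -bvC. Qed.

Lemma tangential_schouten22 F G x : tangential x (fun H => schouten22 P P F G H x).
Proof.
have t : tangential x (fun H => P (P F G) H x + (P G (P F H) x - P F (P G H) x)).
  apply: tangentialD; first exact: tangential_bvr.
  exact: (tangential_commutator (hamiltonian P G) (hamiltonian P F)).
have E H : P (P F G) H x + (P G (P F H) x - P F (P G H) x) =
    (P (P F G) H + P (P G H) F + P (P H F) G) x.
  rewrite [P (P G H) F]bvC [P (P H F) G]bvC [P H F]bvC bvNr opprK /=; ring.
by apply: tangential_ext (tangentialD t t) _ => H; rewrite E.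
Qed.

Lemma tangential_wedge12 F G x : tangential x (fun H => wedge12 X P F G H x).
Proof.
apply: tangentialD; first apply: tangentialD.
- exact: tangentialZ (tangential_bvr P G x).
- exact: tangentialZ (tangential_bvl P F x).
- apply: tangential_ext (tangentialZ (P F G x) (tangential_vf X x)) _ => H; exact: mulrC.
Qed.

(** As an operator on [G] this is the commutator of [X] with the Hamiltonian field of [F], minus the
    Hamiltonian field of [X F], hence of first order. *)
Lemma tangential_schouten12 F x : tangential x (fun G => schouten12 X P F G x).
Proof.
have t : tangential x (fun G => X (P F G) x - P F (X G) x - P (X F) G x).
  apply: tangentialD; first exact: (tangential_commutator X (hamiltonian P F)).
  exact: tangentialN (tangential_bvr P (X F) x).
by apply: tangential_ext t _ => G; rewrite /schouten12 [P (X G) F]bvC /=; ring.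
Qed.

Lemma schouten12C F G : schouten12 X P F G = - schouten12 X P G F.
Proof. by rewrite /schouten12 [P F G]bvC vfN; ring. Qed.

End Derivations.

(** * Jacobi equations for fields prescribed on generators *)

Section LinearJacobi.
Variables (R : realType) (m : nat) (M : manifold R m) (n : nat) (A : vbundle M n).
Variables (L : lie_algebroid A) (phi : section (dual_bundle A)).
Local Notation N := (total_space (dual_bundle A)).
Local Notation pull := (pullback (dual_bundle A)).
Local Notation br := (lbr L).
Local Notation rho := (anchor_vf (anchor L)).
Local Notation fi mu := (pairing phi mu).

Definition generator (F : Cinf N) := (exists mu, F = tilde mu) \/ (exists f, F = pull f).

Lemma vanish_on_generators (T : Cinf N -> Cinf N) :
  (forall x, tangential x (fun H => T H x)) ->
  (forall H, generator H -> T H = 0) -> forall H, T H = 0.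
Proof.
move=> tT T0 H; apply: cinf_eq => x; apply: (tangential_span (tT x)) => [mu|f].
  by rewrite T0 //; left; exists mu.
by rewrite T0 //; right; exists f.
Qed.

(** Tangentiality is available in the last slot only; cyclic invariance rotates each argument into
    it. *)
Lemma cyclic_vanish (T : Cinf N -> Cinf N -> Cinf N -> Cinf N) :
  (forall F G x, tangential x (fun H => T F G H x)) ->
  (forall F G H, T F G H = T G H F) ->
  (forall F G H, generator F -> generator G -> generator H -> T F G H = 0) ->
  forall F G H, T F G H = 0.
Proof.
move=> tT cT T0 F G; apply: vanish_on_generators => // H gH; rewrite -cT.
move: G; apply: (vanish_on_generators (T := T H F)) => // K gK; rewrite -cT.
move: F; apply: (vanish_on_generators (T := T K H)) => // J gJ; exact: T0.
Qed.

Hypothesis hphi : cocycle L phi.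
Variables (P : bivector N) (X : vfield N).
Hypothesis Ptt : forall mu eta, P (tilde mu) (tilde eta) =
  tilde (br mu eta) + tilde mu * pull (fi eta) - tilde eta * pull (fi mu).
Hypothesis Ptp : forall mu f, P (tilde mu) (pull f) = pull (rho mu f).
Hypothesis Ppp : forall f g, P (pull f) (pull g) = 0.
Hypothesis Xt : forall mu, X (tilde mu) = - pull (fi mu).
Hypothesis Xp : forall f, X (pull f) = 0.

Lemma Ppt f mu : P (pull f) (tilde mu) = - pull (rho mu f).
Proof. by rewrite bvC Ptp. Qed.

(** The iterated bracket is put in the form with [nu] outermost, so that the cyclic sum matches
    [lbr_jacobi]. *)
Lemma Pttt mu eta nu : P (P (tilde mu) (tilde eta)) (tilde nu) =
  - tilde (br nu (br mu eta)) + tilde (br mu eta) * pull (fi nu)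
  - tilde nu * pull (fi (br mu eta))
  - tilde mu * pull (rho nu (fi eta)) + tilde eta * pull (rho nu (fi mu))
  + pull (fi eta) * P (tilde mu) (tilde nu)
  - pull (fi mu) * P (tilde eta) (tilde nu).
Proof.
rewrite {1}Ptt !bvDl bvNl !bvMl !Ppt [P (tilde (br mu eta)) _]Ptt (lbr_anti L (br mu eta)) tildeN.
ring.
Qed.

(** Only the values of [P] and [X] on generators enter, so the lemma serves twice: for the Poisson
    structure, with zero cocycle and zero [X], and for the Jacobi structure. On three linear
    functions it rests on the Jacobi identity and the cocycle condition, on two linear functions and
    a basic one on the anchor being a homomorphism. *)
Lemma linear_jacobi_LL F G H : schouten22 P P F G H = wedge12 X P F G H *+ 2.
Proof.
apply/eqP; rewrite -subr_eq0; apply/eqP; move: F G H.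
have S22 F G H : schouten22 P P F G H = (P (P F G) H + P (P G H) F + P (P H F) G) *+ 2.
  by rewrite mulr2n.
apply: cyclic_vanish => [F G x|F G H|F G H].
- apply: tangentialD; first exact: tangential_schouten22.
  apply: tangentialN; apply: tangential_ext (tangentialD (tangential_wedge12 P X F G x)
    (tangential_wedge12 P X F G x)) _ => H; by rewrite mulr2n.
- by rewrite /schouten22 /wedge12; ring.
rewrite S22 /wedge12 -mulrnBl.
pose Z F G H := P (P F G) H + P (P G H) F + P (P H F) G
  - (X F * P G H + X G * P H F + X H * P F G).
have Zc F' G' H' : Z F' G' H' = Z G' H' F' by rewrite /Z; ring.
have Zttt mu eta nu : Z (tilde mu) (tilde eta) (tilde nu) = 0.
  have J : tilde (br nu (br mu eta)) =
      - tilde (br mu (br eta nu)) - tilde (br eta (br nu mu)).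
    apply/eqP; rewrite -subr_eq0 -opprD opprK -!tildeD addrC lbr_jacobi.
    by apply/eqP/cinf_eq => a; rewrite /= linear0.
  rewrite /Z !Pttt !Xt !Ptt !hphi !pullD !pullN J.
  rewrite (lbr_anti L mu nu) (lbr_anti L eta mu) (lbr_anti L nu eta) !tildeN; ring.
have Zttp mu eta f : Z (tilde mu) (tilde eta) (pull f) = 0.
  rewrite /Z !Xt Xp !Ptt Ptp !bvDl !bvNl !bvMl !Ppt !bvNl !Ppt !Ptp !Ppp anchor_lbr !pullD !pullN.
  by ring.
have Ztpp mu f g : Z (tilde mu) (pull f) (pull g) = 0.
  by rewrite /Z !Xt !Xp Ptp !Ppt !Ppp !bvNl !Ppp bv0l; ring.
have Zppp f g h : Z (pull f) (pull g) (pull h) = 0.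
  by rewrite /Z !Xp !Ppp !bv0l; ring.
move=> gF gG gH; rewrite -[X in X *+ 2]/(Z F G H); suff -> : Z F G H = 0 by rewrite mul0rn.
(* Up to rotation only the number of linear arguments matters; the four cases left after the direct
   ones are rotated by [Zc]. *)
case: gF gG gH => [[mu ->]|[f ->]] [[eta ->]|[g ->]] [[nu ->]|[h ->]] //.
- by rewrite -Zc.
- by rewrite Zc.
- by rewrite Zc.
- by rewrite -Zc.
Qed.

(** On two linear functions the expression is [rho mu (phi eta) - rho eta (phi mu) - phi [mu, eta]],
    which is the cocycle condition itself. The other pairs give zero because [X] kills basic
    functions and sends linear ones to basic ones. *)
Lemma linear_jacobi_EL F G : schouten12 X P F G = 0.
Proof.
move: G; apply: vanish_on_generators => [x|G gG]; first exact: tangential_schouten12.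
apply/eqP; rewrite schouten12C oppr_eq0; apply/eqP.
move: F; apply: vanish_on_generators => [x|F gF]; first exact: tangential_schouten12.
have tp mu f : schouten12 X P (tilde mu) (pull f) = 0.
  by rewrite /schouten12 Ptp Xt !Xp bvNl Ppp bv0l; ring.
case: gF gG => [[mu ->]|[f ->]] [[eta ->]|[g ->]] //.
- rewrite /schouten12 Ptt !Xt !vfD !vfN !vfM !Xt !Xp hphi !bvNl !Ppt !pullD !pullN; ring.
- by rewrite schouten12C tp oppr0.
- by rewrite /schouten12 Ppp !Xp vf0 !bv0l; ring.
Qed.

End LinearJacobi.

(** * Existence of the three fields and uniqueness of the Jacobi structure *)

Section Assembly.
Variables (R : realType) (m : nat) (M : manifold R m) (n : nat) (A : vbundle M n).
Variables (L : lie_algebroid A) (phi : section (dual_bundle A)).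
Local Notation N := (total_space (dual_bundle A)).
Local Notation pull := (pullback (dual_bundle A)).
Local Notation br := (lbr L).
Local Notation rho := (anchor_vf (anchor L)).
Local Notation fi mu := (pairing phi mu).

Lemma liouville_exists : exists D : vfield N,
  [/\ liouville D, forall mu, D (tilde mu) = tilde mu & forall f, D (pull f) = 0].
Proof.
have [D DE] := @vertical_field_exists R m M n A (fun a => projT2 a)
  (fun c e i Ac fe => smooth_on_dual_ev i Ac fe).
exists D; split=> [c e Ac fe a F ca|mu|f]; first exact: DE.
  apply: cinf_eq => a; have [c [e [Ac fe ca]]] := dual_chart_cover a.
  by rewrite (DE c e) // vertical_form_tilde.
apply: cinf_eq => a; have [c [e [Ac fe ca]]] := dual_chart_cover a.
by rewrite (DE c e) // vertical_form_pull.
Qed.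

Lemma vertical_lift_exists : exists V : vfield N,
  [/\ vertical_lift phi V, forall mu, V (tilde mu) = pull (fi mu) & forall f, V (pull f) = 0].
Proof.
have s c e i : atlas c -> frames e -> @smooth_on _ _ N (cdom (dual_chart c e))
    (fun a => (phi (projT1 a) : 'Hom(A (projT1 a), R^o)) (tnth (fsec e (projT1 a)) i)).
  move=> Ac fe; have oO : mopen (cdom c `&` fdom e).
    by apply: mopenI; [exact: mopen_dom|exact: frame_open].
  apply: (@smooth_on_pull R m M n A (cdom c `&` fdom e)
    (fun x => (phi x : 'Hom(A x, R^o)) (tnth (fsec e x) i))).
  apply: (smooth_on_congr oO (f := fun x => coord (fsec (dual_frame e) x) i (phi x))).
    by move=> x [_ ex]; rewrite coord_dual.
  apply: (@smooth_on_sub _ _ _ (fdom e)); first by move=> x [].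
  by apply: (secP phi (e := dual_frame e)); exists e.
have [V VE] := @vertical_field_exists R m M n A (fun a => phi (projT1 a)) s.
exists V; split=> [c e Ac fe a F ca|mu|f]; first exact: VE.
  apply: cinf_eq => a; have [c [e [Ac fe ca]]] := dual_chart_cover a.
  by rewrite (VE c e) // vertical_form_tilde.
apply: cinf_eq => a; have [c [e [Ac fe ca]]] := dual_chart_cover a.
by rewrite (VE c e) // vertical_form_pull.
Qed.

(** For the zero cocycle the prescribed values are those of the linear bivector, and with [X = 0]
    the right-hand side of the Schouten identity vanishes. *)
Lemma linear_poisson_exists : exists P : bivector N,
  [/\ linear_poisson L P,
      forall mu eta, P (tilde mu) (tilde eta) = tilde (br mu eta),
      forall mu f, P (tilde mu) (pull f) = pull (rho mu f) &
      forall f g, P (pull f) (pull g) = 0].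
Proof.
have [P [PE Ptt Ptp Ppp]] := linear_bivector_exists L.
exists P; split=> //; split=> // F G H.
have p0 mu : pairing (0 : section (dual_bundle A)) mu = 0.
  by apply: cinf_eq => x; rewrite /= lfunE.
have pull0 : pull 0 = 0 by exact: cinf_eq.
have c0 : cocycle L (0 : section (dual_bundle A)).
  by move=> mu eta; rewrite !p0 !vf0 subrr.
rewrite (@linear_jacobi_LL _ _ _ _ _ L 0 c0 P 0) //.
- by rewrite /wedge12 !mul0r !addr0 mul0rn.
- by move=> mu eta; rewrite Ptt !p0 pull0 !mulr0 subr0 addr0.
- by move=> mu; rewrite p0 pull0 oppr0.
Qed.

Section BracketValues.
Variable J : jacobi_structure N.
Hypothesis lJ : linear_bracket L phi (jacobi_bracket J).

Lemma jac_vf_pull f : jac_vf J (pull f) = 0.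
Proof.
have [_ _ /(_ f 1)] := lJ; rewrite /jacobi_bracket.
rewrite [pull 1](_ : _ = cinf_cst N 1); last exact: cinf_eq.
have -> : jac_bv J (pull f) (cinf_cst N 1) = 0.
  by apply: cinf_eq => x; exact: (tan_cst (tangential_bvr _ _ _)).
have -> : jac_vf J (cinf_cst N 1) = 0.
  by apply: cinf_eq => x; exact: (tan_cst (tangential_vf _ _)).
by rewrite mulr0 !add0r mul1r => /eqP; rewrite oppr_eq0 => /eqP.
Qed.

Lemma jac_vf_tilde mu : jac_vf J (tilde mu) = - pull (fi mu).
Proof.
have [_ /(_ mu 1) + _] := lJ; rewrite /jacobi_bracket.
rewrite [pull 1](_ : _ = cinf_cst N 1); last exact: cinf_eq.
have -> : jac_bv J (tilde mu) (cinf_cst N 1) = 0.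
  by apply: cinf_eq => x; exact: (tan_cst (tangential_bvr _ _ _)).
have -> : jac_vf J (cinf_cst N 1) = 0.
  by apply: cinf_eq => x; exact: (tan_cst (tangential_vf _ _)).
have -> : rho mu 1 = 0.
  by apply: cinf_eq => x; exact: (tan_cst (tangential_vf _ _)).
by rewrite mulr0 !add0r mul1r mulr1 => <-; rewrite opprK.
Qed.

Lemma jac_bv_pull_pull f g : jac_bv J (pull f) (pull g) = 0.
Proof.
have [_ _ /(_ f g)] := lJ; rewrite /jacobi_bracket !jac_vf_pull !mulr0.
by rewrite addr0 subr0.
Qed.

Lemma jac_bv_tilde_pull mu f : jac_bv J (tilde mu) (pull f) = pull (rho mu f).
Proof.
have [_ /(_ mu f) + _] := lJ; rewrite /jacobi_bracket jac_vf_pull jac_vf_tilde.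
rewrite mulr0 addr0 mulrN opprK pullD pullM [pull f * _]mulrC.
exact: addIr.
Qed.

Lemma jac_bv_tilde mu eta : jac_bv J (tilde mu) (tilde eta) =
  tilde (br mu eta) + tilde mu * pull (fi eta) - tilde eta * pull (fi mu).
Proof.
have [/(_ mu eta) <- _ _] := lJ; rewrite /jacobi_bracket !jac_vf_tilde; ring.
Qed.

End BracketValues.

Lemma jacobi_structure_eq (J J' : jacobi_structure N) :
  jac_bv J = jac_bv J' -> jac_vf J = jac_vf J' -> J = J'.
Proof.
case: J J' => [P X p x] [P' X' p' x'] /= PP XX.
by subst P' X'; rewrite (Prop_irrelevance p p') (Prop_irrelevance x x').
Qed.

Lemma linear_bracket_unique (J J' : jacobi_structure N) :
  linear_bracket L phi (jacobi_bracket J) -> linear_bracket L phi (jacobi_bracket J') -> J = J'.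
Proof.
move=> lJ lJ'; apply: jacobi_structure_eq.
  apply: bv_eq => F G; apply: cinf_eq => x.
  apply: (@skew_biderivation_eq _ _ _ _ _ x (fun F G => jac_bv J F G x) (fun F G => jac_bv J' F G x)).
  - by move=> H; exact: tangential_bvl.
  - by move=> H; exact: tangential_bvl.
  - by move=> F' G'; rewrite bvC.
  - by move=> F' G'; rewrite bvC.
  - by move=> mu eta; rewrite !jac_bv_tilde.
  - by move=> mu f; rewrite !jac_bv_tilde_pull.
  - by move=> f g; rewrite !jac_bv_pull_pull.
apply: vf_eq => F; apply: cinf_eq => x.
apply: (tangential_eq (tangential_vf _ x) (tangential_vf _ x)) => [mu|f].
  by rewrite !jac_vf_tilde.
by rewrite !jac_vf_pull.
Qed.

End Assembly.

Theorem theorem1 (R : realType) (m n : nat) (M : manifold R m) (A : vbundle M n)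
    (L : lie_algebroid A) (phi : section (dual_bundle A)) (hphi : cocycle L phi) :
  exists (LambdaA : bivector (total_space (dual_bundle A))) (Delta phiv : vfield (total_space (dual_bundle A))),
    [/\ linear_poisson L LambdaA, liouville Delta, vertical_lift phi phiv &
        exists J : jacobi_structure (total_space (dual_bundle A)),
          [/\ linear_bracket L phi (jacobi_bracket J),
              forall J' : jacobi_structure (total_space (dual_bundle A)),
                linear_bracket L phi (jacobi_bracket J') -> J' = J,
              jac_bv J = LambdaA + vf_wedge Delta phiv &
              jac_vf J = - phiv]].
Proof.
have [P [lP Ptt Ptp Ppp]] := linear_poisson_exists L.
have [D [lD Dt Dp]] := liouville_exists A.
have [V [lV Vt Vp]] := vertical_lift_exists phi.
exists P, D, V; split=> //.
(* Both [D] and [V] kill basic functions, so the wedge alters [P] only on pairs of linear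
   functions. *)
pose Q := P + vf_wedge D V.
have QE F G : Q F G = P F G + (D F * V G - D G * V F) by [].
have Qtt mu eta : Q (tilde mu) (tilde eta) = tilde (lbr L mu eta) +
    tilde mu * pullback _ (pairing phi eta) - tilde eta * pullback _ (pairing phi mu).
  by rewrite QE Ptt !Dt !Vt addrA.
have Qtp mu f : Q (tilde mu) (pullback _ f) = pullback _ (anchor_vf (anchor L) mu f).
  by rewrite QE Ptp Dp Vp mulr0 mul0r subrr addr0.
have Qpp f g : Q (pullback _ f) (pullback _ g) = 0.
  by rewrite QE Ppp !Dp !Vp !mulr0 subrr addr0.
have Xt mu : (- V) (tilde mu) = - pullback _ (pairing phi mu) by rewrite -Vt.
have Xp f : (- V) (pullback _ f) = 0 by apply/eqP; rewrite oppr_eq0 Vp.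
pose J := MkJacobi (linear_jacobi_LL hphi Qtt Qtp Qpp Xt Xp)
  (linear_jacobi_EL hphi Qtt Qtp Qpp Xt Xp).
have lJ : linear_bracket L phi (jacobi_bracket J).
  split=> [mu eta|mu f|f g]; rewrite /jacobi_bracket -[jac_bv J]/Q -[jac_vf J]/(- V).
  - by rewrite Qtt !Xt; ring.
  - by rewrite Qtp Xt Xp pullD pullM; ring.
  - by rewrite Qpp !Xp !mulr0 addr0 subr0.
by exists J; split=> // J' lJ'; exact: linear_bracket_unique lJ' lJ.
Qed.
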